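(* Let $\varphi:\mathbb{D}\to\mathbb{D}$ be a univalent (injective) holomorphic function such that the counting function $n_\varphi$ is essentially radial and $\varphi(0)=0$. Then $\varphi$ is a full map if and only if the composition operator $C_\varphi$ satisfies $$\|C_\varphi:\mathcal{D}_0\to\mathcal{D}_0\|=1.$$
   Context: $\mathbb{D}$ is the open unit disk in $\mathbb{C}$ and $dA=\frac1\pi\,dx\,dy$ is normalized area measure on $\mathbb{D}$. The Dirichlet space $\mathcal{D}$ is the Hilbert space of analytic functions $f$ on $\mathbb{D}$ with $\int_{\mathbb{D}}|f'|^2\,dA<\infty$, with norm $\|f\|_{\mathcal{D}}^2=|f(0)|^2+\int_{\mathbb{D}}|f'(z)|^2\,dA(z)$; $\mathcal{D}_0$ is the subspace of those $f\in\mathcal{D}$ with $f(0)=0$, with the same norm. The composition operator is $C_\varphi f=f\circ\varphi$, and $\|C_\varphi:\mathcal{H}\to\mathcal{H}\|$ denotes its operator norm on the space $\mathcal{H}$. A holomorphic map $\varphi:\mathbb{D}\to\mathbb{D}$ is full if $A[\mathbb{D}\setminus\varphi(\mathbb{D})]=0$. The counting function $n_\varphi(w)$, $w\in\mathbb{D}$, is the cardinality of $\{z\in\mathbb{D}:\varphi(z)=w\}$ when this set is finite, and $\infty$ otherwise. It is essentially radial if there is a function $g:[0,1)\to[0,\infty)$ such that for almost every $r\in[0,1)$, $n_\varphi(re^{i\theta})=g(r)$ for almost every $\theta\in[0,2\pi]$. *)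

(* Defs.v *)
From HB Require Import structures.
From mathcomp Require Import all_boot all_order all_algebra complex.
From mathcomp Require Import all_classical all_reals all_analysis.

Set Implicit Arguments.
Unset Strict Implicit.
Unset Printing Implicit Defensive.

Import Order.TTheory GRing.Theory Num.Theory numFieldNormedType.Exports.

Local Open Scope classical_set_scope.
Local Open Scope ring_scope.

(* Functions on the unit disk are total functions on R[i] of which only the
   values on the disk matter: the derivative, the Dirichlet norm, the image and
   the counting function below never look at values outside of it. *)

Section Dirichlet.
Context {R : realType}.

Definition unit_disk : set R[i] := [set z | `|z| < 1].

(* Complex derivative: R[i]^o is R[i] as a normed module over itself. *)
Definition cderive (f : R[i] -> R[i]) (z : R[i]) : R[i] :=
  derive1 (f : R[i]^o -> R[i]^o) z.

Definition holomorphic_on_disk (f : R[i] -> R[i]) : Prop :=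
  forall z, unit_disk z -> derivable (f : R[i]^o -> R[i]^o) z 1.

Definition complex_of_pair (p : R * R) : R[i] := Complex p.1 p.2.

(* dA = dx dy / pi, a measure on the real coordinates of the plane. *)
Definition darea : set (measurableTypeR R * measurableTypeR R) -> \bar R :=
  mscale (NngNum (eqbRL (invr_ge0 (pi : R)) (pi_ge0 R)))
    (@lebesgue_measure R \x @lebesgue_measure R)%E.

HB.instance Definition _ := Measure.on darea.

Definition area (S : set R[i]) : \bar R := darea (complex_of_pair @^-1` S).

Definition dirichlet_integral (f : R[i] -> R[i]) : \bar R :=
  (\int[darea]_(p in complex_of_pair @^-1` unit_disk)
     (ComplexField.Normc.normc (cderive f (complex_of_pair p)) ^+ 2)%:E)%E.

Definition dirichlet : set (R[i] -> R[i]) :=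
  [set f | holomorphic_on_disk f /\ (dirichlet_integral f < +oo)%E].

Definition dirichlet0 : set (R[i] -> R[i]) :=
  [set f | dirichlet f /\ f 0 = 0].

(* Meaningful for f in dirichlet only, because of fine. *)
Definition dirichlet_norm (f : R[i] -> R[i]) : R :=
  Num.sqrt (ComplexField.Normc.normc (f 0) ^+ 2 + fine (dirichlet_integral f)).

Definition composition_operator (phi f : R[i] -> R[i]) : R[i] -> R[i] :=
  f \o phi.

(* Operator norm, for the Dirichlet norm, of an operator T mapping the subspace
   H of dirichlet to dirichlet; it is +oo when T is unbounded. *)
Definition operator_norm (H : set (R[i] -> R[i]))
    (T : (R[i] -> R[i]) -> (R[i] -> R[i])) : \bar R :=
  ereal_sup [set (dirichlet_norm (T f))%:E
            | f in [set f | H f /\ dirichlet_norm f <= 1]].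

Definition full_map (phi : R[i] -> R[i]) : Prop :=
  area (unit_disk `\` phi @` unit_disk) = 0%E.

Definition counting_function (phi : R[i] -> R[i]) (w : R[i]) : \bar R :=
  counting [set z | unit_disk z /\ phi z = w].

Definition polar (r theta : R) : R[i] :=
  Complex (r * cos theta) (r * sin theta).

Definition essentially_radial (n : R[i] -> \bar R) : Prop :=
  exists2 g : R -> R, (forall r, 0 <= r < 1 -> 0 <= g r) &
    {ae @lebesgue_measure R, forall r, 0 <= r < 1 ->
      {ae @lebesgue_measure R, forall theta, 0 <= theta <= 2 * pi ->
        n (polar r theta) = (g r)%:E}}.

End Dirichlet.

(* Main.v *)
Require Import Defs.
From HB Require Import structures.
From mathcomp Require Import all_boot all_order all_algebra complex.
From mathcomp Require Import cyclic separable cyclotomic.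
From mathcomp Require Import all_classical all_reals all_analysis.
From mathcomp Require Import ring lra measurable_realfun.
From mathcomp Require finmap.

(** Write D for the unit disk and energy S f for the integral of |f'|^2 over S
    against plane Lebesgue measure. For f with f 0 = 0 the squared Dirichlet
    norm of f is energy D f / pi.

    As phi is injective, the substitution w = phi z turns energy D (f \o phi)
    into the energy of f over the image of phi ([energy_composition]). Hence
    the composition operator never increases norms, and it preserves them if
    the image has full measure in D; then the norm 1 is attained at a multiple
    of the identity function.

    Conversely, let the operator have norm 1. Suppose that phi omits a whole
    circle of radius r, 0 < r < 1, around 0. Since phi is continuous and
    phi 0 = 0, its image lies in the disk of radius r ([image_inside]), and
    energy (disk r) f <= r * energy D f ([energy_small_disk_le]) because the
    mean of |f'|^2 over a circle increases with its radius; so the norm is at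
    most sqrt r < 1, a contradiction. The image, which is open, therefore
    contains an arc of each of these circles. There the counting function is 1,
    and as it is essentially radial it is 1 at almost every point of almost
    every circle: the complement of the image is null on almost every circle.
    Such a set has measure 0 ([radial_null]), which is fullness.

    Two tools carry the work. The first is the elementary theory of
    holomorphic functions: Goursat's theorem ([goursat]), Cauchy's formula
    ([cauchy_formula]), polynomial approximation ([taylor]) and the open mapping
    theorem ([open_mapping]), which makes the inverse of phi continuous, and
    holomorphic where phi' does not vanish. The second is an inequality between
    measures that can be checked on small squares ([comparison]). It gives one
    half of the change of variables for a continuously differentiable bijection
    of open sets with continuous inverse ([integral_image_le]); the other half
    is the same inequality for the inverse of phi off the zeros of phi'
    ([integral_univalent_le]). *)

Set Implicit Arguments.
Unset Strict Implicit.
Unset Printing Implicit Defensive.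

Import Order.TTheory GRing.Theory Num.Theory numFieldNormedType.Exports.
Import ComplexField.Normc.

Local Open Scope classical_set_scope.
Local Open Scope ring_scope.
Local Open Scope complex_scope.

Local Notation Re := (@complex.Re _).
Local Notation Im := (@complex.Im _).

(** * Modulus and complex derivative *)

Section ComplexNorm.
Context {R : realType}.
Implicit Types x y z : R[i].

Lemma normcR z : `|z| = (normc z)%:C.
Proof. by case: z. Qed.

Lemma normc_ge0 z : 0 <= normc z.
Proof. by case: z => a b; exact: sqrtr_ge0. Qed.

Lemma normc_eq0 z : (normc z == 0) = (z == 0).
Proof.
by apply/eqP/eqP => [/eq0_normc//|->]; rewrite /normc /= expr0n addr0 sqrtr0.
Qed.

Lemma normcc0 : normc (0 : R[i]) = 0.
Proof. by apply/eqP; rewrite normc_eq0. Qed.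

Lemma normcc1 : normc (1 : R[i]) = 1.
Proof. by rewrite /normc /= expr0n addr0 expr1n sqrtr1. Qed.

Lemma normc_gt0 z : (0 < normc z) = (z != 0).
Proof. by rewrite lt_def normc_ge0 andbT normc_eq0. Qed.

Lemma normc_opp z : normc (- z) = normc z.
Proof. by case: z => a b; rewrite /normc /= !sqrrN. Qed.

Lemma normc_triangle x y : normc (x + y) <= normc x + normc y.
Proof. by rewrite -lecR rmorphD /= -!normcR ler_normD. Qed.

Lemma normc_distC x y : normc (x - y) = normc (y - x).
Proof. by rewrite -normc_opp opprB. Qed.

Lemma normc_dist y x z : normc (x - z) <= normc (x - y) + normc (y - z).
Proof. by apply: le_trans (normc_triangle _ _); rewrite addrA subrK. Qed.

Lemma normc_dist2 x y : `|normc x - normc y| <= normc (x - y).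
Proof.
have h (a b : R[i]) : normc a - normc b <= normc (a - b).
  by rewrite lerBlDr -{1}(subrK b a) normc_triangle.
by rewrite ler_norml h andbT lerNl opprB normc_distC h.
Qed.

Lemma normcX z n : normc (z ^+ n) = normc z ^+ n.
Proof.
elim: n => [|n IH]; first by rewrite !expr0 normcc1.
by rewrite !exprS normcM IH.
Qed.

Lemma normc_real (a : R) : normc a%:C = `|a|.
Proof. by rewrite /normc /= expr0n addr0 sqrtr_sqr. Qed.

Lemma normc_sqr z : normc z ^+ 2 = Re z ^+ 2 + Im z ^+ 2.
Proof. by case: z => a b; rewrite /= sqr_sqrtr// addr_ge0// sqr_ge0. Qed.

Lemma Re_le_normc z : `|Re z| <= normc z.
Proof.
by case: z => a b /=; rewrite -sqrtr_sqr ler_wsqrtr// lerDl sqr_ge0.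
Qed.

Lemma Im_le_normc z : `|Im z| <= normc z.
Proof.
by case: z => a b /=; rewrite -sqrtr_sqr ler_wsqrtr// lerDr sqr_ge0.
Qed.

Lemma normc_le_ReIm z : normc z <= `|Re z| + `|Im z|.
Proof.
rewrite -(@ler_pXn2r _ 2)// ?nnegrE ?normc_ge0 ?addr_ge0//.
rewrite normc_sqr sqrrD !real_normK ?num_real//.
by rewrite -addrA lerD2l lerDr mulrn_wge0// mulr_ge0.
Qed.

Lemma unit_diskE z : unit_disk z <-> normc z < 1.
Proof.
rewrite /unit_disk /= normcR.
by rewrite (_ : 1 = (1 : R)%:C) // ltcR.
Qed.

Lemma ReD x y : Re (x + y) = Re x + Re y. Proof. by case: x; case: y. Qed.
Lemma ImD x y : Im (x + y) = Im x + Im y. Proof. by case: x; case: y. Qed.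
Lemma ReB x y : Re (x - y) = Re x - Re y. Proof. by case: x; case: y. Qed.
Lemma ImB x y : Im (x - y) = Im x - Im y. Proof. by case: x; case: y. Qed.
Lemma ReM x y : Re (x * y) = Re x * Re y - Im x * Im y.
Proof. by case: x; case: y. Qed.
Lemma ImM x y : Im (x * y) = Re x * Im y + Im x * Re y.
Proof. by case: x; case: y. Qed.

End ComplexNorm.

Lemma two_gt0 {R : realType} : 0 < 2 :> R.
Proof. by rewrite ltr0n. Qed.

Section ComplexDerivative.
Context {R : realType}.
Implicit Types (f g : R[i] -> R[i]) (u : R -> R[i]).

(** Multiplying the difference quotient out and measuring the error in R keeps
    estimates free of division and of filters on the complex numbers. *)
Definition has_cderiv f z d := forall e : R, 0 < e -> exists2 r : R, 0 < r &
  forall w, normc (w - z) < r ->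
    normc (f w - f z - d * (w - z)) <= e * normc (w - z).

Definition ccont f z := forall e : R, 0 < e -> exists2 r : R, 0 < r &
  forall w, normc (w - z) < r -> normc (f w - f z) < e.

Lemma gt0_complexE (e : R[i]) : 0 < e -> exists2 r : R, 0 < r & e = r%:C.
Proof.
case: e => a b; rewrite ltcE /= => /andP[/eqP -> a0].
by exists a.
Qed.

Lemma has_cderivP f z d :
  has_cderiv f z d <->
  (fun h : R[i]^o => h^-1 *: ((f : R[i]^o -> R[i]^o) (h *: 1 + z) - f z))
    @ 0^' --> (d : R[i]^o).
Proof.
split=> [fd|/cvgrPdist_le fd e e0].
  apply/cvgrPdist_le => e /gt0_complexE[e' e'0 ->].
  have [r r0 hr] := fd _ e'0.
  apply/nbhs_ballP; exists r%:C => /=; first by rewrite ltcR.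
  move=> h /=; rewrite /ball/= sub0r normrN normcR ltcR => hr0 h0.
  rewrite normcR lecR /GRing.scale /= mulr1.
  have := hr (h + z); rewrite addrK => /(_ hr0).
  rewrite -(@ler_pM2l _ (normc h)^-1) ?invr_gt0 ?normc_gt0//.
  rewrite mulrCA mulVf ?mulr1 ?normc_eq0// -normcV -normcM.
  have E : d - h^-1 * (f (h + z) - f z) =
    - (h^-1 * (f (h + z) - f z - d * h)) by field.
  by rewrite -normc_opp -E; exact.
have e0' : 0 < e%:C :> R[i] by rewrite ltcR.
have /nbhs_ballP[r' /= /gt0_complexE[r r0 ->] hr] := fd _ e0'.
exists r => // w wr.
have [->|wz] := eqVneq w z.
  by rewrite !subrr mulr0 subrr normcc0 mulr0.
have := hr (w - z); rewrite /ball /= sub0r normrN normcR ltcR => /(_ wr).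
rewrite subr_eq0 => /(_ wz).
rewrite normcR lecR /GRing.scale /= mulr1 subrK.
have wz0 : 0 < normc (w - z) by rewrite normc_gt0 subr_eq0.
rewrite -(@ler_pM2r _ (normc (w - z)))// -normcM.
have E : (d - (w - z)^-1 * (f w - f z)) * (w - z) =
    - (f w - f z - d * (w - z)) by field; rewrite subr_eq0.
by rewrite (_ : normc _ = normc (f w - f z - d * (w - z)))// -[RHS]normc_opp -E.
Qed.

Lemma derivable_cderiv f z :
  derivable (f : R[i]^o -> R[i]^o) z 1 -> has_cderiv f z (cderive f z).
Proof. by move=> df; apply/has_cderivP; rewrite /cderive derive1E; exact: df. Qed.

Lemma has_cderiv_derivable f z d :
  has_cderiv f z d -> derivable (f : R[i]^o -> R[i]^o) z 1.
Proof. by move=> /has_cderivP fd; apply/cvg_ex; exists d. Qed.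

Lemma has_cderiv_cderive f z d : has_cderiv f z d -> cderive f z = d.
Proof.
by move=> /has_cderivP fd; rewrite /cderive derive1E; exact: cvg_lim fd.
Qed.

Lemma has_cderiv_unique f z d d' :
  has_cderiv f z d -> has_cderiv f z d' -> d = d'.
Proof. by move=> /has_cderiv_cderive <- /has_cderiv_cderive. Qed.

Lemma has_cderiv_lip f z d : has_cderiv f z d -> exists2 r : R, 0 < r &
  forall w, normc (w - z) < r -> normc (f w - f z) <= (normc d + 1) * normc (w - z).
Proof.
move=> /(_ _ ltr01)[r r0 hr]; exists r => // w wr.
have := normc_triangle (f w - f z - d * (w - z)) (d * (w - z)).
rewrite subrK => /le_trans; apply; rewrite normcM mulrDl addrC lerD2l.
exact: hr.
Qed.

Lemma has_cderiv_cont f z d : has_cderiv f z d -> ccont f z.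
Proof.
move=> /has_cderiv_lip[r r0 hr] e e0.
have d0 : 0 < normc d + 1 by rewrite ltr_wpDl ?normc_ge0.
exists (Num.min r (e / (normc d + 1))); first by rewrite lt_min r0 divr_gt0.
move=> w; rewrite lt_min => /andP[wr we].
by rewrite (le_lt_trans (hr _ wr))// mulrC -ltr_pdivlMr.
Qed.

Lemma has_cderiv_comp f g z d d' :
  has_cderiv f (g z) d -> has_cderiv g z d' -> has_cderiv (f \o g) z (d * d').
Proof.
move=> df dg e e0.
have [r1 r10 lip] := has_cderiv_lip dg.
pose L := normc d' + 1.
have L0 : 0 < L by rewrite ltr_wpDl ?normc_ge0.
have [r2 r20 hf] := df (e / 2 / L) (divr_gt0 (divr_gt0 e0 two_gt0) L0).
have D0 : 0 < normc d + 1 by rewrite ltr_wpDl ?normc_ge0.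
have [r3 r30 hg] := dg (e / 2 / (normc d + 1)) (divr_gt0 (divr_gt0 e0 two_gt0) D0).
exists (Num.min r1 (Num.min (r2 / L) r3)).
  by rewrite !lt_min r10 r30 divr_gt0.
move=> w; rewrite !lt_min => /and3P[w1 w2 w3] /=.
have lw := lip _ w1.
have gw : normc (g w - g z) < r2.
  by rewrite (le_lt_trans lw)// mulrC -ltr_pdivlMr.
have -> : f (g w) - f (g z) - d * d' * (w - z) =
   (f (g w) - f (g z) - d * (g w - g z)) + d * (g w - g z - d' * (w - z)) by ring.
apply: (le_trans (normc_triangle _ _)); rewrite (splitr e) mulrDl lerD//.
  apply: (le_trans (hf _ gw)); rewrite -mulrA ler_wpM2l ?divr_ge0 ?(ltW e0)//.
  by rewrite mulrC ler_pdivrMr// mulrC.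
rewrite normcM; apply: (@le_trans _ _ ((normc d + 1) * normc (g w - g z - d' * (w - z)))).
  by rewrite ler_wpM2r ?normc_ge0// lerDl.
apply: (le_trans (ler_wpM2l (ltW D0) (hg _ w3))).
by rewrite mulrA mulrCA mulfV ?gt_eqF// mulr1.
Qed.

Lemma has_cderivM f g z d d' : has_cderiv f z d -> has_cderiv g z d' ->
  has_cderiv (fun w => f w * g w) z (d * g z + f z * d').
Proof.
move=> df dg e e0.
have [r1 r10 lipf] := has_cderiv_lip df.
have [r2 r20 lipg] := has_cderiv_lip dg.
pose A := normc (g z) + 1; pose B := normc (f z) + 1.
pose L := (normc d + 1) * (normc d' + 1).
have A0 : 0 < A by rewrite ltr_wpDl ?normc_ge0.
have B0 : 0 < B by rewrite ltr_wpDl ?normc_ge0.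
have L0 : 0 < L by rewrite mulr_gt0// ltr_wpDl ?normc_ge0.
have e3 : 0 < e / 3 by rewrite divr_gt0// ltr0n.
have [r3 r30 hf] := df (e / 3 / A) (divr_gt0 e3 A0).
have [r4 r40 hg] := dg (e / 3 / B) (divr_gt0 e3 B0).
exists (Num.min (Num.min r1 r2) (Num.min (Num.min r3 r4) (e / 3 / L))).
  by rewrite !lt_min r10 r20 r30 r40 divr_gt0.
move=> w; rewrite !lt_min => /andP[/andP[w1 w2] /andP[/andP[w3 w4] w5]].
set t := normc (w - z).
have t0 : 0 <= t by exact: normc_ge0.
have -> : f w * g w - f z * g z - (d * g z + f z * d') * (w - z) =
   (f w - f z - d * (w - z)) * g z + f z * (g w - g z - d' * (w - z))
   + (f w - f z) * (g w - g z) by ring.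
apply: (le_trans (normc_triangle _ _)).
have -> : e * t = e / 3 / A * t * A + B * (e / 3 / B * t) + e / 3 * t.
  by field; rewrite (gt_eqF A0) (gt_eqF B0).
apply: lerD; first apply: (le_trans (normc_triangle _ _)).
  rewrite !normcM; apply: lerD.
    apply: ler_pM; rewrite ?normc_ge0// ?hf// lerDl //.
  by apply: ler_pM; rewrite ?normc_ge0// ?hg// lerDl.
rewrite normcM; apply: (@le_trans _ _ (L * t * t)).
  have -> : L * t * t = ((normc d + 1) * t) * ((normc d' + 1) * t) by rewrite /L; ring.
  by apply: ler_pM; rewrite ?normc_ge0// ?lipf ?lipg.
by rewrite ler_wpM2r// mulrC -ler_pdivlMr// ltW.
Qed.

Lemma has_cderiv_invB (a z : R[i]) : z != a ->
  has_cderiv (fun w => (w - a)^-1) z (- ((z - a)^-1) ^+ 2).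
Proof.
move=> za; set q := normc (z - a).
have q0 : 0 < q by rewrite normc_gt0 subr_eq0.
move=> e e0; exists (Num.min (q / 2) (e * q ^+ 3 / 2)).
  by rewrite lt_min !divr_gt0// mulr_gt0// exprn_gt0.
move=> w; rewrite lt_min => /andP[w1 w2].
have qw : q / 2 <= normc (w - a).
  have := normc_dist w z a; rewrite -/q (normc_distC z w) => h; lra.
have wa : w - a != 0 by rewrite -normc_gt0; apply: lt_le_trans qw; exact: divr_gt0.
have za0 : z - a != 0 by rewrite subr_eq0.
have -> : (w - a)^-1 - (z - a)^-1 - - (z - a)^-1 ^+ 2 * (w - z) =
  (w - z) * (w - z) * ((w - a)^-1 * ((z - a)^-1) ^+ 2).
  by field; rewrite wa za0.
rewrite !normcM !normcV -/q (mulrC e).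
rewrite -mulrA ler_wpM2l ?normc_ge0//.
apply: (@le_trans _ _ (e * q ^+ 3 / 2 * ((q / 2)^-1 * (q^-1 * q^-1)))).
  apply: ler_pM; rewrite ?normc_ge0 ?(ltW w2)//.
    by rewrite !mulr_ge0 ?invr_ge0 ?normc_ge0 ?(ltW q0).
  rewrite ler_wpM2r ?mulr_ge0 ?invr_ge0 ?(ltW q0)//.
  by rewrite lef_pV2 ?posrE ?divr_gt0// (lt_le_trans _ qw)// divr_gt0.
by rewrite le_eqVlt; apply/orP; left; apply/eqP; field; rewrite gt_eqF.
Qed.

Lemma has_cderiv_cst (c z : R[i]) : has_cderiv (fun=> c) z 0.
Proof.
move=> e e0; exists 1 => // w _.
by rewrite subrr mul0r subrr normcc0 mulr_ge0 ?normc_ge0 ?(ltW e0).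
Qed.

Lemma has_cderiv_affine (c b z : R[i]) : has_cderiv (fun w => b + c * w) z c.
Proof.
move=> e e0; exists 1 => // w _.
have -> : b + c * w - (b + c * z) - c * (w - z) = 0 by ring.
by rewrite normcc0 mulr_ge0 ?normc_ge0 ?(ltW e0).
Qed.

Lemma has_cderivD f g z d d' : has_cderiv f z d -> has_cderiv g z d' ->
  has_cderiv (fun w => f w + g w) z (d + d').
Proof.
move=> df dg e e0; have e2 : 0 < e / 2 by exact: divr_gt0.
have [r1 r10 h1] := df _ e2; have [r2 r20 h2] := dg _ e2.
exists (Num.min r1 r2) => [|w]; first by rewrite lt_min r10.
rewrite lt_min => /andP[/h1 w1 /h2 w2].
rewrite (splitr e) [leRHS]mulrDl; apply: (le_trans _ (lerD w1 w2)).
have -> : f w + g w - (f z + g z) - (d + d') * (w - z) =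
  (f w - f z - d * (w - z)) + (g w - g z - d' * (w - z)) by ring.
exact: normc_triangle.
Qed.

Lemma ccontB f g z : ccont f z -> ccont g z -> ccont (fun w => f w - g w) z.
Proof.
move=> fc gc e e0; have e2 : 0 < e / 2 by exact: divr_gt0.
have [r1 r10 h1] := fc _ e2; have [r2 r20 h2] := gc _ e2.
exists (Num.min r1 r2) => [|w]; first by rewrite lt_min r10.
rewrite lt_min => /andP[/h1 w1 /h2 w2].
rewrite (splitr e); apply: (le_lt_trans _ (ltrD w1 w2)).
have -> : f w - g w - (f z - g z) = (f w - f z) + - (g w - g z) by ring.
by apply: (le_trans (normc_triangle _ _)); rewrite normc_opp.
Qed.

Definition has_rderiv u (t : R) (v : R[i]) := forall e : R, 0 < e -> exists2 r : R, 0 < r &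
  forall s, `|s - t| < r ->
    normc (u s - u t - v * (s - t)%:C) <= e * `|s - t|.

Lemma has_rderiv_comp f u t d (v : R[i]) :
  has_cderiv f (u t) d -> has_rderiv u t v -> has_rderiv (f \o u) t (d * v).
Proof.
move=> df du e e0.
have [r1 r10 lip0] := du 1 ltr01.
pose L := normc v + 1.
have L0 : 0 < L by rewrite ltr_wpDl ?normc_ge0.
have lip s : `|s - t| < r1 -> normc (u s - u t) <= L * `|s - t|.
  move=> /lip0 h; rewrite -(subrK (v * (s - t)%:C) (u s - u t)).
  apply: (le_trans (normc_triangle _ _)).
  by rewrite normcM normc_real mulrDl addrC lerD2l.
have [r2 r20 hf] := df (e / 2 / L) (divr_gt0 (divr_gt0 e0 two_gt0) L0).
have D0 : 0 < normc d + 1 by rewrite ltr_wpDl ?normc_ge0.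
have [r3 r30 hg] := du (e / 2 / (normc d + 1)) (divr_gt0 (divr_gt0 e0 two_gt0) D0).
exists (Num.min r1 (Num.min (r2 / L) r3)).
  by rewrite !lt_min r10 r30 divr_gt0.
move=> s; rewrite !lt_min => /and3P[w1 w2 w3] /=.
have lw := lip _ w1.
have gw : normc (u s - u t) < r2.
  by rewrite (le_lt_trans lw)// mulrC -ltr_pdivlMr.
have -> : f (u s) - f (u t) - d * v * (s - t)%:C =
   (f (u s) - f (u t) - d * (u s - u t)) + d * (u s - u t - v * (s - t)%:C) by ring.
apply: (le_trans (normc_triangle _ _)); rewrite (splitr e) mulrDl lerD//.
  apply: (le_trans (hf _ gw)); rewrite -mulrA ler_wpM2l ?divr_ge0 ?(ltW e0)//.
  by rewrite mulrC ler_pdivrMr// mulrC.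
rewrite normcM; apply: (@le_trans _ _ ((normc d + 1) * normc (u s - u t - v * (s - t)%:C))).
  by rewrite ler_wpM2r ?normc_ge0// lerDl.
apply: (le_trans (ler_wpM2l (ltW D0) (hg _ w3))).
by rewrite mulrA mulrCA mulfV ?gt_eqF// mulr1.
Qed.

End ComplexDerivative.

Section RealDerivative.
Context {R : realType}.
Implicit Types (u : R -> R[i]) (t : R) (v : R[i]).

Lemma is_deriveP (h : R -> R) (t d : R) :
  (forall e : R, 0 < e -> exists2 r : R, 0 < r & forall s, `|s - t| < r ->
    `|h s - h t - d * (s - t)| <= e * `|s - t|) <-> is_derive t 1 h d.
Proof.
split=> [hd|[dh <-] e e0].
  suff H : (fun k : R => k^-1 *: (h (k *: 1 + t) - h t)) @ 0^' --> d.
    by split; [apply/cvg_ex; exists d | exact: cvg_lim H].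
  apply/cvgrPdist_le => e e0; have [r r0 hr] := hd _ e0.
  apply/nbhs_ballP; exists r => //= k; rewrite /ball/= sub0r normrN => kr k0.
  have := hr (k + t); rewrite addrK => /(_ kr).
  rewrite -(@ler_pM2l _ `|k|^-1) ?invr_gt0 ?normr_gt0//.
  rewrite mulrCA mulVf ?mulr1 ?normr_eq0// -normfV -normrM.
  have -> : d - k^-1 *: (h (k *: 1 + t) - h t) =
    - (k^-1 * (h (k + t) - h t - d * k)) by rewrite /GRing.scale /= mulr1; field.
  by rewrite normrN.
have /cvgrPdist_le/(_ _ e0)/nbhs_ballP[r /= r0 hr] :
   (fun k : R => k^-1 *: (h (k *: 1 + t) - h t)) @ 0^' --> 'D_1 h t by exact: dh.
exists r => // s sr; have [->|st] := eqVneq s t.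
  by rewrite !subrr mulr0 subrr normr0 mulr0.
have := hr (s - t); rewrite /ball /= sub0r normrN => /(_ sr).
rewrite subr_eq0 => /(_ st); rewrite /GRing.scale /= mulr1 subrK.
have st0 : 0 < `|s - t| by rewrite normr_gt0 subr_eq0.
rewrite -(@ler_pM2r _ `|s - t|)// -normrM -normrN.
by have -> : - (('D_1 h t - (s - t)^-1 * (h s - h t)) * (s - t)) =
   h s - h t - 'D_1 h t * (s - t) by field; rewrite subr_eq0.
Qed.

Lemma has_rderivP u t v : has_rderiv u t v <->
  is_derive t 1 (fun s => Re (u s)) (Re v) /\
  is_derive t 1 (fun s => Im (u s)) (Im v).
Proof.
have reE (x : R[i]) (s : R) : Re (x * s%:C) = Re x * s by rewrite ReM /= mulr0 subr0.
have imE (x : R[i]) (s : R) : Im (x * s%:C) = Im x * s by rewrite ImM /= mulr0 add0r.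
split=> [du|[/is_deriveP hr /is_deriveP hi] e e0].
  split; apply/is_deriveP => e e0; have [r r0 hr] := du _ e0;
    exists r => // s /hr; apply: le_trans.
    by rewrite -reE -!ReB Re_le_normc.
  by rewrite -imE -!ImB Im_le_normc.
have e2 : 0 < e / 2 by rewrite divr_gt0.
have [r1 r10 h1] := hr _ e2; have [r2 r20 h2] := hi _ e2.
exists (Num.min r1 r2); first by rewrite lt_min r10.
move=> s; rewrite lt_min => /andP[s1 s2].
apply: (le_trans (normc_le_ReIm _)); rewrite !ReB !ImB reE imE.
by rewrite (splitr e) mulrDl lerD// (h1,h2).
Qed.

Lemma rderiv_continuous u t v : has_rderiv u t v ->
  {for t, continuous (fun s => Re (u s))} /\ {for t, continuous (fun s => Im (u s))}.
Proof.
move=> /has_rderivP[h1 h2].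
by split; apply: differentiable_continuous; apply/derivable1_diffP; apply: ex_derive.
Qed.

End RealDerivative.

(** * Bisection and extreme values *)

Section Bisection.
Context {R : realType}.

Lemma expr_lt_eventually (x e : R) : 0 <= x < 1 -> 0 < e -> exists n, x ^+ n < e.
Proof.
move=> /andP[x0 x1] e0.
have /cvgrPdist_lt/(_ _ e0)[n _ /(_ n (leqnn n))] : (GRing.exp x : R^nat) @ \oo --> 0.
  by apply: cvg_expr; rewrite ger0_norm.
by rewrite sub0r normrN => /(le_lt_trans (ler_norm _)) h; exists n.
Qed.

Lemma exp2_lt_eventually (e : R) : 0 < e -> exists n, (2 ^+ n)^-1 < e.
Proof.
move=> e0; have [|n hn] := @expr_lt_eventually 2^-1 e _ e0.
  by apply/andP; split; lra.
by exists n; rewrite -exprVn.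
Qed.

Lemma le0_eventually (x K : R) : (forall n, x <= K / 2 ^+ n) -> x <= 0.
Proof.
move=> hx; apply/ler_addgt0Pr => e e0; rewrite add0r.
have K0 : 0 < `|K| + 1 by rewrite ltr_wpDl.
have [n hn] := exp2_lt_eventually (divr_gt0 e0 K0).
apply: (le_trans (hx n)); apply: (@le_trans _ _ ((`|K| + 1) / 2 ^+ n)).
  rewrite ler_wpM2r ?invr_ge0 ?exprn_ge0//.
  by rewrite (le_trans (ler_norm K))// lerDl.
by move: hn; rewrite ltr_pdivlMr// mulrC => /ltW.
Qed.

Lemma nested_intervals (l u : nat -> R) :
  (forall n, l n <= l n.+1) -> (forall n, u n.+1 <= u n) ->
  (forall n, l n <= u n) -> exists x, forall n, l n <= x <= u n.
Proof.
move=> hl hu hlu.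
have ml n m : (n <= m)%N -> l n <= l m.
  move=> /subnK <-; elim: (m - n)%N => // k IH.
  by rewrite addSn (le_trans IH).
have mu n m : (n <= m)%N -> u m <= u n.
  move=> /subnK <-; elim: (m - n)%N => // k IH.
  by rewrite addSn (le_trans _ IH).
have lu n m : l n <= u m.
  have [nm|/ltnW mn] := leqP n m; first by rewrite (le_trans (ml _ _ nm)).
  by rewrite (le_trans (hlu _))// mu.
have hs : has_sup (range l).
  by split; [exists (l 0%N); exists 0%N|exists (u 0%N) => _ [n _ <-]].
exists (sup (range l)) => n; apply/andP; split.
  by apply: (ub_le_sup hs.2); exists n.
by apply: (ge_sup hs.1) => _ [m _ <-].
Qed.

(** The locations form a Cauchy sequence; the coordinates of a piece at stage n
    are within K / 2 ^ n + K / 2 ^ n.+1 + ... = 2 * K / 2 ^ n of their limits. *)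
Lemma bisection (T : Type) (loc : T -> R[i]) (bad : nat -> T -> Prop) (K : R) t0 :
  bad 0%N t0 ->
  (forall n t, bad n t -> exists2 t', bad n.+1 t' &
     normc (loc t' - loc t) <= K / 2 ^+ n) ->
  exists p, forall n, exists2 t, bad n t & normc (loc t - p) <= 4 * K / 2 ^+ n.
Proof.
move=> b0 step.
have nxt n (x : {t | bad n t}) : {y : {t | bad n.+1 t} |
    normc (loc (sval y) - loc (sval x)) <= K / 2 ^+ n}.
  apply: cid; case: x => t bt; have [t' bt' h] := step n t bt.
  by exists (exist _ t' bt').
pose s := fix s n : {t | bad n t} :=
  if n is m.+1 return {t | bad n t} then sval (nxt m (s m)) else exist _ t0 b0.
have sS n : normc (loc (sval (s n.+1)) - loc (sval (s n))) <= K / 2 ^+ n.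
  exact: (svalP (nxt n (s n))).
have K0 : 0 <= K.
  by have := sS 0%N; rewrite expr0 divr1; apply: le_trans; exact: normc_ge0.
have coord (c : R[i] -> R) : (forall x y, `|c x - c y| <= normc (x - y)) ->
    exists x, forall n, `|c (loc (sval (s n))) - x| <= 2 * K / 2 ^+ n.
  move=> cl.
  have hS n : `|c (loc (sval (s n.+1))) - c (loc (sval (s n)))| <= K / 2 ^+ n.
    exact: le_trans (cl _ _) (sS n).
  have h2 n : 2 * K / 2 ^+ n.+1 = K / 2 ^+ n.
    by rewrite exprS; field; rewrite expf_neq0.
  have h2' n : 2 * K / 2 ^+ n = K / 2 ^+ n + K / 2 ^+ n by ring.
  have [|||x hx] := @nested_intervals
     (fun n => c (loc (sval (s n))) - 2 * K / 2 ^+ n)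
     (fun n => c (loc (sval (s n))) + 2 * K / 2 ^+ n).
  - move=> n; have := hS n; rewrite h2 h2' ler_norml => /andP[a b]; lra.
  - move=> n; have := hS n; rewrite h2 h2' ler_norml => /andP[a b]; lra.
  - move=> n; have : 0 <= K / 2 ^+ n by rewrite divr_ge0 ?exprn_ge0.
    rewrite h2' => ?; lra.
  exists x => n; have /andP[a b] := hx n.
  by rewrite ler_norml; apply/andP; split; lra.
have [x hx] := coord Re (fun x y => ltac:(by rewrite -ReB Re_le_normc)).
have [y hy] := coord Im (fun x y => ltac:(by rewrite -ImB Im_le_normc)).
exists (Complex x y) => n; exists (sval (s n)); first exact: svalP (s n).
apply: (le_trans (normc_le_ReIm _)); rewrite ReB ImB /=.
have -> : 4 * K / 2 ^+ n = 2 * K / 2 ^+ n + 2 * K / 2 ^+ n by ring.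
exact: lerD.
Qed.

End Bisection.

Section ExtremeValue.
Context {R : realType}.

Definition rccont (g : R[i] -> R) z := forall e : R, 0 < e ->
  exists2 r : R, 0 < r & forall w, normc (w - z) < r -> `|g w - g z| < e.

Lemma rccont_continuous (g : R[i] -> R) (p : R * R) :
  rccont g (complex_of_pair p) -> {for p, continuous (g \o complex_of_pair)}.
Proof.
move=> gc; apply/cvgrPdist_lt => e e0; have [r r0 hr] := gc _ e0.
apply/(@nbhs_ballP R (R * R)%type); exists (r / 2); first exact: divr_gt0.
move=> q [/= q1 q2]; rewrite distrC; apply: hr.
apply: (le_lt_trans (normc_le_ReIm _)); rewrite ReB ImB /= (splitr r).
by rewrite /ball/= distrC in q1; rewrite /ball/= distrC in q2; exact: ltrD.
Qed.

Lemma closed_disk_compact (z0 : R[i]) (r : R) :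
  compact [set p : R * R | normc (complex_of_pair p - z0) <= r].
Proof.
have C : closed [set p : R * R | normc (complex_of_pair p - z0) <= r].
  rewrite (_ : [set p | _] = (fun p => normc (complex_of_pair p - z0)) @^-1` [set x | x <= r])//.
  apply: closed_comp; last exact: closed_le.
  move=> p _; apply: (@rccont_continuous (fun z => normc (z - z0))).
  move=> e e0; exists e => // w we.
  apply: le_lt_trans (normc_dist2 _ _) _.
  by rewrite opprB addrA subrK.
apply: (subclosed_compact C (compact_setX
   (@segment_compact _ (Re z0 - r) (Re z0 + r)) (@segment_compact _ (Im z0 - r) (Im z0 + r)))).
move=> p /= pr; split; rewrite /= in_itv /=.
  have := le_trans (Re_le_normc _) pr; rewrite ReB /= ler_norml => /andP[? ?].
  by apply/andP; split; lra.
have := le_trans (Im_le_normc _) pr; rewrite ImB /= ler_norml => /andP[? ?].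
by apply/andP; split; lra.
Qed.

Lemma closed_disk_min (g : R[i] -> R) (z0 : R[i]) (r : R) : 0 <= r ->
  (forall z, normc (z - z0) <= r -> rccont g z) ->
  exists2 c, normc (c - z0) <= r & forall z, normc (z - z0) <= r -> g c <= g z.
Proof.
move=> r0 gc.
have [||c /set_mem cA cmin] := @compact_EVT_min _ _ (g \o complex_of_pair) _ _
   (@closed_disk_compact z0 r).
- by exists (Re z0, Im z0) => /=; case: z0 {gc} => a b; rewrite subrr normcc0.
- apply: continuous_in_subspaceT => p /set_mem pA.
  by apply: rccont_continuous; exact: gc.
exists (complex_of_pair c) => // -[a b] zr.
by have /= := cmin (a, b); apply; apply/mem_set.
Qed.

Lemma rccontN (g : R[i] -> R) z : rccont g z -> rccont (fun w => - g w) z.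
Proof.
by move=> gc e /gc[r r0 h]; exists r => // w /h; rewrite -normrN opprB addrC opprK.
Qed.

Lemma ccont_normc (f : R[i] -> R[i]) z : ccont f z -> rccont (fun w => normc (f w)) z.
Proof.
move=> fc e /fc[r r0 h]; exists r => // w /h.
exact: le_lt_trans (normc_dist2 _ _).
Qed.

Lemma closed_disk_bounded (f : R[i] -> R[i]) (z0 : R[i]) (r : R) : 0 <= r ->
  (forall z, normc (z - z0) <= r -> ccont f z) ->
  exists2 M : R, 0 < M & forall z, normc (z - z0) <= r -> normc (f z) <= M.
Proof.
move=> r0 fc.
have [|c _ h] := @closed_disk_min (fun w => - normc (f w)) z0 r r0.
  by move=> z zr; apply/rccontN/ccont_normc/fc.
exists (normc (f c) + 1) => [|z /h]; first by rewrite ltr_wpDl ?normc_ge0.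
by rewrite lerN2 => /le_trans; apply; rewrite lerDl.
Qed.

End ExtremeValue.

(** * Integrals along real intervals and segments *)

Section PathIntegral.
Context {R : realType}.
Local Notation mu := (@lebesgue_measure R).
Implicit Types (u v : R -> R[i]) (a b t : R) (f F : R[i] -> R[i]).

Definition cint a b u : R[i] :=
  Complex (\int[mu]_(t in `[a, b]) Re (u t))%R (\int[mu]_(t in `[a, b]) Im (u t))%R.

Definition pcont u t := {for t, continuous (fun s => Re (u s))} /\
  {for t, continuous (fun s => Im (u s))}.

Definition pconts a b u := forall t, a <= t <= b -> pcont u t.

Lemma has_rderiv_pcont u t (v : R[i]) : has_rderiv u t v -> pcont u t.
Proof. exact: rderiv_continuous. Qed.

Lemma pcont_cst (c : R[i]) t : pcont (fun=> c) t.
Proof. by split; exact: cvg_cst. Qed.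

Lemma pcontD u v t : pcont u t -> pcont v t -> pcont (fun s => u s + v s) t.
Proof.
move=> [u1 u2] [v1 v2]; split.
  rewrite (_ : (fun _ => _) = (fun s => Re (u s) + Re (v s))).
    exact: cvgD. by apply/funext => s; rewrite ReD.
rewrite (_ : (fun _ => _) = (fun s => Im (u s) + Im (v s))).
  exact: cvgD. by apply/funext => s; rewrite ImD.
Qed.

Lemma pcontM u v t : pcont u t -> pcont v t -> pcont (fun s => u s * v s) t.
Proof.
move=> [u1 u2] [v1 v2]; split.
  rewrite (_ : (fun _ => _) = (fun s => Re (u s) * Re (v s) - Im (u s) * Im (v s))).
    by apply: cvgB; exact: cvgM. by apply/funext => s; rewrite ReM.
rewrite (_ : (fun _ => _) = (fun s => Re (u s) * Im (v s) + Im (u s) * Re (v s))).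
  by apply: cvgD; exact: cvgM. by apply/funext => s; rewrite ImM.
Qed.

Lemma pcontP u t : pcont u t <-> forall e : R, 0 < e ->
  exists2 r : R, 0 < r & forall s, `|s - t| < r -> normc (u s - u t) < e.
Proof.
split=> [[/cvgrPdist_lt h1 /cvgrPdist_lt h2] e e0|h].
  have e2 : 0 < e / 2 by exact: divr_gt0.
  have /nbhs_ballP[r1 /= r10 k1] := h1 _ e2.
  have /nbhs_ballP[r2 /= r20 k2] := h2 _ e2.
  exists (Num.min r1 r2) => [|s]; first by rewrite lt_min r10.
  rewrite lt_min => /andP[s1 s2].
  apply: (le_lt_trans (normc_le_ReIm _)); rewrite (splitr e) ReB ImB ltrD//.
    by rewrite distrC; apply: k1; rewrite /ball/= distrC.
  by rewrite distrC; apply: k2; rewrite /ball/= distrC.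
split; apply/cvgrPdist_lt => e /h[r r0 k]; apply/nbhs_ballP; exists r => // s;
  rewrite /ball/= distrC => /k; apply: le_lt_trans; rewrite distrC.
  by rewrite -ReB Re_le_normc.
by rewrite -ImB Im_le_normc.
Qed.

Lemma pcont_comp f u t : ccont f (u t) -> pcont u t -> pcont (fun s => f (u s)) t.
Proof.
move=> fc /pcontP uc; apply/pcontP => e /fc[r r0 h]; have [q q0 k] := uc _ r0.
by exists q => // s /k /h.
Qed.

Lemma pconts_within a b u : pconts a b u ->
  {within `[a, b], continuous (fun s => Re (u s))} /\
  {within `[a, b], continuous (fun s => Im (u s))}.
Proof.
by move=> h; split; apply: continuous_in_subspaceT => t /set_mem/=;
  rewrite in_itv/= => /h[].
Qed.

Lemma pconts_int a b u : pconts a b u ->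
  mu.-integrable `[a, b] (EFin \o (fun s => Re (u s))) /\
  mu.-integrable `[a, b] (EFin \o (fun s => Im (u s))).
Proof.
by move=> /pconts_within[h1 h2]; split; apply: continuous_compact_integrable => //;
  exact: segment_compact.
Qed.

Lemma eq_cint a b u v : (forall t, a <= t <= b -> u t = v t) -> cint a b u = cint a b v.
Proof.
by move=> uv; congr Complex; apply: eq_Rintegral => t /set_mem/=;
  rewrite in_itv/= => /uv ->.
Qed.

Lemma cintD a b u v : pconts a b u -> pconts a b v ->
  cint a b (fun t => u t + v t) = cint a b u + cint a b v.
Proof.
move=> /pconts_int[u1 u2] /pconts_int[v1 v2].
rewrite /cint; apply/eqP; rewrite eq_complex /=; apply/andP; split; apply/eqP.
  under eq_Rintegral do rewrite ReD.
  by rewrite RintegralD.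
under eq_Rintegral do rewrite ImD.
by rewrite RintegralD.
Qed.

Lemma cintZ a b u (c : R[i]) : pconts a b u ->
  cint a b (fun t => c * u t) = c * cint a b u.
Proof.
move=> /pconts_int[u1 u2].
have Z (h : R -> R) (k : R) : mu.-integrable `[a, b] (EFin \o h) ->
    mu.-integrable `[a, b] (EFin \o (fun t => k * h t)).
  by move=> hi; exact: (@integrableZl _ _ R mu _ _ k (EFin \o h) hi).
rewrite /cint; apply/eqP; rewrite eq_complex ReM ImM /=; apply/andP; split; apply/eqP.
  under eq_Rintegral do rewrite ReM.
  by rewrite RintegralB ?RintegralZl//; exact: Z.
under eq_Rintegral do rewrite ImM.
by rewrite RintegralD ?RintegralZl//; exact: Z.
Qed.

Lemma cintN a b u : pconts a b u -> cint a b (fun t => - u t) = - cint a b u.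
Proof.
move=> uc; rewrite -mulN1r -cintZ//; apply: eq_cint => t _.
by rewrite mulN1r.
Qed.

Lemma cintB a b u v : pconts a b u -> pconts a b v ->
  cint a b (fun t => u t - v t) = cint a b u - cint a b v.
Proof.
move=> uc vc; rewrite -[in RHS]cintN// -cintD// => t tab.
rewrite (_ : (fun t => _) = (fun t => -1 * v t)).
  by apply: pcontM; [exact: pcont_cst | exact: vc].
by apply/funext => s; rewrite mulN1r.
Qed.

(** The factor 2 comes from bounding the real and the imaginary part
    separately. *)
Lemma cint_le a b u (M : R) : a <= b -> pconts a b u ->
  (forall t, a <= t <= b -> normc (u t) <= M) ->
  normc (cint a b u) <= 2 * M * (b - a).
Proof.
move=> ab /pconts_int[u1 u2] uM.
have H (h : R -> R) : mu.-integrable `[a, b] (EFin \o h) ->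
    (forall t, a <= t <= b -> `|h t| <= M) ->
    `|\int[mu]_(t in `[a, b]) h t|%R <= M * (b - a).
  move=> hi hM; apply: (le_trans (le_normr_Rintegral _ hi)) => //.
  apply: (@le_trans _ _ (\int[mu]_(t in `[a, b]) cst M t)%R).
    apply: le_Rintegral => //.
    - by have := integrable_norm hi; apply.
    - apply: continuous_compact_integrable; first exact: segment_compact.
      by apply: continuous_in_subspaceT => t _; exact: cvg_cst.
  rewrite Rintegral_cst; last exact: measurable_itv.
  have E : lebesgue_measure `[a, b] = (b - a)%:E.
    rewrite lebesgue_measure_itv /= lte_fin.
    by case: ltgtP ab => //= [->]; rewrite subrr.
  by rewrite [X in fine X]E.
apply: (le_trans (normc_le_ReIm _)).
rewrite (_ : 2 * M * (b - a) = M * (b - a) + M * (b - a)); last by ring.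
by apply: lerD; apply: H => // t /uM; apply: le_trans;
  rewrite ?Re_le_normc ?Im_le_normc.
Qed.

Lemma cint_FTC a b u v : a < b -> (forall t, a <= t <= b -> has_rderiv u t (v t)) ->
  pconts a b v -> cint a b v = u b - u a.
Proof.
move=> ab du vc.
have [v1 v2] := pconts_within vc.
have H (h k : R -> R) : (forall t, a <= t <= b -> is_derive t 1 h (k t)) ->
    {within `[a, b], continuous k} -> (\int[mu]_(t in `[a, b]) k t)%R = h b - h a.
  move=> dh kc; rewrite /Rintegral (@continuous_FTC2 _ k h)//.
    have ct t : a <= t <= b -> {for t, continuous h}.
      move=> /dh dht; apply: differentiable_continuous; apply/derivable1_diffP.
      exact: ex_derive.
    split.
    - move=> t; rewrite in_itv/= => /andP[at' tb].
      by have /dh[] : a <= t <= b by rewrite !ltW.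
    - by apply: cvg_at_right_filter; apply: ct; rewrite lexx ltW.
    - by apply: cvg_at_left_filter; apply: ct; rewrite lexx ltW.
  move=> t; rewrite in_itv/= => /andP[at' tb].
  rewrite derive1E; apply: derive_val; apply: dh.
  by rewrite !ltW.
have HR := H (fun t => Re (u t)) (fun t => Re (v t)) (fun t tab => proj1 (proj1 (has_rderivP _ _ _) (du t tab))) v1.
have HI := H (fun t => Im (u t)) (fun t => Im (v t)) (fun t tab => proj2 (proj1 (has_rderivP _ _ _) (du t tab))) v2.
rewrite /cint HR HI -ReB -ImB.
by case: (u b - u a).
Qed.

Lemma has_rderiv_line (c d : R[i]) t : has_rderiv (fun s : R => c + s%:C * d) t d.
Proof.
move=> e e0; exists 1 => // s _.
have -> : c + s%:C * d - (c + t%:C * d) - d * (s - t)%:C = 0.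
  by rewrite rmorphB /=; ring.
by rewrite normcc0 mulr_ge0// ltW.
Qed.

Lemma cint_cst a b (c : R[i]) : a < b -> cint a b (fun=> c) = (b - a)%:C * c.
Proof.
move=> ab; rewrite (@cint_FTC _ _ (fun s : R => 0 + s%:C * c)) //.
- by rewrite rmorphB/=; ring.
- by move=> t _; exact: has_rderiv_line.
- by move=> t _; exact: pcont_cst.
Qed.

End PathIntegral.

Section Antiderivative.
Context {R : realType}.
Local Notation mu := (@lebesgue_measure R).
Implicit Types (u v : R -> R[i]) (a b t : R) (f F : R[i] -> R[i]).

(** The derivative is two-sided at the endpoints too, which lets [cint_FTC]
    apply after any affine change of variable that stays in the interval. *)
Lemma antiderivative a b u : a <= b -> pconts a b u ->
  exists U : R -> R[i], forall t, a <= t <= b -> has_rderiv U t (u t).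
Proof.
move=> ab uc.
(* extending u by constants makes it continuous on the whole line *)
pose k t : R := Num.max a (Num.min b t).
have k_in t : a <= k t <= b by rewrite /k le_max lexx ge_max ge_min ab lexx.
have k_id t : a <= t <= b -> k t = t.
  by move=> /andP[ta tb]; rewrite /k min_r// max_r.
have k_lip s t : `|k s - k t| <= `|s - t|.
  have H x y : x <= y -> `|k x - k y| <= `|x - y|.
    move=> xy; rewrite (distrC (k x)) (distrC x).
    rewrite (@ger0_norm _ (y - x)) ?subr_ge0//.
    rewrite /k ler_norml; case: (leP b x) => ?; case: (leP b y) => ?;
      repeat match goal with |- context[Num.max ?p ?q] => case: (leP p q) => ? end;
      apply/andP; split; lra.
  by have [/H//|/ltW/H] := leP s t; rewrite distrC (distrC t).
have kc t : pcont (fun s => u (k s)) t.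
  apply/pcontP => e e0; have [r r0 h] := (proj1 (pcontP _ _) (uc _ (k_in t))) e e0.
  by exists r => // s st; apply: h; exact: le_lt_trans (k_lip _ _) st.
have H (h : R -> R) : continuous h -> exists U : R -> R, forall t, a <= t <= b ->
    is_derive t 1 U (h t).
  move=> hc; exists (fun x => \int[mu]_(t in `[a - 1, x]) h t)%R => t /andP[ta tb].
  have [|||//|d1 d2] := @continuous_FTC1_closed R h (a - 1) t (b + 1).
  - lra.
  - apply: continuous_compact_integrable; first exact: segment_compact.
    exact: continuous_subspaceT.
  - lra.
  - exact: hc.
  by split; [exact: d1 | rewrite -derive1E d2].
have [U1 h1] := H (fun s => Re (u (k s))) (fun t => proj1 (kc t)).
have [U2 h2] := H (fun s => Im (u (k s))) (fun t => proj2 (kc t)).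
exists (fun t => Complex (U1 t) (U2 t)) => t tab; apply/has_rderivP => /=.
by split; [have := h1 _ tab | have := h2 _ tab]; rewrite k_id.
Qed.

Lemma has_rderiv_affine u (c d t : R) (v : R[i]) : has_rderiv u (c + d * t) v ->
  has_rderiv (fun s => u (c + d * s)) t (v * d%:C).
Proof.
move=> du e e0.
have d0 : 0 < `|d| + 1 by rewrite ltr_wpDl.
have [r r0 h] := du (e / (`|d| + 1)) (divr_gt0 e0 d0).
exists (r / (`|d| + 1)); first exact: divr_gt0.
move=> s st.
have E : c + d * s - (c + d * t) = d * (s - t) by ring.
have E2 : `|d * (s - t)| <= (`|d| + 1) * `|s - t|.
  by rewrite normrM ler_wpM2r// lerDl.
have := h (c + d * s); rewrite E.
rewrite (_ : v * d%:C * (s - t)%:C = v * (d * (s - t))%:C); last first.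
  by rewrite rmorphM/= mulrA.
move=> /(_ _)/le_trans; apply.
  by apply: (le_lt_trans E2); rewrite mulrC -ltr_pdivlMr.
apply: (le_trans (ler_wpM2l _ E2)); first by rewrite divr_ge0// ltW.
by rewrite mulrA divfK// gt_eqF.
Qed.

Lemma pcont_affine u (c d t : R) : pcont u (c + d * t) -> pcont (fun s => u (c + d * s)) t.
Proof.
move=> /pcontP uc; apply/pcontP => e /uc[r r0 h].
have d0 : 0 < `|d| + 1 by rewrite ltr_wpDl.
exists (r / (`|d| + 1)) => [|s st]; first exact: divr_gt0.
apply: h; rewrite (_ : c + d * s - (c + d * t) = d * (s - t)); last by ring.
apply: (@le_lt_trans _ _ ((`|d| + 1) * `|s - t|)).
  by rewrite normrM ler_wpM2r// lerDl.
by rewrite mulrC -ltr_pdivlMr.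
Qed.

(** Both sides are increments of one antiderivative of u. *)
Lemma cint01_split u : pconts 0 1 u ->
  cint 0 1 u = (2^-1)%:C * cint 0 1 (fun t => u (0 + 2^-1 * t))
             + (2^-1)%:C * cint 0 1 (fun t => u (2^-1 + 2^-1 * t)).
Proof.
move=> uc; have [U hU] := antiderivative ler01 uc.
have A (c : R) : 0 <= c -> c + 2^-1 <= 1 ->
    (2^-1)%:C * cint 0 1 (fun t => u (c + 2^-1 * t)) = U (c + 2^-1) - U c.
  move=> c0 c1.
  have I t : 0 <= t <= 1 -> 0 <= c + 2^-1 * t <= 1.
    by move=> /andP[? ?]; apply/andP; split; lra.
  have pc : pconts 0 1 (fun t => u (c + 2^-1 * t)).
    by move=> t t01; apply: pcont_affine; apply: uc; exact: I.
  rewrite -cintZ// (@cint_FTC _ _ _ (fun t => U (c + 2^-1 * t)))//.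
  - by rewrite mulr1 mulr0 addr0.
  - by move=> t t01; rewrite mulrC; apply: has_rderiv_affine; apply: hU; exact: I.
  - by move=> t t01; apply: pcontM; [exact: pcont_cst | exact: pc].
have h2 : 2^-1 + 2^-1 = 1 :> R by lra.
have h0 : 0 <= 2^-1 :> R by rewrite invr_ge0.
have h1 : 0 + 2^-1 <= 1 :> R by lra.
rewrite (A 0 _ h1)// (A _ h0) ?h2// (@cint_FTC _ _ _ U)//.
by rewrite add0r; ring.
Qed.

Lemma cint01_rev u : pconts 0 1 u -> cint 0 1 (fun t => u (1 - t)) = cint 0 1 u.
Proof.
move=> uc; have [U hU] := antiderivative ler01 uc.
have I t : 0 <= t <= 1 -> 0 <= 1 + -1 * t <= 1.
  by move=> /andP[? ?]; apply/andP; split; lra.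
have pc : pconts 0 1 (fun t => u (1 + -1 * t)).
  by move=> t t01; apply: pcont_affine; apply: uc; exact: I.
have E : (-1)%:C * cint 0 1 (fun t => u (1 + -1 * t)) = U 0 - U 1.
  rewrite -cintZ// (@cint_FTC _ _ _ (fun t => U (1 + -1 * t)))//.
  - by rewrite mulr1 mulr0 addr0 subrr.
  - by move=> t t01; rewrite mulrC; apply: has_rderiv_affine; apply: hU; exact: I.
  - by move=> t t01; apply: pcontM; [exact: pcont_cst | exact: pc].
rewrite [RHS](@cint_FTC _ _ _ U)// -[RHS]opprB -E rmorphN mulN1r opprK.
by apply: eq_cint => t _; rewrite mulN1r.
Qed.

End Antiderivative.

Section Segments.
Context {R : realType}.
Implicit Types (f F : R[i] -> R[i]) (a b z w : R[i]).

(** The contour integral of f over the segment from a to b. *)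
Definition seg f a b : R[i] := (b - a) * cint 0 1 (fun t : R => f (a + t%:C * (b - a))).

Lemma seg_in (r : R) a b (t : R) : normc a <= r -> normc b <= r -> 0 <= t <= 1 ->
  normc (a + t%:C * (b - a)) <= r.
Proof.
move=> ar br /andP[t0 t1].
have -> : a + t%:C * (b - a) = (1 - t)%:C * a + t%:C * b by rewrite rmorphB/= rmorph1; ring.
apply: (le_trans (normc_triangle _ _)); rewrite !normcM !normc_real.
rewrite ger0_norm ?subr_ge0// ger0_norm//.
have -> : r = (1 - t) * r + t * r by ring.
by apply: lerD; apply: ler_wpM2l => //; rewrite subr_ge0.
Qed.

Lemma seg_dist_in (r : R) p a b (t : R) : normc (a - p) <= r -> normc (b - p) <= r ->
  0 <= t <= 1 -> normc (a + t%:C * (b - a) - p) <= r.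
Proof.
move=> ar br t01; have := seg_in ar br t01.
by congr (normc _ <= _); ring.
Qed.

Definition cont_seg f a b := forall t : R, 0 <= t <= 1 -> ccont f (a + t%:C * (b - a)).

Lemma cont_seg_pconts f a b : cont_seg f a b ->
  pconts 0 1 (fun t : R => f (a + t%:C * (b - a))).
Proof.
move=> fc t t01; apply: pcont_comp; first exact: fc.
exact: has_rderiv_pcont (has_rderiv_line _ _ _).
Qed.

Lemma seg_rev f a b : cont_seg f a b -> seg f b a = - seg f a b.
Proof.
move=> /cont_seg_pconts fc; rewrite /seg -(cint01_rev fc) -mulNr opprB; congr (_ * _).
by apply: eq_cint => t _; congr f; rewrite rmorphB/= rmorph1; ring.
Qed.

Lemma seg_split f a b : cont_seg f a b ->
  seg f a b = seg f a ((a + b) / 2) + seg f ((a + b) / 2) b.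
Proof.
move=> /cont_seg_pconts fc; rewrite /seg (cint01_split fc) mulrDr !mulrA.
have two : (2^-1)%:C = 2^-1 :> R[i] by rewrite fmorphV/= rmorph_nat.
congr (_ * _ + _ * _).
- by rewrite two; field.
- by apply: eq_cint => t _; congr f; rewrite add0r rmorphM/= two; field.
- by rewrite two; field.
- by apply: eq_cint => t _; congr f; rewrite rmorphD rmorphM/= two; field.
Qed.

Lemma seg_le f a b (M : R) : cont_seg f a b ->
  (forall t : R, 0 <= t <= 1 -> normc (f (a + t%:C * (b - a))) <= M) ->
  normc (seg f a b) <= 2 * M * normc (b - a).
Proof.
move=> fc fM; rewrite /seg normcM mulrC ler_wpM2r ?normc_ge0//.
rewrite -(mulr1 (2 * M)) -[X in _ * X](subr0 1).
by apply: cint_le => //; exact: cont_seg_pconts.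
Qed.

Lemma seg_FTC f F a b : cont_seg f a b ->
  (forall t : R, 0 <= t <= 1 -> has_cderiv F (a + t%:C * (b - a)) (f (a + t%:C * (b - a)))) ->
  seg f a b = F b - F a.
Proof.
move=> fc dF; have pc := cont_seg_pconts fc.
rewrite /seg -cintZ// (@cint_FTC _ _ _ (fun t : R => F (a + t%:C * (b - a))))//.
- rewrite rmorph1 mul1r rmorph0 mul0r addr0.
  by have -> : a + (b - a) = b by ring.
- move=> t t01; rewrite mulrC; apply: (@has_rderiv_comp _ F) => //; first exact: dF.
  exact: has_rderiv_line.
- by move=> t t01; apply: pcontM; [exact: pcont_cst | exact: pc].
Qed.

Lemma seg_sub f g a b : cont_seg f a b -> cont_seg g a b ->
  seg (fun z => f z - g z) a b = seg f a b - seg g a b.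
Proof.
by move=> /cont_seg_pconts fc /cont_seg_pconts gc; rewrite /seg cintB// mulrBr.
Qed.

End Segments.

(** * Goursat's theorem *)

Section Goursat.
Context {R : realType}.
Implicit Types (f F : R[i] -> R[i]) (a b c z w : R[i]).

(** The contour integral of f over the boundary of a triangle. *)
Definition tri f a b c : R[i] := seg f a b + seg f b c + seg f c a.

Lemma normc_half z : normc (z / 2) = normc z / 2.
Proof.
rewrite normcM normcV; congr (_ / _).
by rewrite -[2 in LHS](rmorph_nat (real_complex R)) normc_real ger0_norm.
Qed.

Lemma normc_mid (r : R) a b : normc a <= r -> normc b <= r -> normc ((a + b) / 2) <= r.
Proof.
move=> ar br; rewrite normc_half ler_pdivrMr// mulr_natr mulr2n.
by apply: (le_trans (normc_triangle _ _)); exact: lerD.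
Qed.

Section OnDisk.
Variables (f : R[i] -> R[i]) (r : R).
Hypothesis fc : forall z, normc z <= r -> ccont f z.

Lemma disk_cont_seg a b : normc a <= r -> normc b <= r -> cont_seg f a b.
Proof. by move=> ar br t t01; apply: fc; exact: seg_in. Qed.

Lemma tri_split a b c : normc a <= r -> normc b <= r -> normc c <= r ->
  let p := (a + b) / 2 in let q := (b + c) / 2 in let s := (c + a) / 2 in
  tri f a b c = tri f a p s + tri f p b q + tri f s q c + tri f q s p.
Proof.
move=> ar br cr p q s.
have pr : normc p <= r by exact: normc_mid.
have qr : normc q <= r by exact: normc_mid.
have sr : normc s <= r by exact: normc_mid.
have S x y : normc x <= r -> normc y <= r -> cont_seg f x y := @disk_cont_seg x y.
rewrite /tri (seg_split (S a b ar br)) (seg_split (S b c br cr)) (seg_split (S c a cr ar)).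
rewrite -/p -/q -/s.
rewrite (seg_rev (S p s pr sr)) (seg_rev (S q p qr pr)) (seg_rev (S s q sr qr)).
ring.
Qed.

(** If the integral over the boundary is not 0, then at each bisection one of
    the four triangles keeps at least a quarter of it. The perimeter is halved,
    so the integral over the n-th triangle has order 4 ^ - n. But near the limit
    point f differs from an affine function, whose integral vanishes, by less
    than any multiple of the distance, so that integral is o(4 ^ - n). *)
Lemma goursat a b c : (forall z, normc z <= r -> exists d, has_cderiv f z d) ->
  normc a <= r -> normc b <= r -> normc c <= r -> tri f a b c = 0.
Proof.
move=> fd ar br cr; apply/eqP; rewrite -normc_eq0; apply: contraT => tri0.
have {}tri0 : 0 < normc (tri f a b c) by rewrite lt_def tri0 normc_ge0.
pose e := normc (tri f a b c) / 2.
have e0 : 0 < e by exact: divr_gt0.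
pose L := normc (b - a) + normc (c - b) + normc (a - c).
have L0 : 0 <= L by rewrite /L !addr_ge0 ?normc_ge0.
pose bad n (t : R[i] * R[i] * R[i]) := let: (x, y, z) := t in
  [/\ normc x <= r, normc y <= r & normc z <= r] /\
  [/\ normc (y - x) <= L / 2 ^+ n, normc (z - y) <= L / 2 ^+ n,
      normc (x - z) <= L / 2 ^+ n & e / 4 ^+ n < normc (tri f x y z)].
have hL n : L / 2 ^+ n / 2 = L / 2 ^+ n.+1.
  by rewrite exprSr invfM mulrA.
have [||p hp] := @bisection R _ (fun t => t.1.1) bad L (a, b, c).
- split=> //=; rewrite !expr0 !divr1; split; rewrite /L /e.
  + by rewrite -addrA lerDl addr_ge0 ?normc_ge0.
  + by rewrite -addrA addrCA lerDl addr_ge0 ?normc_ge0.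
  + by rewrite lerDr addr_ge0 ?normc_ge0.
  + by rewrite ltr_pdivrMr// mulr_natr mulr2n ltrDl.
- move=> n [[x y] z] [[xr yr zr] [yx zy xz big]] /=.
  pose p := (x + y) / 2; pose q := (y + z) / 2; pose s := (z + x) / 2.
  have pr : normc p <= r by exact: normc_mid.
  have qr : normc q <= r by exact: normc_mid.
  have sr : normc s <= r by exact: normc_mid.
  have H u v : normc (u - v) <= L / 2 ^+ n -> normc ((u - v) / 2) <= L / 2 ^+ n.+1.
    by move=> h; rewrite normc_half -hL ler_pM2r// invr_gt0.
  have H' u v : normc (u - v) <= L / 2 ^+ n -> normc ((v - u) / 2) <= L / 2 ^+ n.+1.
    by rewrite normc_distC; exact: H.
  have lenL : 0 <= L / 2 ^+ n by rewrite divr_ge0// exprn_ge0.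
  have hLle : L / 2 ^+ n.+1 <= L / 2 ^+ n by rewrite -hL; lra.
  have E1 : y - p = (y - x) / 2 by rewrite /p; field.
  have E2 : p - x = (y - x) / 2 by rewrite /p; field.
  have E3 : q - y = (z - y) / 2 by rewrite /q; field.
  have E4 : z - q = (z - y) / 2 by rewrite /q; field.
  have E5 : s - z = (x - z) / 2 by rewrite /s; field.
  have E6 : x - s = (x - z) / 2 by rewrite /s; field.
  have E7 : s - p = (z - y) / 2 by rewrite /s /p; field.
  have E7' : p - s = (y - z) / 2 by rewrite /s /p; field.
  have E8 : q - p = (z - x) / 2 by rewrite /q /p; field.
  have E8' : p - q = (x - z) / 2 by rewrite /q /p; field.
  have E9 : q - s = (y - x) / 2 by rewrite /q /s; field.
  have E9' : s - q = (x - y) / 2 by rewrite /q /s; field.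
  have S : tri f x y z = tri f x p s + tri f p y q + tri f s q z + tri f q s p.
    exact: tri_split.
  have [b1|b1] := ltP (e / 4 ^+ n.+1) (normc (tri f x p s)).
    exists (x, p, s); last by rewrite subrr normcc0.
    by split=> //; split; rewrite ?E2 ?E7 ?E6 //; apply: H.
  have [b2|b2] := ltP (e / 4 ^+ n.+1) (normc (tri f p y q)).
    exists (p, y, q); last by rewrite /= E2 (le_trans (H _ _ yx)).
    by split=> //; split; rewrite ?E1 ?E3 ?E8' //; apply: H.
  have [b3|b3] := ltP (e / 4 ^+ n.+1) (normc (tri f s q z)).
    exists (s, q, z); last by rewrite /= -[_ - _]opprB normc_opp E6 (le_trans (H _ _ xz)).
    by split=> //; split; rewrite ?E9 ?E4 ?E5 //; apply: H.
  have [b4|b4] := ltP (e / 4 ^+ n.+1) (normc (tri f q s p)).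
    exists (q, s, p).
      by split=> //; split; rewrite ?E9' ?E7' ?E8 //; apply: H'.
    rewrite /= (_ : q - x = (q - p) + (p - x)); last by ring.
    rewrite E8 E2; apply: (le_trans (normc_triangle _ _)).
    have := H' _ _ xz; have := H _ _ yx; rewrite -hL => ? ?; lra.
  exfalso; move: big; rewrite S ltNge => /negP; apply.
  have -> : e / 4 ^+ n = e / 4 ^+ n.+1 * 4 by rewrite exprS; field; rewrite expf_neq0.
  have h1 := normc_triangle (tri f x p s + tri f p y q + tri f s q z) (tri f q s p).
  have h2 := normc_triangle (tri f x p s + tri f p y q) (tri f s q z).
  have h3 := normc_triangle (tri f x p s) (tri f p y q).
  lra.
have p2 n : 0 < (2 ^+ n : R) by exact: exprn_gt0.
have pr : normc p <= r.
  apply/ler_addgt0Pr => d d0.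
  have [n hn] : exists n, (2 ^+ n)^-1 < d / (4 * L + 1).
    by apply: exp2_lt_eventually; rewrite divr_gt0// ltr_wpDl// mulr_ge0.
  have [[[x y] z] [[xr _ _] _] /=] := hp n.
  have := normc_triangle (p - x) x; rewrite subrK normc_distC => h1 h2.
  apply: (le_trans h1); rewrite addrC lerD//; apply: (le_trans h2).
  move: hn; rewrite ltr_pdivlMr; last by rewrite ltr_wpDl// mulr_ge0.
  move=> /ltW; apply: le_trans; rewrite mulrC ler_wpM2l ?invr_ge0 ?exprn_ge0//.
  by rewrite lerDl.
have [d fdp] := fd p pr.
(* each side contributes at most 10 * eta * L ^+ 2 / 4 ^+ n; 30 * eta * L ^+ 2 < e *)
pose eta := e / (60 * L ^+ 2 + 1).
have D0 : 0 < 60 * L ^+ 2 + 1 by rewrite ltr_wpDl// mulr_ge0// sqr_ge0.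
have eta0 : 0 < eta by exact: divr_gt0.
have [q q0 fq] := fdp _ eta0.
have [n hn] : exists n, (2 ^+ n)^-1 < q / (5 * L + 1).
  by apply: exp2_lt_eventually; rewrite divr_gt0// ltr_wpDl// mulr_ge0.
have hn' : 5 * L / 2 ^+ n < q.
  move: hn; rewrite ltr_pdivlMr; last by rewrite ltr_wpDl// mulr_ge0.
  apply: le_lt_trans; rewrite mulrC ler_wpM2l ?invr_ge0 ?exprn_ge0//.
  by rewrite lerDl.
have [[[x y] z] [[xr yr zr] [yx zy xz big]] /= xp] := hp n.
(* on this small triangle f is close to its linear part *)
pose l := fun w : R[i] => f p + d * (w - p).
pose Q := fun w : R[i] => f p * w + d * ((w - p) * (w - p)) / 2.
have dQ w : has_cderiv Q w (l w).
  have h1 : has_cderiv (fun w : R[i] => - p + 1 * w) w 1 by exact: has_cderiv_affine.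
  have h2 := has_cderivM h1 h1.
  have h3 := has_cderivM (has_cderiv_cst (d / 2) w) h2.
  have h4 : has_cderiv (fun w : R[i] => 0 + f p * w) w (f p) by exact: has_cderiv_affine.
  have h5 : has_cderiv (fun v => 0 + f p * v + d / 2 * ((- p + 1 * v) * (- p + 1 * v))) w
     (f p + (0 * ((- p + 1 * w) * (- p + 1 * w)) + d / 2 *
       (1 * (- p + 1 * w) + (- p + 1 * w) * 1))) := has_cderivD h4 h3.
  have EQ : (fun v => 0 + f p * v + d / 2 * ((- p + 1 * v) * (- p + 1 * v))) = Q.
    by apply/funext => v; rewrite /Q; field.
  rewrite EQ in h5; move: h5; congr (has_cderiv _ _ _).
  by rewrite /l; field.
have lc w : ccont l w.
  have : has_cderiv l w d.
    have -> : l = (fun w : R[i] => (f p - d * p) + d * w).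
      by apply/funext => v; rewrite /l; ring.
    exact: has_cderiv_affine.
  exact: has_cderiv_cont.
have ls u v : cont_seg l u v by move=> t _; exact: lc.
have lin u v : seg l u v = Q v - Q u.
  by apply: seg_FTC => // t _; exact: dQ.
have near u v : normc u <= r -> normc v <= r -> normc (u - p) <= 5 * L / 2 ^+ n ->
    normc (v - p) <= 5 * L / 2 ^+ n -> normc (v - u) <= L / 2 ^+ n ->
    normc (seg f u v - seg l u v) <= 10 * eta * L ^+ 2 / 4 ^+ n.
  move=> ur vr up vp uv; rewrite -seg_sub//; last exact: disk_cont_seg.
  have fl : cont_seg (fun w => f w - l w) u v.
    by move=> t t01; apply: ccontB; [exact: fc (seg_in ur vr t01) | exact: lc].
  apply: (le_trans (@seg_le _ _ _ _ (eta * (5 * L / 2 ^+ n)) fl _)).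
    move=> t t01; have tp := seg_dist_in up vp t01.
    have := fq _ (le_lt_trans tp hn').
    rewrite /l opprD addrA => /le_trans; apply.
    by rewrite ler_wpM2l// ltW.
  apply: (@le_trans _ _ (2 * (eta * (5 * L / 2 ^+ n)) * (L / 2 ^+ n))).
    by rewrite ler_wpM2l// !mulr_ge0 ?invr_ge0 ?exprn_ge0// ltW.
  have -> : 4 ^+ n = 2 ^+ n * 2 ^+ n :> R.
    by rewrite -exprMn; congr (_ ^+ _); ring.
  by rewrite le_eqVlt; apply/orP; left; apply/eqP; field; rewrite gt_eqF.
have lenL : 0 <= L / 2 ^+ n by rewrite divr_ge0// exprn_ge0.
have xp' : normc (x - p) <= 5 * L / 2 ^+ n.
  by apply: (le_trans xp); move: lenL; rewrite -!(mulrA _ L) => ?; lra.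
have E5 : 5 * L / 2 ^+ n = L / 2 ^+ n + 4 * L / 2 ^+ n by ring.
have yp' : normc (y - p) <= 5 * L / 2 ^+ n.
  by apply: (le_trans (normc_dist x _ _)); rewrite E5 lerD.
have zp' : normc (z - p) <= 5 * L / 2 ^+ n.
  by apply: (le_trans (normc_dist x _ _)); rewrite E5 lerD// normc_distC.
have := lerD (lerD (near _ _ xr yr xp' yp' yx) (near _ _ yr zr yp' zp' zy))
   (near _ _ zr xr zp' xp' xz).
rewrite !lin => tot.
have : normc (tri f x y z) <= 30 * eta * L ^+ 2 / 4 ^+ n.
  rewrite (_ : 30 * eta * L ^+ 2 / 4 ^+ n =  10 * eta * L ^+ 2 / 4 ^+ n +
    10 * eta * L ^+ 2 / 4 ^+ n + 10 * eta * L ^+ 2 / 4 ^+ n); last by ring.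
  apply: (le_trans _ tot).
  rewrite /tri (_ : _ + _ = (seg f x y - (Q y - Q x)) + (seg f y z - (Q z - Q y)) +
     (seg f z x - (Q x - Q z))); last by ring.
  by apply: (le_trans (normc_triangle _ _)); rewrite lerD2r normc_triangle.
move=> /(lt_le_trans big); rewrite ltr_pM2r ?invr_gt0 ?exprn_gt0//.
rewrite ltNge => /negP[].
rewrite (_ : 30 * eta * L ^+ 2 = (30 * e * L ^+ 2) / (60 * L ^+ 2 + 1)); last by rewrite /eta; ring.
rewrite ler_pdivrMr// -subr_ge0.
rewrite (_ : _ - _ = e * (30 * L ^+ 2 + 1)); last by ring.
by rewrite mulr_ge0 ?(ltW e0)// addr_ge0// mulr_ge0// sqr_ge0.
Qed.

End OnDisk.

Definition holo f := forall z, normc z < 1 -> exists d, has_cderiv f z d.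

Lemma holo_cont f z : holo f -> normc z < 1 -> ccont f z.
Proof. by move=> fh /fh[d]; exact: has_cderiv_cont. Qed.

(** By Goursat's theorem increments of seg f 0 are integrals over segments, and
    over a short segment f is nearly constant. *)
Lemma primitive f : holo f -> forall z, normc z < 1 -> has_cderiv (seg f 0) z (f z).
Proof.
move=> fh z z1 e e0; have e2 : 0 < e / 2 by exact: divr_gt0.
have [r r0 hr] := holo_cont fh z1 e2.
exists (Num.min r (1 - normc z)); first by rewrite lt_min r0 subr_gt0.
move=> w; rewrite lt_min => /andP[wr wz].
have w1 : normc w < 1.
  by have := normc_triangle (w - z) z; rewrite subrK => h; lra.
pose q := Num.max (normc z) (normc w).
have q1 : q < 1 by rewrite gt_max z1.
have zq : normc z <= q by rewrite le_max lexx.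
have wq : normc w <= q by rewrite le_max lexx orbT.
have q0 : normc (0 : R[i]) <= q by rewrite normcc0 (le_trans (normc_ge0 z)).
have fc x : normc x <= q -> ccont f x.
  by move=> xq; apply: holo_cont => //; exact: le_lt_trans xq q1.
have zw : cont_seg f z w by exact (disk_cont_seg fc zq wq).
have -> : seg f 0 w - seg f 0 z = seg f z w.
  have := goursat fc (fun x xq => fh x (le_lt_trans xq q1)) q0 zq wq.
  rewrite /tri (seg_rev (disk_cont_seg fc q0 wq)) => /eqP.
  by rewrite subr_eq0 => /eqP <-; ring.
have cc : cont_seg (fun=> f z) z w.
  by move=> t _ k k0; exists 1 => // v _; rewrite subrr normcc0.
have -> : f z * (w - z) = seg (fun=> f z) z w.
  by rewrite /seg cint_cst// subr0 mul1r mulrC.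
rewrite -seg_sub//.
apply: (le_trans (@seg_le _ _ _ _ (e / 2) _ _)).
- move=> t t01 k k0; have [p p0 hp] := zw t t01 k k0.
  by exists p => // v /hp; congr (normc _ < _); ring.
- move=> t t01; apply/ltW/hr.
  have -> : z + t%:C * (w - z) - z = t%:C * (w - z) by ring.
  rewrite normcM normc_real; apply: le_lt_trans wr.
  rewrite ler_piMl ?normc_ge0// ger0_norm; by case/andP: t01.
by rewrite mulrC (mulrC 2) divfK// mulrC.
Qed.

End Goursat.

(** * Cauchy's formula *)

Section Circle.
Context {R : realType}.
Local Notation mu := (@lebesgue_measure R).
Implicit Types (f F g : R[i] -> R[i]) (a z w : R[i]) (t s : R).

Definition cis t : R[i] := Complex (cos t) (sin t).
Definition circ s t : R[i] := s%:C * cis t.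

Lemma normc_cis t : normc (cis t) = 1.
Proof. by rewrite /normc /= cos2Dsin2 sqrtr1. Qed.

Lemma normc_circ s t : 0 <= s -> normc (circ s t) = s.
Proof. by move=> s0; rewrite normcM normc_cis mulr1 normc_real ger0_norm. Qed.

Lemma has_rderiv_cis t : has_rderiv cis t ('i * cis t).
Proof.
apply/has_rderivP => /=; split.
  have := is_derive_cos t; rewrite mul0r sub0r mul1r; exact.
have := is_derive_sin t; rewrite mul0r mul1r add0r; exact.
Qed.

Lemma has_rderiv_circ s t : has_rderiv (circ s) t ('i * circ s t).
Proof.
have := has_rderiv_comp (has_cderiv_affine s%:C 0 (cis t)) (has_rderiv_cis t).
rewrite (_ : _ \o _ = circ s); last by apply/funext => x /=; rewrite add0r.
by congr (has_rderiv _ _ _); rewrite /circ; ring.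
Qed.

Lemma circ_periodic s : circ s (2 * pi) = circ s 0.
Proof.
by rewrite /circ /cis mulr_natl cos2pi sin2pi cos0 sin0.
Qed.

Lemma twopi_gt0 : 0 < 2 * pi :> R.
Proof. by rewrite mulr_gt0// pi_gt0. Qed.

(** Differentiation under the integral sign, applied to the real and the
    imaginary part. *)
Lemma cint_deriv (u du : R -> R -> R[i]) (lo hi b c t M : R) : lo < t < hi -> b <= c ->
  (forall x y, lo < x < hi -> b <= y <= c -> has_rderiv (u ^~ y) x (du x y)) ->
  (forall x, lo < x < hi -> pconts b c (u x)) ->
  (forall x y, lo < x < hi -> b <= y <= c -> normc (du x y) <= M) ->
  has_rderiv (fun x => cint b c (u x)) t (cint b c (du t)).
Proof.
move=> tI bc dud uc duM.
have M0 : 0 <= M by apply: le_trans (duM t b tI _); rewrite ?normc_ge0// lexx.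
have H (h dh : R -> R -> R) :
    (forall x y, lo < x < hi -> b <= y <= c -> is_derive x 1 (h ^~ y) (dh x y)) ->
    (forall x, lo < x < hi -> mu.-integrable `[b, c] (EFin \o h x)) ->
    (forall x y, lo < x < hi -> b <= y <= c -> `|dh x y| <= M) ->
    is_derive t 1 (fun x => \int[mu]_(y in `[b, c]) h x y)%R
       (\int[mu]_(y in `[b, c]) dh t y)%R.
  move=> hd hint hM.
  have Mint : mu.-integrable `[b, c] (EFin \o (fun=> M)).
    apply: continuous_compact_integrable; first exact: segment_compact.
    by apply: continuous_in_subspaceT => y _; exact: cvg_cst.
  have tI' : (`]lo, hi[%classic : set R) t by rewrite /= in_itv.
  have iI x : (`]lo, hi[%classic : set R) x -> lo < x < hi by rewrite /= in_itv.
  have iB y : (`[b, c]%classic : set R) y -> b <= y <= c by rewrite /= in_itv.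
  have A1 x : (`]lo, hi[%classic : set R) x -> mu.-integrable `[b, c] (EFin \o h x).
    by move=> /iI; exact: hint.
  have A2 x y : (`]lo, hi[%classic : set R) x -> (`[b, c]%classic : set R) y ->
      derivable (h ^~ y) x 1.
    by move=> /iI xI /iB yB; have [] := hd x y xI yB.
  have dE x y : lo < x < hi -> b <= y <= c -> partial1of2 h x y = dh x y.
    move=> xI yB; rewrite partial1of2E.
    by have [_ ->] := hd x y xI yB.
  have A3 x y : (`]lo, hi[%classic : set R) x -> (`[b, c]%classic : set R) y ->
      `|partial1of2 h x y| <= M.
    by move=> /iI xI /iB yB; rewrite dE//; exact: hM.
  have D : derivable (fun x => \int[mu]_(y in `[b, c]) h x y)%R t 1.
    by apply: (derivable_under_integral _ tI' A1 A2 (fun=> M0) Mint A3).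
  have E : derive1 (fun x => (\int[mu]_(y in `[b, c]) h x y)%R) t =
      (\int[mu]_(y in `[b, c]) partial1of2 h t y)%R.
    by apply: (differentiation_under_integral _ tI' A1 A2 (fun=> M0) Mint A3).
  split; first exact: D.
  rewrite -derive1E E; apply: eq_Rintegral => y /set_mem/iB yB.
  exact: dE.
apply/has_rderivP; split.
  apply: (H (fun x y => Re (u x y)) (fun x y => Re (du x y))) => x.
  - by move=> y xI yB; have /has_rderivP[] := dud x y xI yB.
  - by move=> /uc/pconts_int[].
  - by move=> y xI yB; apply: le_trans (duM x y xI yB); exact: Re_le_normc.
apply: (H (fun x y => Im (u x y)) (fun x y => Im (du x y))) => x.
- by move=> y xI yB; have /has_rderivP[] := dud x y xI yB.
- by move=> /uc/pconts_int[].
- by move=> y xI yB; apply: le_trans (duM x y xI yB); exact: Im_le_normc.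
Qed.

Lemma has_rderiv0_cst (u : R -> R[i]) :
  (forall t, 0 <= t <= 1 -> has_rderiv u t 0) -> u 1 = u 0.
Proof.
move=> du; apply/eqP; rewrite -subr_eq0; apply/eqP.
rewrite -(@cint_FTC _ _ _ _ (fun=> 0)) ?cint_cst ?mulr0//.
by move=> t _; exact: pcont_cst.
Qed.

(** Up to the factor 'i the integrand is the derivative of G along the circle,
    and the increment of G over a full turn vanishes. *)
Lemma cint_closed g G (s : R) :
  (forall t, has_cderiv G (circ s t) (g (circ s t))) ->
  (forall t, ccont g (circ s t)) ->
  cint 0 (2 * pi) (fun t => g (circ s t) * circ s t) = 0.
Proof.
move=> dG gc.
have pc : pconts 0 (2 * pi) (fun t => g (circ s t) * circ s t).
  move=> t _; apply: pcontM; last exact: has_rderiv_pcont (has_rderiv_circ _ _).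
  apply: pcont_comp => //; exact: has_rderiv_pcont (has_rderiv_circ _ _).
have E : 'i * cint 0 (2 * pi) (fun t => g (circ s t) * circ s t) = 0.
  rewrite -cintZ// (@cint_FTC _ _ _ (fun t => G (circ s t)) _ twopi_gt0).
  - by rewrite circ_periodic subrr.
  - move=> t _; rewrite mulrCA; apply: (@has_rderiv_comp _ G) => //.
    exact: has_rderiv_circ.
  - by move=> t t01; apply: pcontM; [exact: pcont_cst | exact: pc].
apply/eqP; move/eqP: E; rewrite mulf_eq0 => /orP[|//].
by rewrite (negPf (neq0Ci _)).
Qed.

End Circle.

Section CauchyKernel.
Context {R : realType}.
Implicit Types (f F g : R[i] -> R[i]) (a b z w : R[i]) (t s : R).

(** On the circle dz = 'i z dt, so these are, up to the factor 'i, the contour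
    integrals of g z / (z - a) and of g z / (z - a) ^ 2. *)
Definition cauchy1 s g a : R[i] :=
  cint 0 (2 * pi) (fun t => g (circ s t) * circ s t * (circ s t - a)^-1).

Definition cauchy2 s g a : R[i] :=
  cint 0 (2 * pi) (fun t => g (circ s t) * circ s t * ((circ s t - a)^-1 ^+ 2)).

Lemma circ_sub_ge s t a : 0 <= s -> s - normc a <= normc (circ s t - a).
Proof.
move=> s0; rewrite -{1}(@normc_circ R s t)//.
by apply: le_trans (normc_dist2 _ _); exact: ler_norm.
Qed.

Lemma circ_neq s t a : 0 <= s -> normc a < s -> circ s t != a.
Proof.
by move=> s0 as'; rewrite -subr_eq0 -normc_gt0 (lt_le_trans _ (circ_sub_ge t a s0))// subr_gt0.
Qed.

Lemma pcont_circ s t : pcont (circ s) t.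
Proof. exact: has_rderiv_pcont (has_rderiv_circ _ _). Qed.

Lemma pcont_inv s t a : 0 <= s -> normc a < s -> pcont (fun t => (circ s t - a)^-1) t.
Proof.
move=> s0 as'; apply: (@pcont_comp _ (fun w => (w - a)^-1)); last exact: pcont_circ.
by apply: has_cderiv_cont (has_cderiv_invB _); exact: circ_neq.
Qed.

Definition circ_cont s g := forall t, ccont g (circ s t).

Lemma pcont_cauchy1 s g a : 0 <= s -> normc a < s -> circ_cont s g ->
  pconts 0 (2 * pi) (fun t => g (circ s t) * circ s t * (circ s t - a)^-1).
Proof.
move=> s0 as' gc t _; apply: pcontM; last exact: pcont_inv.
by apply: pcontM; [apply: pcont_comp|]; rewrite //; exact: pcont_circ.
Qed.

Lemma pcont_cauchy2 s g a : 0 <= s -> normc a < s -> circ_cont s g ->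
  pconts 0 (2 * pi) (fun t => g (circ s t) * circ s t * ((circ s t - a)^-1 ^+ 2)).
Proof.
move=> s0 as' gc t _; apply: pcontM; last by apply: pcontM; exact: pcont_inv.
by apply: pcontM; [apply: pcont_comp|]; rewrite //; exact: pcont_circ.
Qed.

Lemma circ_cont_bound s g : 0 <= s -> circ_cont s g ->
  exists2 M : R, 0 < M & forall t, 0 <= t <= 2 * pi -> normc (g (circ s t)) <= M.
Proof.
move=> s0 gc.
have pc : pconts 0 (2 * pi) (fun t => g (circ s t)).
  by move=> t _; apply: pcont_comp => //; exact: pcont_circ.
have [h1 h2] := pconts_within pc.
have B (h : R -> R) : {within `[0, 2 * pi], continuous h} ->
    exists2 M : R, 0 <= M & forall t, 0 <= t <= 2 * pi -> `|h t| <= M.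
  move=> hc; have [c1 _ m1] := EVT_max (ltW (@twopi_gt0 R)) hc.
  have [c2 _ m2] := EVT_min (ltW (@twopi_gt0 R)) hc.
  exists (`|h c1| + `|h c2|) => [|t tI]; first exact: addr_ge0.
  have k1 := m1 t; have k2 := m2 t; rewrite in_itv/= in k1 k2.
  have := k1 tI; have := k2 tI; have := ler_norm (h c1); have := ler_norm (- h c2).
  rewrite normrN => *; rewrite ler_norml.
  have := normr_ge0 (h c1); have := normr_ge0 (h c2) => *.
  by apply/andP; split; lra.
have [M1 M10 b1] := B _ h1; have [M2 M20 b2] := B _ h2.
exists (M1 + M2 + 1) => [|t tI]; first by rewrite ltr_wpDl// addr_ge0.
apply: (le_trans (normc_le_ReIm _)).
by have := b1 t tI; have := b2 t tI => ? ?; lra.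
Qed.

Lemma normc_twopi : normc (2 * pi)%:C = 2 * pi :> R.
Proof. by rewrite normc_real ger0_norm// ltW// twopi_gt0. Qed.

(** The integral of z / (z - x a) over the circle is computed at x = 0. It does
    not depend on x in [0, 1]: its derivative in x is the integral of a multiple
    of 1 / (z - x a) ^ 2, which has a primitive on the circle. *)
Lemma cauchy1_cst1 s a : s < 1 -> normc a < s -> cauchy1 s (fun=> 1) a = (2 * pi)%:C.
Proof.
move=> s1 as'; have s0 : 0 < s by exact: le_lt_trans (normc_ge0 _) as'.
have s0' := ltW s0.
pose q := (s - normc a) / 2; have q0 : 0 < q by rewrite divr_gt0// subr_gt0.
have ha : normc a <= 1 by rewrite ltW// (lt_trans as').
have xa (x : R) : - q < x < 1 + q -> normc (x%:C * a) <= normc a + q.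
  move=> /andP[x1 x2]; rewrite normcM normc_real.
  have : `|x| <= 1 + q by rewrite ler_norml; apply/andP; split; rewrite /q in x1 x2 *; lra.
  move=> /(ler_wpM2r (normc_ge0 a))/le_trans; apply.
  by rewrite mulrDl mul1r lerD2l ler_piMr// ltW.
have xas (x : R) : - q < x < 1 + q -> normc (x%:C * a) < s.
  by move=> /xa/le_lt_trans; apply; rewrite /q; lra.
have one_c : circ_cont s (fun=> 1 : R[i]).
  by move=> t e e0; exists 1 => // w _; rewrite subrr normcc0.
have W t : 0 <= t <= 1 ->
   has_rderiv (fun x : R => cauchy1 s (fun=> 1) (x%:C * a)) t 0.
  move=> /andP[t0 t1].
  have tI : - q < t < 1 + q by apply/andP; split; lra.
  have D := @cint_deriv R
    (fun x y => 1 * circ s y * (circ s y - x%:C * a)^-1)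
    (fun x y => 1 * circ s y * (((circ s y - x%:C * a)^-1) ^+ 2 * a))
    (- q) (1 + q) 0 (2 * pi) t (s * q^-1 ^+ 2) tI (ltW twopi_gt0).
  have Z : cint 0 (2 * pi) (fun y => 1 * circ s y * (((circ s y - t%:C * a)^-1) ^+ 2 * a)) = 0.
    pose g w := - ((w - t%:C * a)^-1) ^+ 2.
    pose G w := (w - t%:C * a)^-1.
    have dG y : has_cderiv G (circ s y) (g (circ s y)).
      by apply: has_cderiv_invB; apply: circ_neq => //; exact: xas.
    have gc y : ccont g (circ s y).
      have hG := has_cderivM (dG y) (dG y).
      have := ccontB (has_cderiv_cont (has_cderiv_cst 0 (circ s y))) (has_cderiv_cont hG).
      rewrite (_ : (fun w => _ - _) = g)//.
      by apply/funext => w; rewrite sub0r /g expr2.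
    have := cint_closed dG gc.
    have pc : pconts 0 (2 * pi) (fun t => g (circ s t) * circ s t).
      by move=> y _; apply: pcontM; [apply: pcont_comp|]; rewrite //; exact: pcont_circ.
    move=> E; transitivity (- a * 0); last by rewrite mulr0.
    rewrite -E -cintZ//; apply: eq_cint => y _; rewrite /g; ring.
  rewrite Z in D; apply: D.
  - move=> x y xI yI.
    have cn : x%:C * a != circ s y by rewrite eq_sym; apply: circ_neq => //; exact: xas.
    have h1 := has_cderiv_invB cn.
    have h2 := has_cderiv_affine (- (1 * circ s y)) 0 ((x%:C * a - circ s y)^-1).
    have h3 := @has_cderiv_comp R (fun w => 0 + - (1 * circ s y) * w)
      (fun w => (w - circ s y)^-1) _ _ _ h2 h1.
    have h4 : has_rderiv (fun v : R => 0 + v%:C * a) x a by exact: has_rderiv_line.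
    have h5 : has_cderiv ((fun w => 0 + - (1 * circ s y) * w) \o (fun w => (w - circ s y)^-1))
      ((fun v : R => 0 + v%:C * a) x) (- (1 * circ s y) * - (x%:C * a - circ s y)^-1 ^+ 2).
      by rewrite /= add0r.
    have h6 := has_rderiv_comp h5 h4.
    have E : (fun v : R => 1 * circ s y * (circ s y - v%:C * a)^-1) =
      ((fun w => 0 + - (1 * circ s y) * w) \o (fun w => (w - circ s y)^-1)) \o
       (fun v : R => 0 + v%:C * a).
      by apply/funext => v /=; rewrite !add0r -opprB invrN mulrN mulNr.
    rewrite /= E; move: h6; congr (has_rderiv _ _ _).
    rewrite -(opprB (circ s y)) invrN sqrrN; ring.
  - by move=> x xI; exact: (@pcont_cauchy1 s (fun=> 1) (x%:C * a) s0' (xas x xI) one_c).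
  - move=> x y xI yI; rewrite mul1r (normcM (circ s y)) normc_circ//.
    rewrite ler_wpM2l// (normcM (_ ^+ 2)) -[leRHS]mulr1 ler_pM ?normc_ge0//.
    rewrite !expr2 normcM normcV.
    have qn : q <= normc (circ s y - x%:C * a).
      have := circ_sub_ge y (x%:C * a) s0'; have := xa x xI; rewrite /q => ? ?; lra.
    have iq : (normc (circ s y - x%:C * a))^-1 <= q^-1.
      by rewrite lef_pV2// posrE (lt_le_trans q0).
    by apply: ler_pM; rewrite ?invr_ge0 ?normc_ge0.
have := has_rderiv0_cst W; rewrite rmorph1 mul1r rmorph0 mul0r => ->.
rewrite /cauchy1 (@eq_cint _ _ _ _ (fun=> 1)).
  by rewrite cint_cst ?twopi_gt0// subr0 mulr1.
move=> t _; rewrite subr0 mul1r divff// -normc_gt0 normc_circ//.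
Qed.

End CauchyKernel.

Section CauchyFormula.
Context {R : realType}.
Implicit Types (f F g : R[i] -> R[i]) (a b z w : R[i]) (t s : R).

Lemma normc_lt1_circ s t : 0 <= s -> s < 1 -> normc (circ s t) < 1.
Proof. by move=> s0; rewrite normc_circ. Qed.

(** Shrinking the circle affinely to the point a does not change the integral of
    F (a + x (z - a)) / (z - a): its derivative in x is the integral of the exact
    form f (a + x (z - a)) dz. Differentiation under the integral sign needs
    F' = f to be continuous, which is known of the primitives F built above but
    not yet of all holomorphic functions. *)
Lemma cauchy1_primitive f F s a : s < 1 -> normc a < s ->
  (forall z, normc z < 1 -> has_cderiv F z (f z)) ->
  (forall z, normc z < 1 -> ccont f z) ->
  cauchy1 s F a = (2 * pi)%:C * F a.
Proof.
move=> s1 as' dF fc; have s0 : 0 < s by exact: le_lt_trans (normc_ge0 _) as'.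
have s0' := ltW s0.
pose q := (1 - s) / 4; have q0 : 0 < q by rewrite divr_gt0// subr_gt0.
pose r := (1 + s) / 2.
have r1 : r < 1 by rewrite /r; lra.
have r0 : 0 <= r by rewrite /r; lra.
pose Z (x y : R) := a + x%:C * (circ s y - a).
have Zr (x y : R) : - q < x < 1 + q -> normc (Z x y) <= r.
  move=> /andP[x1 x2].
  have -> : Z x y = (1 - x)%:C * a + x%:C * circ s y.
    by rewrite /Z rmorphB/= rmorph1; ring.
  apply: (le_trans (normc_triangle _ _)).
  rewrite (normcM x%:C) (normcM (1 - x)%:C) !normc_real normc_circ//.
  have a0 := normc_ge0 a.
  have [x0|x0] := leP 0 x; have [x3|x3] := leP x 1.
  - rewrite ger0_norm ?subr_ge0// ger0_norm//.
    have : (1 - x) * normc a <= (1 - x) * s by rewrite ler_wpM2l ?subr_ge0// ltW.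
    by rewrite /r => ?; lra.
  - rewrite ltr0_norm ?subr_lt0// ger0_norm//.
    have : (x - 1) * normc a <= (x - 1) * 1 by rewrite ler_wpM2l; lra.
    have : (x - 1) * s <= (x - 1) * 1 by rewrite ler_wpM2l; lra.
    rewrite /r /q in x2 * => ? ?; lra.
  - rewrite ger0_norm; last by lra. rewrite ltr0_norm//.
    have : (- x) * normc a <= (- x) * 1 by rewrite ler_wpM2l; lra.
    have : (- x) * s <= (- x) * 1 by rewrite ler_wpM2l; lra.
    rewrite /r /q in x1 * => ? ?; lra.
  - lra.
have Z1 (x y : R) : - q < x < 1 + q -> normc (Z x y) < 1.
  by move=> xI; exact: le_lt_trans (Zr x y xI) r1.
have [M M0 hM] : exists2 M : R, 0 < M & forall z, normc (z - 0) <= r -> normc (f z) <= M.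
  apply: closed_disk_bounded => // z; rewrite subr0 => zr.
  by apply: fc; exact: le_lt_trans zr r1.
have na y : circ s y - a != 0 by rewrite subr_eq0; exact: circ_neq.
pose u (x y : R) := F (Z x y) * circ s y * (circ s y - a)^-1.
pose du (x y : R) := f (Z x y) * circ s y.
have pZ (x y : R) : pcont (Z x) y.
  apply: pcontD; first exact: pcont_cst.
  apply: pcontM; first exact: pcont_cst.
  by apply: pcontD; [exact: pcont_circ | exact: pcont_cst].
have Fc z : normc z < 1 -> ccont F z by move=> /dF; exact: has_cderiv_cont.
have pdu (x : R) : - q < x < 1 + q -> pconts 0 (2 * pi) (du x).
  move=> xI y _; apply: pcontM; last exact: pcont_circ.
  by apply: (@pcont_comp _ f) => //; apply: fc; exact: Z1.
have pu (x : R) : - q < x < 1 + q -> pconts 0 (2 * pi) (u x).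
  move=> xI y _; apply: pcontM; last exact: pcont_inv.
  apply: pcontM; last exact: pcont_circ.
  by apply: (@pcont_comp _ F) => //; apply: Fc; exact: Z1.
have K t : 0 <= t <= 1 -> has_rderiv (fun x => cint 0 (2 * pi) (u x)) t 0.
  move=> /andP[t0 t1].
  have tI : - q < t < 1 + q by apply/andP; split; lra.
  have := @cint_deriv R u du (- q) (1 + q) 0 (2 * pi) t (M * s) tI (ltW twopi_gt0).
  have -> : cint 0 (2 * pi) (du t) = 0.
    have [tz|tn0] := eqVneq t 0.
      have E : cint 0 (2 * pi) (fun y => (fun=> 1 : R[i]) (circ s y) * circ s y) = 0.
        apply: (@cint_closed _ (fun=> 1) (fun z => 0 + 1 * z) s).
          by move=> y; exact: has_cderiv_affine.
        by move=> y; apply: has_cderiv_cont (has_cderiv_cst _ _).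
      transitivity (f a * 0); last by rewrite mulr0.
      rewrite -E -cintZ.
        by apply: eq_cint => y _; rewrite /du /Z tz rmorph0 mul0r addr0 mul1r.
      move=> y _; apply: pcontM; first exact: pcont_cst.
      exact: pcont_circ.
    have E : ('i * t%:C) * cint 0 (2 * pi) (du t) = 0.
      rewrite -cintZ; last exact: pdu.
      rewrite (@cint_FTC _ _ _ (fun y => F (Z t y)) _ twopi_gt0).
      - by rewrite /Z circ_periodic subrr.
      - move=> y _; rewrite /du.
        have h1 := has_cderiv_affine (t%:C) (a - t%:C * a) (circ s y).
        have h2 := has_rderiv_comp h1 (has_rderiv_circ s y).
        have E1 : (fun w => a - t%:C * a + t%:C * w) \o circ s = Z t.
          by apply/funext => x /=; rewrite /Z; ring.
        rewrite E1 in h2.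
        have := @has_rderiv_comp _ F (Z t) y _ _ (dF _ (Z1 t y tI)) h2.
        by congr (has_rderiv _ _ _); ring.
      - by move=> y yI; apply: pcontM; [exact: pcont_cst | exact: (pdu t tI y yI)].
    apply/eqP; move/eqP: E; rewrite mulf_eq0 => /orP[|//].
    rewrite mulf_eq0 (negPf (neq0Ci _)) /=.
    by rewrite -(rmorph0 (real_complex R)) (inj_eq (@complexI _)) (negPf tn0).
  apply.
  - move=> x y xI yI.
    have h1 : has_rderiv (fun x : R => Z x y) x (circ s y - a) by exact: has_rderiv_line.
    have h2 := @has_rderiv_comp _ F (fun x : R => Z x y) x _ _ (dF _ (Z1 x y xI)) h1.
    have h3 := has_cderiv_affine (circ s y * (circ s y - a)^-1) 0 (F (Z x y)).
    have := @has_rderiv_comp _ _ (F \o (fun x : R => Z x y)) x _ _ h3 h2.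
    have E2 : (fun w => 0 + circ s y * (circ s y - a)^-1 * w) \o (F \o (fun x : R => Z x y)) =
        u^~ y.
      by apply/funext => v /=; rewrite /u; ring.
    rewrite E2; congr (has_rderiv _ _ _).
    by rewrite /du; field; exact: na.
  - by move=> x xI; exact: pu.
  - move=> x y xI yI; rewrite /du (normcM (f _)) normc_circ// ler_wpM2r//.
    by apply: hM; rewrite subr0; exact: Zr.
have K10 : cint 0 (2 * pi) (u 1) = cint 0 (2 * pi) (u 0) := has_rderiv0_cst K.
have U1 : cauchy1 s F a = cint 0 (2 * pi) (u 1).
  apply: eq_cint => y _; rewrite /u /Z rmorph1 mul1r.
  by have -> : a + (circ s y - a) = circ s y by ring.
rewrite U1 K10 -(cauchy1_cst1 s1 as') (mulrC (cauchy1 _ _ _)) /cauchy1 -cintZ.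
  by apply: eq_cint => y _; rewrite /u /Z rmorph0 mul0r addr0; ring.
have one_c : circ_cont s (fun=> 1 : R[i]).
  by move=> t; apply: has_cderiv_cont (has_cderiv_cst _ _).
exact: (@pcont_cauchy1 _ s (fun=> 1) a s0' as' one_c).
Qed.

(** The remainder of the first-order expansion of 1 / (z - a) in a is exactly
    (b - a) ^ 2 / ((z - b) (z - a) ^ 2), and q bounds the distance of a and b to the
    circle from below. *)
Lemma cauchy1_deriv s g a : s < 1 -> normc a < s -> circ_cont s g ->
  has_cderiv (cauchy1 s g) a (cauchy2 s g a).
Proof.
move=> s1 as' gc; have s0 : 0 < s by exact: le_lt_trans (normc_ge0 _) as'.
have s0' := ltW s0.
have [M M0 hM] := circ_cont_bound s0' gc.
pose q := (s - normc a) / 2; have q0 : 0 < q by rewrite divr_gt0// subr_gt0.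
pose B := 2 * (M * s * (q^-1 * (q^-1 * q^-1))) * (2 * pi - 0).
have B0 : 0 < B.
  by rewrite /B subr0 !mulr_gt0// ?invr_gt0// pi_gt0.
move=> e e0; exists (Num.min q (e / B)); first by rewrite lt_min q0 divr_gt0.
move=> b; rewrite lt_min => /andP[bq be].
have bs : normc b <= normc a + q.
  by have := normc_triangle (b - a) a; rewrite subrK => h; lra.
have bs' : normc b < s by move: bs; rewrite /q => ?; lra.
have pa := pcont_cauchy1 s0' as' gc.
have pb := pcont_cauchy1 s0' bs' gc.
have pa2 := pcont_cauchy2 s0' as' gc.
pose k t := g (circ s t) * circ s t *
  ((circ s t - b)^-1 * ((circ s t - a)^-1 * (circ s t - a)^-1)).
have pk : pconts 0 (2 * pi) k.
  move=> t tI; apply: pcontM.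
    by apply: pcontM; [apply: pcont_comp|]; rewrite //; exact: pcont_circ.
  apply: pcontM; first exact: pcont_inv.
  by apply: pcontM; exact: pcont_inv.
have E : cauchy1 s g b - cauchy1 s g a - cauchy2 s g a * (b - a) =
    (b - a) * (b - a) * cint 0 (2 * pi) k.
  rewrite /cauchy1 /cauchy2 -cintB// (mulrC _ (b - a)) -!cintZ// -cintB//.
  - apply: eq_cint => t _; rewrite /k.
    have h1 : circ s t - a != 0 by rewrite subr_eq0 circ_neq.
    have h2 : circ s t - b != 0 by rewrite subr_eq0 circ_neq.
    by field; rewrite h1 h2.
  - move=> t tI; rewrite (_ : (fun _ => _) = (fun t => g (circ s t) * circ s t / (circ s t - b) +
      -1 * (g (circ s t) * circ s t / (circ s t - a)))); last first.
      by apply/funext => x; rewrite mulN1r.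
    by apply: pcontD; [exact: pb | apply: pcontM; [exact: pcont_cst | exact: pa]].
  - by move=> t tI; apply: pcontM; [exact: pcont_cst | exact: pa2].
rewrite E (normcM (_ * _)) (normcM (b - a)).
have kB : normc (cint 0 (2 * pi) k) <= B.
  apply: cint_le => //; first exact: ltW twopi_gt0.
  move=> t tI; rewrite /k (normcM (_ * _)) (normcM (g _)) normc_circ//.
  have qa : q <= normc (circ s t - a).
    by have := circ_sub_ge t a s0'; rewrite /q => ?; have := normc_ge0 a => ?; lra.
  have qb : q <= normc (circ s t - b).
    by have := circ_sub_ge t b s0'; move: bs; rewrite /q => ? ?; lra.
  have iq x : q <= normc x -> normc x^-1 <= q^-1.
    by move=> qx; rewrite normcV lef_pV2// posrE (lt_le_trans q0).
  apply: ler_pM; rewrite ?mulr_ge0 ?normc_ge0//.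
    by rewrite ler_wpM2r// hM.
  rewrite (normcM (circ s t - b)^-1) (normcM (circ s t - a)^-1).
  by rewrite !ler_pM ?mulr_ge0 ?normc_ge0 ?iq.
rewrite mulrC (mulrC e) mulrC -mulrA ler_wpM2l ?normc_ge0//.
apply: (le_trans (ler_wpM2l (normc_ge0 _) kB)).
by rewrite -ler_pdivlMr// ltW.
Qed.

Lemma cauchy2_cont s g a : s < 1 -> normc a < s -> circ_cont s g ->
  ccont (cauchy2 s g) a.
Proof.
move=> s1 as' gc; have s0 : 0 < s by exact: le_lt_trans (normc_ge0 _) as'.
have s0' := ltW s0.
have [M M0 hM] := circ_cont_bound s0' gc.
pose q := (s - normc a) / 2; have q0 : 0 < q by rewrite divr_gt0// subr_gt0.
pose B := 2 * (M * s * (q^-1 * q^-1 * (q^-1 + q^-1))) * (2 * pi - 0).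
have B0 : 0 < B.
  have iq0 : 0 < q^-1 by rewrite invr_gt0.
  have p0 := @pi_gt0 R.
  by rewrite /B subr0 !mulr_gt0// addr_gt0.
move=> e e0; exists (Num.min q (e / B)); first by rewrite lt_min q0 divr_gt0.
move=> b; rewrite lt_min => /andP[bq be].
have bs : normc b <= normc a + q.
  by have := normc_triangle (b - a) a; rewrite subrK => h; lra.
have bs' : normc b < s by move: bs; rewrite /q => ?; lra.
have pa := pcont_cauchy2 s0' as' gc.
have pb := pcont_cauchy2 s0' bs' gc.
pose k t := g (circ s t) * circ s t *
  ((circ s t - b)^-1 * (circ s t - a)^-1 * ((circ s t - a)^-1 + (circ s t - b)^-1)).
have pk : pconts 0 (2 * pi) k.
  move=> t tI; apply: pcontM.
    by apply: pcontM; [apply: pcont_comp|]; rewrite //; exact: pcont_circ.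
  apply: pcontM; first by apply: pcontM; exact: pcont_inv.
  by apply: pcontD; exact: pcont_inv.
have E : cauchy2 s g b - cauchy2 s g a = (b - a) * cint 0 (2 * pi) k.
  rewrite /cauchy2 -cintB// -!cintZ//.
  apply: eq_cint => t _; rewrite /k.
  have h1 : circ s t - a != 0 by rewrite subr_eq0 circ_neq.
  have h2 : circ s t - b != 0 by rewrite subr_eq0 circ_neq.
  by field; rewrite h1 h2.
rewrite E (normcM (b - a)).
have kB : normc (cint 0 (2 * pi) k) <= B.
  apply: cint_le => //; first exact: ltW twopi_gt0.
  move=> t tI; rewrite /k (normcM (_ * _)) (normcM (g _)) normc_circ//.
  have qa : q <= normc (circ s t - a).
    by have := circ_sub_ge t a s0'; rewrite /q => ?; have := normc_ge0 a => ?; lra.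
  have qb : q <= normc (circ s t - b).
    by have := circ_sub_ge t b s0'; move: bs; rewrite /q => ? ?; lra.
  have iq x : q <= normc x -> normc x^-1 <= q^-1.
    by move=> qx; rewrite normcV lef_pV2// posrE (lt_le_trans q0).
  apply: ler_pM; rewrite ?mulr_ge0 ?normc_ge0//.
    by rewrite ler_wpM2r// hM.
  rewrite (normcM (_ * _)) (normcM (circ s t - b)^-1).
  apply: ler_pM; rewrite ?mulr_ge0 ?normc_ge0//.
    by rewrite ler_pM ?normc_ge0 ?iq.
  by apply: (le_trans (normc_triangle _ _)); rewrite lerD ?iq.
apply: (le_lt_trans (ler_wpM2l (normc_ge0 _) kB)).
by rewrite -ltr_pdivlMr.
Qed.

(** Integration by parts: the derivative of G z / (z - a) has integral 0. *)
Lemma cauchy2_parts s g G a : s < 1 -> normc a < s ->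
  (forall z, normc z < 1 -> has_cderiv G z (g z)) ->
  (forall z, normc z < 1 -> ccont g z) ->
  cauchy2 s G a = cauchy1 s g a.
Proof.
move=> s1 as' dG gc; have s0 : 0 < s by exact: le_lt_trans (normc_ge0 _) as'.
have s0' := ltW s0.
have c1 t : normc (circ s t) < 1 by rewrite normc_lt1_circ.
have gcc : circ_cont s g by move=> t; apply: gc.
have Gcc : circ_cont s G by move=> t; apply: has_cderiv_cont (dG _ _).
pose H w := G w * (w - a)^-1.
pose h w := g w * (w - a)^-1 + G w * - (w - a)^-1 ^+ 2.
have dH t : has_cderiv H (circ s t) (h (circ s t)).
  by apply: has_cderivM; [exact: dG | apply: has_cderiv_invB; exact: circ_neq].
have p1 := pcont_cauchy1 s0' as' gcc.
have p2 := pcont_cauchy2 s0' as' Gcc.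
have pc : pconts 0 (2 * pi) (fun t => h (circ s t) * circ s t).
  move=> t tI; rewrite (_ : (fun _ => _) = fun t =>
     g (circ s t) * circ s t * (circ s t - a)^-1 +
     -1 * (G (circ s t) * circ s t * ((circ s t - a)^-1 ^+ 2))); last first.
    by apply/funext => x; rewrite /h; ring.
  by apply: pcontD; [exact: p1 | apply: pcontM; [exact: pcont_cst | exact: p2]].
have : 'i * cint 0 (2 * pi) (fun t => h (circ s t) * circ s t) = 0.
  rewrite -cintZ// (@cint_FTC _ _ _ (fun t => H (circ s t)) _ twopi_gt0).
  - by rewrite circ_periodic subrr.
  - move=> t _; rewrite mulrCA; apply: (@has_rderiv_comp _ H) => //.
    exact: has_rderiv_circ.
  - by move=> t t01; apply: pcontM; [exact: pcont_cst | exact: pc].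
move=> /eqP; rewrite mulf_eq0 (negPf (neq0Ci _)) /= => /eqP E.
apply/eqP; rewrite eq_sym -subr_eq0 /cauchy1 /cauchy2 -cintB//; apply/eqP.
rewrite -[RHS]E; apply: eq_cint => t _; rewrite /h; ring.
Qed.

Lemma twopiC_neq0 : (2 * pi)%:C != 0 :> R[i].
Proof. by rewrite eq_complex /= (gt_eqF twopi_gt0). Qed.

Lemma holo_cderiv f z : holo f -> normc z < 1 -> has_cderiv f z (cderive f z).
Proof. by move=> fh /fh[d fd]; rewrite (has_cderiv_cderive fd). Qed.

(** Let F be a primitive of f. Cauchy's formula holds for F; differentiated in a
    it expresses f by [cauchy2] of F, which is [cauchy1] of f by parts. *)
Lemma cauchy_formula f s a : holo f -> s < 1 -> normc a < s ->
  cauchy1 s f a = (2 * pi)%:C * f a.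
Proof.
move=> fh s1 as'; have s0 := le_lt_trans (normc_ge0 _) as'.
pose F := seg f 0.
have dF z : normc z < 1 -> has_cderiv F z (f z) by exact: primitive.
have fc z : normc z < 1 -> ccont f z by exact: holo_cont.
have Fcc : circ_cont s F.
  by move=> t; apply: has_cderiv_cont (dF _ _); rewrite normc_circ// ltW.
rewrite -(cauchy2_parts s1 as' dF fc).
have d1 := cauchy1_deriv s1 as' Fcc.
have a1 : normc a < 1 by exact: lt_trans s1.
have d2 := @has_cderiv_comp _ (fun w => 0 + (2 * pi)%:C * w) F a _ _
   (has_cderiv_affine _ _ _) (dF a a1).
apply: has_cderiv_unique d1 _.
move=> e e0; have [r r0 h] := d2 e e0.
exists (Num.min r (s - normc a)); first by rewrite lt_min r0 subr_gt0.
move=> w; rewrite lt_min => /andP[wr ws].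
have ws' : normc w < s.
  by have := normc_triangle (w - a) a; rewrite subrK => ?; lra.
have := h w wr; rewrite /= !add0r.
by rewrite !(cauchy1_primitive s1 _ dF fc).
Qed.

Lemma cderive_cauchy2 f s a : holo f -> s < 1 -> normc a < s ->
  cauchy2 s f a = (2 * pi)%:C * cderive f a.
Proof.
move=> fh s1 as'; have s0 := le_lt_trans (normc_ge0 _) as'.
have fcc : circ_cont s f by move=> t; apply: holo_cont => //; rewrite normc_circ// ltW.
have d1 := cauchy1_deriv s1 as' fcc.
have a1 : normc a < 1 by exact: lt_trans s1.
have d2 := @has_cderiv_comp _ (fun w => 0 + (2 * pi)%:C * w) f a _ _
   (has_cderiv_affine _ _ _) (holo_cderiv fh a1).
apply: has_cderiv_unique d1 _.
move=> e e0; have [r r0 h] := d2 e e0.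
exists (Num.min r (s - normc a)); first by rewrite lt_min r0 subr_gt0.
move=> w; rewrite lt_min => /andP[wr ws].
have ws' : normc w < s.
  by have := normc_triangle (w - a) a; rewrite subrK => ?; lra.
have := h w wr; rewrite /= !add0r.
by rewrite !(cauchy_formula fh s1).
Qed.

(** Off the circle the integral [cauchy2] depends continuously on the point. *)
Lemma cderive_cont f a : holo f -> normc a < 1 -> ccont (cderive f) a.
Proof.
move=> fh a1; pose s := (1 + normc a) / 2.
have as' : normc a < s by rewrite /s; lra.
have s1 : s < 1 by rewrite /s; lra.
have s0 := le_lt_trans (normc_ge0 _) as'.
have fcc : circ_cont s f by move=> t; apply: holo_cont => //; rewrite normc_circ// ltW.
move=> e e0; have e2 : 0 < e * (2 * pi) by rewrite mulr_gt0// twopi_gt0.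
have [r r0 h] := cauchy2_cont s1 as' fcc e2.
exists (Num.min r (s - normc a)); first by rewrite lt_min r0 subr_gt0.
move=> w; rewrite lt_min => /andP[wr ws].
have ws' : normc w < s.
  by have := normc_triangle (w - a) a; rewrite subrK => ?; lra.
have := h w wr; rewrite !(cderive_cauchy2 fh s1)// -mulrBr normcM normc_twopi.
by rewrite mulrC ltr_pM2r// twopi_gt0.
Qed.

Lemma cderive_cauchy1 f s a : holo f -> s < 1 -> normc a < s ->
  cauchy1 s (cderive f) a = (2 * pi)%:C * cderive f a.
Proof.
move=> fh s1 as'; rewrite -(cderive_cauchy2 fh s1 as'); apply/esym.
apply: cauchy2_parts => // z z1; first exact: holo_cderiv.
exact: cderive_cont.
Qed.

End CauchyFormula.

(** * Expansions in powers *)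

Section Taylor.
Context {R : realType}.
Implicit Types (f F g phi : R[i] -> R[i]) (a b z w : R[i]) (t s : R).

(** The kernel z / (z - a) is a geometric series in a / z whose n-th remainder
    is (a / z) ^ n * z / (z - a). The hypothesis is Cauchy's formula, so that
    the lemma serves both a holomorphic function and its derivative. *)
Lemma taylor s g : 0 < s -> s < 1 -> circ_cont s g ->
  (forall a, normc a < s -> cauchy1 s g a = (2 * pi)%:C * g a) ->
  exists c : nat -> R[i], exists2 M : R, 0 < M &
  forall n a, normc a < s ->
    normc (g a - \sum_(k < n) c k * a ^+ k) <= M / (s - normc a) * (normc a / s) ^+ n.
Proof.
move=> s0 s1 gc gE; have s0' := ltW s0.
have [M M0 hM] := circ_cont_bound s0' gc.
have cn t : circ s t != 0 by rewrite -normc_gt0 normc_circ.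
pose C k := cint 0 (2 * pi) (fun t => g (circ s t) * (circ s t)^-1 ^+ k).
pose D n a := cint 0 (2 * pi) (fun t => g (circ s t) * (circ s t)^-1 ^+ n *
   (circ s t * (circ s t - a)^-1)).
have pinv0 t : pcont (fun t => (circ s t)^-1) t.
  have h : normc (0 : R[i]) < s by rewrite normcc0.
  have := pcont_inv t s0' h.
  by rewrite (_ : (fun _ => _) = fun t => (circ s t)^-1)//; apply/funext => x; rewrite subr0.
have pX n t : pcont (fun t => (circ s t)^-1 ^+ n) t.
  elim: n => [|n IH].
    by rewrite (_ : (fun _ => _) = fun=> 1); [exact: pcont_cst|apply/funext => x; rewrite expr0].
  rewrite (_ : (fun _ => _) = fun t => (circ s t)^-1 * (circ s t)^-1 ^+ n).
    exact: pcontM.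
  by apply/funext => x; rewrite exprS.
have pg t : pcont (fun t => g (circ s t)) t.
  by apply: pcont_comp => //; exact: pcont_circ.
have pC k : pconts 0 (2 * pi) (fun t => g (circ s t) * (circ s t)^-1 ^+ k).
  by move=> t _; apply: pcontM.
have pD n a : normc a < s -> pconts 0 (2 * pi) (fun t => g (circ s t) * (circ s t)^-1 ^+ n *
   (circ s t * (circ s t - a)^-1)).
  move=> as' t _; apply: pcontM; first exact: pcontM.
  by apply: pcontM; [exact: pcont_circ | exact: pcont_inv].
have DS n a : normc a < s -> D n a = C n + a * D n.+1 a.
  move=> as'; rewrite /D /C -cintZ; last exact: pD.
  rewrite -cintD//; last first.
    by move=> t tI; apply: pcontM; [exact: pcont_cst | exact: (pD n.+1 a as')].
  apply: eq_cint => t _; rewrite exprS.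
  by field; rewrite cn subr_eq0 circ_neq.
exists (fun k => (2 * pi)%:C^-1 * C k).
exists (2 * M * s); first by rewrite !mulr_gt0.
move=> n a as'.
have E : cauchy1 s g a = \sum_(k < n) C k * a ^+ k + a ^+ n * D n a.
  elim: n => [|n IH].
    rewrite big_ord0 add0r expr0 mul1r; apply: eq_cint => t _.
    by rewrite expr0 mulr1 mulrA.
  by rewrite big_ord_recr /= IH (DS n a as') exprS; ring.
have -> : g a - \sum_(k < n) (2 * pi)%:C^-1 * C k * a ^+ k =
    (2 * pi)%:C^-1 * (a ^+ n * D n a).
  have -> : g a = (2 * pi)%:C^-1 * cauchy1 s g a.
    by rewrite gE// mulKf// twopiC_neq0.
  rewrite E mulrDr big_distrr /= addrAC.
  under eq_bigr do rewrite mulrA.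
  by rewrite subrr add0r.
have Dn : normc (D n a) <= 2 * (M * (s^-1 ^+ n) * (s * (s - normc a)^-1)) * (2 * pi - 0).
  apply: cint_le; [exact: ltW twopi_gt0 | exact: pD|].
  move=> t tI; rewrite (normcM (_ * _)) (normcM (g _)) (normcM (circ s t)).
  rewrite normcX !normcV normc_circ//.
  apply: ler_pM; rewrite ?mulr_ge0 ?normc_ge0 ?exprn_ge0 ?invr_ge0 ?normc_ge0//.
    by rewrite ler_wpM2r ?hM// exprn_ge0// invr_ge0.
  rewrite ler_wpM2l// lef_pV2 ?posrE ?circ_sub_ge ?subr_gt0//.
  by rewrite normc_gt0 subr_eq0 circ_neq.
rewrite normcM normcV normc_twopi normcM normcX.
apply: (@le_trans _ _ ((2 * pi)^-1 * (normc a ^+ n *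
   (2 * (M * (s^-1 ^+ n) * (s * (s - normc a)^-1)) * (2 * pi - 0))))).
  by rewrite ler_wpM2l ?invr_ge0 ?(ltW twopi_gt0)// ler_wpM2l// exprn_ge0// normc_ge0.
rewrite subr0 exprMn le_eqVlt; apply/orP; left; apply/eqP.
have p0 : (pi : R) != 0 by rewrite gt_eqF ?pi_gt0.
set X := s^-1 ^+ n; set A := normc a ^+ n; set q := s - normc a.
have q0 : q != 0 by rewrite subr_eq0 gt_eqF.
by move: (pi : R) p0 => P p0; field; rewrite p0 q0.
Qed.

Lemma cderive_poly_approx f (r e : R) : holo f -> 0 <= r < 1 -> 0 < e ->
  exists n, exists c : nat -> R[i], forall a, normc a <= r ->
    normc (cderive f a - \sum_(k < n) c k * a ^+ k) <= e.
Proof.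
move=> fh /andP[r0 r1] e0; pose s := (1 + r) / 2.
have rs : r < s by rewrite /s; lra.
have s1 : s < 1 by rewrite /s; lra.
have s0 : 0 < s := le_lt_trans r0 rs.
clearbody s.
have cc : circ_cont s (cderive f).
  by move=> t; apply: cderive_cont => //; rewrite normc_circ// ltW.
have [c [M M0 hM]] := taylor s0 s1 cc (fun a as' => cderive_cauchy1 fh s1 as').
have K0 : 0 < M / (s - r) by rewrite divr_gt0// subr_gt0.
have [n hn] : exists n, (r / s) ^+ n < e / (M / (s - r)).
  apply: expr_lt_eventually; last by rewrite divr_gt0.
  by rewrite divr_ge0 ?(ltW s0)// ltr_pdivrMr// mul1r.
exists n, c => a ar; have as' := le_lt_trans ar rs.
apply: (le_trans (hM n a as')).
move: hn; rewrite ltr_pdivlMr// mulrC => /ltW; apply: le_trans.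
apply: ler_pM.
- by rewrite divr_ge0 ?(ltW M0)// subr_ge0 ltW.
- by rewrite exprn_ge0// divr_ge0 ?normc_ge0 ?(ltW s0).
- by rewrite ler_wpM2l ?(ltW M0)// lef_pV2 ?posrE ?subr_gt0// lerD2l lerN2.
apply: lerXn2r; rewrite ?nnegrE ?divr_ge0 ?normc_ge0 ?(ltW s0)//.
by apply: ler_wpM2r; rewrite ?invr_ge0 ?(ltW s0).
Qed.

(** An injective function is not constant near 0, so one of the Taylor
    coefficients c k with 0 < k is not 0; the least such k is the leading one. *)
Lemma leading_term f : holo f -> set_inj unit_disk f ->
  exists k c, [/\ (0 < k)%N, c != 0 & exists2 K : R, 0 < K &
    forall a, normc a <= 2^-1 ->
      normc (f a - f 0 - c * a ^+ k) <= K * normc a ^+ k.+1].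
Proof.
move=> fh fi; pose s : R := 3 / 4.
have s0 : 0 < s by rewrite /s; lra.
have s1 : s < 1 by rewrite /s; lra.
have hs : 2^-1 < s by rewrite /s; lra.
have fcc : circ_cont s f.
  by move=> t; apply: holo_cont => //; rewrite normc_circ// ltW.
have [c [M M0 hM]] := taylor s0 s1 fcc (fun a as' => cauchy_formula fh s1 as').
have f0 : f 0 = c 0%N.
  apply/eqP; rewrite -subr_eq0 -normc_eq0 eq_le normc_ge0 andbT.
  have := hM 1%N 0; rewrite normcc0 => /(_ s0).
  by rewrite big_ord_recl big_ord0 expr0 mulr1 addr0 mul0r expr1 mulr0.
have [[k k0 ck]|no] := pselect (exists2 k, (0 < k)%N & c k != 0).
  have ex : exists k, (0 < k)%N && (c k != 0) by exists k; rewrite k0.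
  case: (ex_minnP ex) => {k k0 ck}k /andP[k0 ck] kmin.
  exists k, (c k); split=> //.
  exists (M / (s - 2^-1) * s^-1 ^+ k.+1).
    by rewrite mulr_gt0 ?exprn_gt0 ?divr_gt0 ?invr_gt0 ?subr_gt0.
  move=> a ah; have as' := le_lt_trans ah hs.
  have := hM k.+1 a as'.
  have -> : \sum_(i < k.+1) c i * a ^+ i = c 0%N + c k * a ^+ k.
    rewrite big_ord_recr /=; congr (_ + _).
    case: k k0 {ck as' ah} kmin => // k _ kmin.
    rewrite big_ord_recl /= expr0 mulr1 big1 ?addr0// => i _.
    suff -> : c (bump 0 i) = 0 by rewrite mul0r.
    apply/eqP; apply: contraT => ci.
    have := kmin (bump 0 i); rewrite ci => /(_ isT).
    by rewrite /bump /= add1n ltnNge => /negP[]; exact: ltn_ord i.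
  rewrite -f0 opprD addrA => /le_trans; apply.
  rewrite exprMn mulrA mulrAC ler_wpM2r ?exprn_ge0 ?normc_ge0//.
  rewrite ler_wpM2r ?exprn_ge0 ?invr_ge0 ?(ltW s0)//.
  by rewrite ler_wpM2l ?(ltW M0)// lef_pV2 ?posrE ?subr_gt0// lerD2l lerN2.
exfalso.
have cst a : normc a <= 2^-1 -> f a = c 0%N.
  move=> ah; have as' := le_lt_trans ah hs.
  apply/eqP; rewrite -subr_eq0 -normc_eq0 eq_le normc_ge0 andbT.
  apply/ler_addgt0Pr => e e0; rewrite add0r.
  have K0 : 0 < M / (s - normc a) by rewrite divr_gt0// subr_gt0.
  have [n hn] : exists n, (normc a / s) ^+ n < e / (M / (s - normc a)).
    apply: expr_lt_eventually; last by rewrite divr_gt0.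
    by rewrite divr_ge0 ?normc_ge0 ?(ltW s0)// ltr_pdivrMr// mul1r.
  have K1 : normc a / s <= 1 by rewrite ler_pdivrMr// mul1r ltW.
  have := hM n.+1 a as'.
  rewrite big_ord_recl expr0 mulr1 /= big1 ?addr0; last first.
    move=> i _; suff -> : c (bump 0 i) = 0 by rewrite mul0r.
    apply/eqP; apply: contraT => ci; case: no.
    by exists (bump 0 i).
  move=> /le_trans; apply.
  move: hn; rewrite ltr_pdivlMr// mulrC => /ltW; apply: le_trans.
  rewrite ler_wpM2l ?(ltW K0)// exprS ler_piMl// exprn_ge0// divr_ge0 ?normc_ge0//.
  exact: ltW.
pose h : R[i] := (2^-1)%:C.
have hn : normc h = 2^-1 by rewrite normc_real ger0_norm// invr_ge0.
have h1 : h \in (unit_disk : set R[i]).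
  by apply/mem_set/unit_diskE; rewrite hn; lra.
have h0 : 0 \in (unit_disk : set R[i]).
  by apply/mem_set/unit_diskE; rewrite normcc0.
have : h = 0.
  apply: fi => //; rewrite !cst// ?hn//.
  by rewrite normcc0 invr_ge0.
by move/eqP; rewrite -normc_eq0 hn invr_eq0 pnatr_eq0.
Qed.

End Taylor.

(** * Polar coordinates and the open mapping theorem *)

Section Polar.
Context {R : realType}.
Implicit Types (z : R[i]) (t : R).

Lemma polar_circ (r t : R) : polar r t = circ r t.
Proof. by rewrite /circ /cis /polar; apply/eqP; rewrite eq_complex /=; apply/andP; split; apply/eqP; ring. Qed.

Lemma circP z : exists2 t : R, 0 <= t <= 2 * pi & z = circ (normc z) t.
Proof.
have [->|z0] := eqVneq z 0.
  exists 0; first by rewrite lexx (ltW twopi_gt0).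
  by rewrite normcc0 /circ rmorph0 mul0r.
have n0 : 0 < normc z by rewrite normc_gt0.
pose c := Re z / normc z.
have c1 : -1 <= c <= 1.
  by rewrite -ler_norml normrM normfV (ger0_norm (normc_ge0 z)) ler_pdivrMr// mul1r Re_le_normc.
have cs : (Im z / normc z) ^+ 2 = 1 - c ^+ 2.
  rewrite /c !expr_div_n; apply/eqP; rewrite eq_sym subr_eq addrC -mulrDl -normc_sqr.
  by rewrite divff// expf_neq0// gt_eqF.
have cosE : cos (acos c) = c by rewrite acosK// in_itv/=.
have sinE : sin (acos c) = `|Im z / normc z|.
  by rewrite sin_acos// -cs sqrtr_sqr.
have a0 : 0 <= acos c <= pi by rewrite acos_ge0// acos_lepi.
have zE (x y : R) : x = c -> y = Im z / normc z -> z = (normc z)%:C * Complex x y.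
  move=> -> ->; case: z z0 n0 @c {c1 cs cosE sinE a0} => x' y' z0 n0 c.
  apply/eqP; rewrite eq_complex ReM ImM.
  set n := normc _; have nn : n != 0 by rewrite gt_eqF.
  rewrite /c -/n; apply/andP; split; apply/eqP; simpl; rewrite mul0r ?subr0 ?addr0.
    by rewrite mulrC divfK.
  by rewrite mulrC divfK.
have [s0|s0] := leP 0 (Im z / normc z).
  exists (acos c); first by move/andP: a0 => [? ?]; apply/andP; split; lra.
  by apply: zE; rewrite // sinE ger0_norm.
exists (2 * pi - acos c); first by move/andP: a0 => [? ?]; apply/andP; split; lra.
apply: zE; rewrite mulr_natl addrC.
  by rewrite cosD2pi cosN.
by rewrite sinD2pi sinN sinE ltr0_norm// opprK.
Qed.

End Polar.

Section OpenMapping.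
Context {R : realType}.
Implicit Types (f g phi : R[i] -> R[i]) (a b z w : R[i]).

(** If v = phi z1 - w is not 0, let c * a ^ k be the leading term of
    phi (z1 + l * a) - phi z1. Moving along a = t * b with c * b ^ k = - v changes
    phi - w into (1 - t ^ k) * v up to a smaller error, so its modulus drops. *)
Lemma min_modulus_zero phi w z1 (d : R) : holo phi -> set_inj unit_disk phi ->
  normc z1 < 1 -> 0 < d ->
  (forall z, normc (z - z1) < d -> normc (phi z1 - w) <= normc (phi z - w)) ->
  phi z1 = w.
Proof.
move=> ph pinj z11 d0 hmin.
apply/eqP; rewrite -subr_eq0; apply: contraT => v0.
pose l : R := 1 - normc z1.
have l0 : 0 < l by rewrite subr_gt0.
have l1 : l <= 1 by rewrite /l gerBl normc_ge0.
(* the disk of radius l around z1 becomes the unit disk *)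
pose f a := phi (z1 + l%:C * a).
have ind a : normc a < 1 -> normc (z1 + l%:C * a) < 1.
  move=> a1; apply: (le_lt_trans (normc_triangle _ _)).
  rewrite normcM normc_real ger0_norm ?(ltW l0)//.
  rewrite (_ : 1 = normc z1 + l * 1); last by rewrite /l mulr1 addrC subrK.
  by rewrite ltrD2l ltr_pM2l.
have fh : holo f.
  move=> a a1; have [D hD] := ph _ (ind _ a1).
  exists (D * l%:C); apply: (@has_cderiv_comp _ phi (fun a => z1 + l%:C * a)) => //.
  exact: has_cderiv_affine.
have fi : set_inj unit_disk f.
  move=> a b /set_mem/unit_diskE a1 /set_mem/unit_diskE b1 fab.
  have := pinj (z1 + l%:C * a) (z1 + l%:C * b).
  move=> /(_ _ _ fab) H.
  have /addrI : z1 + l%:C * a = z1 + l%:C * b.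
    by apply: H; apply/mem_set/unit_diskE; exact: ind.
  apply: mulfI; rewrite -normc_eq0 normc_real normr_eq0 gt_eqF//.
have [k [c [k0 c0 [K K0 hK]]]] := leading_term fh fi.
have f0 : f 0 = phi z1 by rewrite /f mulr0 addr0.
set v := phi z1 - w in v0 *.
pose b : R[i] := nthroot k (- v / c).
have bk : c * b ^+ k = - v by rewrite rootCK// mulrC divfK.
have b0 : 0 < normc b.
  rewrite normc_gt0; apply/eqP => b0; move: bk; rewrite b0 expr0n (gtn_eqF k0) mulr0.
  by move/eqP; rewrite eq_sym oppr_eq0 (negPf v0).
have v0' : 0 < normc v by rewrite normc_gt0.
have Kb0 : 0 < K * normc b ^+ k.+1 by rewrite mulr_gt0// exprn_gt0.
pose t := Num.min (Num.min 1 (2^-1 / normc b))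
   (Num.min (d / 2 / normc b) (normc v / 2 / (K * normc b ^+ k.+1))).
have t0 : 0 < t by rewrite !lt_min ltr01 !divr_gt0// invr_gt0.
have t1 : t <= 1 by rewrite /t !ge_min lexx.
have tb : t * normc b <= 2^-1.
  by rewrite -ler_pdivlMr// /t !ge_min lexx !orbT.
have td : t * normc b <= d / 2.
  by rewrite -ler_pdivlMr// /t !ge_min lexx !orbT.
have tv : t * (K * normc b ^+ k.+1) <= normc v / 2.
  by rewrite -ler_pdivlMr// /t !ge_min lexx !orbT.
clearbody t.
pose a := t%:C * b.
have an : normc a = t * normc b by rewrite normcM normc_real ger0_norm// ltW.
have ah : normc a <= 2^-1 by rewrite an.
have := hK a ah; rewrite f0.
have tk0 : 0 < t ^+ k by exact: exprn_gt0.
have tk1 : t ^+ k <= 1 by rewrite exprn_ile1// ltW.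
have ak : c * a ^+ k = - (t ^+ k)%:C * v.
  rewrite exprMn rmorphXn/= mulrCA bk; ring.
rewrite ak an exprMn exprSr => hE.
have hE2 : normc (f a - phi z1 - - (t ^+ k)%:C * v) <= t ^+ k * (normc v / 2).
  apply: (le_trans hE); rewrite mulrCA -!mulrA ler_wpM2l ?(ltW tk0)//.
have fa : normc (f a - w) < normc v.
  have -> : f a - w = (f a - phi z1 - - (t ^+ k)%:C * v) + (1 - t ^+ k)%:C * v.
    by rewrite rmorphB/= rmorph1 /v; ring.
  apply: (le_lt_trans (normc_triangle _ _)).
  rewrite (normcM (1 - _)%:C) normc_real ger0_norm ?subr_ge0//.
  have : 0 < t ^+ k * normc v by exact: mulr_gt0.
  move: hE2; rewrite mulrBl mul1r mulrA => ? ?; lra.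
suff H : normc (z1 + l%:C * a - z1) < d.
  by have := hmin _ H; rewrite -/(f a) leNgt fa.
have -> : z1 + l%:C * a - z1 = l%:C * a by ring.
rewrite normcM normc_real ger0_norm ?(ltW l0)// an.
have : l * (t * normc b) <= 1 * (t * normc b) by rewrite ler_wpM2r// mulr_ge0 ?ltW.
move=> ?; lra.
Qed.

(** The minimum of |phi - w| over a closed disk around z0 is not on the boundary
    circle, where phi stays away from phi z0 by injectivity, if w is close
    to phi z0; by [min_modulus_zero] it is therefore 0. *)
Lemma open_mapping phi z0 (r : R) : holo phi -> set_inj unit_disk phi ->
  normc z0 < 1 -> 0 < r ->
  exists2 d : R, 0 < d & forall w, normc (w - phi z0) < d ->
    exists z, [/\ normc (z - z0) < r, normc z < 1 & phi z = w].
Proof.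
move=> ph pinj z01 r0.
pose q := Num.min r (1 - normc z0) / 2.
have m0 : 0 < Num.min r (1 - normc z0) by rewrite lt_min r0 subr_gt0.
have q0 : 0 < q by rewrite divr_gt0.
have qr : q < r.
  have : Num.min r (1 - normc z0) <= r by rewrite ge_min lexx.
  by move: m0; rewrite /q => ? ?; lra.
have ql : q < 1 - normc z0.
  have : Num.min r (1 - normc z0) <= 1 - normc z0 by rewrite ge_min lexx orbT.
  by move: m0; rewrite /q => ? ?; lra.
clearbody q.
have ind z : normc (z - z0) <= q -> normc z < 1.
  by move=> zq; have := normc_triangle (z - z0) z0; rewrite subrK => ?; lra.
have pc z : normc (z - z0) <= q -> ccont phi z by move=> /ind; exact: holo_cont.
(* by compactness and injectivity *)
have [d d0 hd] : exists2 d : R, 0 < d & forall z, normc (z - z0) = q ->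
    d <= normc (phi z - phi z0).
  pose h (t : R) := normc (phi (z0 + circ q t) - phi z0).
  have hq t : normc (z0 + circ q t - z0) = q.
    by rewrite (_ : z0 + _ - z0 = circ q t); [rewrite normc_circ// ltW|ring].
  have hc : {within `[0, 2 * pi], continuous h}.
    apply: continuous_in_subspaceT => t _.
    apply/cvgrPdist_lt => e e0.
    have cz : ccont (fun z => phi z - phi z0) (z0 + circ q t).
      apply: ccontB; first by apply: pc; rewrite hq.
      by apply: has_cderiv_cont (has_cderiv_cst _ _).
    have pz : pcont (fun t => z0 + circ q t) t.
      by apply: pcontD; [exact: pcont_cst | exact: pcont_circ].
    have /pcontP/(_ e e0)[s s0 hs] :=
      @pcont_comp _ (fun z => phi z - phi z0) (fun t => z0 + circ q t) t cz pz.
    apply/nbhs_ballP; exists s => // x; rewrite /ball /= distrC => /hs.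
    by rewrite distrC; apply: le_lt_trans; exact: normc_dist2.
  have [c cI cmin] := EVT_min (ltW (@twopi_gt0 R)) hc.
  exists (h c) => [|z zq].
    rewrite normc_gt0 subr_eq0; apply/eqP => pe.
    have : z0 + circ q c = z0.
      by apply: pinj => //; apply/mem_set/unit_diskE => //; apply: ind; rewrite hq.
    move=> e; have := hq c; rewrite e subrr normcc0 => ?; lra.
  have [t tI zE] := circP (z - z0).
  have := cmin t; rewrite in_itv/= => /(_ tI) /le_trans; apply.
  by rewrite /h -zq -zE (addrC z0) subrK.
exists (d / 2) => [|w wd]; first exact: divr_gt0.
have wc z : normc (z - z0) <= q -> rccont (fun z => normc (phi z - w)) z.
  move=> zq; apply: ccont_normc; apply: ccontB; first exact: pc.
  by apply: has_cderiv_cont (has_cderiv_cst _ _).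
have [c cq cmin] := closed_disk_min (ltW q0) wc.
have c0 : normc (phi c - w) < d / 2.
  apply: le_lt_trans wd; apply: (le_trans (cmin z0 _)).
    by rewrite subrr normcc0 ltW.
  by rewrite normc_distC.
have cq' : normc (c - z0) < q.
  rewrite lt_neqAle cq andbT; apply/eqP => ce.
  have := hd c ce; have := normc_dist w (phi c) (phi z0) => ? ?; lra.
exists c; split; [exact: lt_trans qr | exact: ind |].
apply: (min_modulus_zero ph pinj (ind _ cq) (d := q - normc (c - z0))).
  by rewrite subr_gt0.
move=> z zc; apply: cmin; have := normc_dist c z z0 => ?; lra.
Qed.

End OpenMapping.

Section Inverse.
Context {R : realType}.
Implicit Types (phi : R[i] -> R[i]) (a b z w : R[i]).

Definition inverse_on phi w : R[i] :=
  if pselect (exists2 z, normc z < 1 & phi z = w) is left h then s2val (cid2 h) else 0.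

Lemma inverse_onK phi z : set_inj unit_disk phi -> normc z < 1 ->
  inverse_on phi (phi z) = z.
Proof.
move=> pinj z1; rewrite /inverse_on; case: pselect => [h|[]]; last by exists z.
case: (cid2 h) => y y1 /= yz; apply: pinj => //; apply/mem_set/unit_diskE => //.
Qed.

Lemma inverse_on_cont phi z : holo phi -> set_inj unit_disk phi -> normc z < 1 ->
  ccont (inverse_on phi) (phi z).
Proof.
move=> ph pinj z1 e e0; have [d d0 hd] := open_mapping ph pinj z1 e0.
exists d => // w /hd[y [yz y1 <-]].
by rewrite !inverse_onK.
Qed.

Lemma inverse_on_deriv phi z c : holo phi -> set_inj unit_disk phi -> normc z < 1 ->
  has_cderiv phi z c -> c != 0 -> has_cderiv (inverse_on phi) (phi z) c^-1.
Proof.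
move=> ph pinj z1 dphi c0.
have nc0 : 0 < normc c by rewrite normc_gt0.
move=> e e0.
pose eta := Num.min (normc c / 2) (e * normc c ^+ 2 / 2).
have eta0 : 0 < eta by rewrite lt_min !divr_gt0// mulr_gt0// exprn_gt0.
have eta1 : eta <= normc c / 2 by rewrite ge_min lexx.
have eta2 : eta <= e * normc c ^+ 2 / 2 by rewrite ge_min lexx orbT.
clearbody eta.
have [r r0 hr] := dphi _ eta0.
have [d d0 hd] := open_mapping ph pinj z1 r0.
exists d => // w /hd[y [yz y1 <-]].
rewrite !inverse_onK//.
have h := hr y yz.
have nzy := normc_ge0 (y - z).
have low : normc c / 2 * normc (y - z) <= normc (phi y - phi z).
  have := normc_triangle (phi y - phi z) (- (phi y - phi z - c * (y - z))).
  rewrite (_ : _ + _ = c * (y - z)); last by ring.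
  rewrite normcM normc_opp => h1.
  have := ler_wpM2r nzy eta1 => ?; lra.
have -> : y - z - c^-1 * (phi y - phi z) = - (c^-1 * (phi y - phi z - c * (y - z))).
  by field.
rewrite normc_opp normcM normcV mulrC ler_pdivrMr//.
apply: (le_trans h); apply: (le_trans (ler_wpM2r nzy eta2)).
have -> : e * normc c ^+ 2 / 2 * normc (y - z) = e * normc c * (normc c / 2 * normc (y - z)).
  by ring.
by rewrite [leRHS]mulrAC ler_wpM2l// mulr_ge0 ?ltW.
Qed.

End Inverse.

(** * Plane Lebesgue measure *)

Section ImageMeasure.
Context d d' (T1 : measurableType d) (T2 : measurableType d') (R : realType).
Variables (m : {measure set T1 -> \bar R}) (f : T1 -> T2).

(** The proof mf is an argument so that the measure structure is found from the
    term alone. *)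
Definition image_measure (mf : measurable_fun [set: T1] f) (A : set T2) : \bar R :=
  m (f @^-1` A).

Variable mf : measurable_fun [set: T1] f.

Let image_measure0 : image_measure mf set0 = 0%E.
Proof. by rewrite /image_measure preimage_set0 measure0. Qed.

Let image_measure_ge0 A : (0 <= image_measure mf A)%E.
Proof. exact: measure_ge0. Qed.

Let image_measure_sigma_additive : semi_sigma_additive (image_measure mf).
Proof.
have mp A : measurable A -> measurable (f @^-1` A).
  by move=> mA; rewrite -[X in measurable X]setTI; exact: mf.
move=> F mF tF mUF; rewrite /image_measure preimage_bigcup.
apply: measure_semi_sigma_additive.
- by move=> n; exact: mp.
- apply/trivIsetP => /= i j _ _ ij; rewrite -preimage_setI.
  by move/trivIsetP : tF => /(_ _ _ _ _ ij) ->//; rewrite preimage_set0.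
- by rewrite -preimage_bigcup; exact: mp.
Qed.

HB.instance Definition _ := isMeasure.Build _ _ _
  (image_measure mf) image_measure0 image_measure_ge0 image_measure_sigma_additive.

End ImageMeasure.

Section PlaneTransformations.
Context {R : realType}.
Local Notation mR := (measurableTypeR R).
Local Notation leb := (@lebesgue_measure R).
Local Notation leb2 := (leb \x leb)%E.

Lemma lebesgue_translation (c : R) (A : set mR) : measurable A ->
  leb ((fun y => y + c) @^-1` A) = leb A.
Proof.
move=> mA.
have mt : measurable_fun [set: mR] (fun y : mR => (y + c : mR)).
  exact: measurable_funD.
apply/esym; apply: (@lebesgue_measure_unique R (image_measure leb mt)) => //.
move=> X [[x y] xy <-].
rewrite [RHS](_ : _ = leb `]x - c, y - c]%classic); last first.
  rewrite /= /image_measure; congr (leb _).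
  by apply/seteqP; split=> z /=; rewrite !in_itv/= ltrBlDr lerBrDr.
rewrite !lebesgue_measure_itv /= !lte_fin ltrD2r; case: ifPn => // _.
by rewrite -!EFinB; congr EFin; ring.
Qed.

Lemma lebesgue_scaling (r : R) (A : set mR) : 0 < r -> measurable A ->
  leb ((fun y => r * y) @^-1` A) = ((r^-1)%:E * leb A)%E.
Proof.
move=> r0 mA.
have mt : measurable_fun [set: mR] (fun y : mR => (r * y : mR)).
  exact: measurable_funM.
have r0' : 0 <= r by exact: ltW.
suff : leb A = mscale (NngNum r0') (image_measure leb mt) A.
  rewrite /mscale /= => ->; rewrite muleA -EFinM mulVf ?mul1e// gt_eqF//.
apply: (@lebesgue_measure_unique R (mscale (NngNum r0') (image_measure leb mt))) => //.
move=> X [[x y] xy <-].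
rewrite [RHS](_ : _ = (r%:E * leb `](r^-1 * x)%R, (r^-1 * y)%R]%classic)%E); last first.
  rewrite /mscale /image_measure /=; congr (_ * leb _)%E.
  by apply/seteqP; split=> z /=; rewrite !in_itv/= ltr_pdivrMl// ler_pdivlMl.
rewrite !lebesgue_measure_itv /= !lte_fin ltr_pM2l ?invr_gt0//; case: ifPn => // _.
  by rewrite -!EFinB -EFinM; congr EFin; field; rewrite gt_eqF.
by rewrite mule0.
Qed.

Lemma preimage_measurableT d d' (T1 : measurableType d) (T2 : measurableType d')
  (f : T1 -> T2) (A : set T2) : measurable_fun setT f -> measurable A ->
  measurable (f @^-1` A).
Proof. by move=> mf mA; rewrite -[X in measurable X]setTI; exact: mf. Qed.

Definition scales_measure (T : mR * mR -> mR * mR) (k : R) :=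
  measurable_fun setT T /\ forall X, measurable X -> leb2 (T @^-1` X) = (k%:E * leb2 X)%E.

Lemma scales_measure_comp T1 T2 k1 k2 : scales_measure T1 k1 -> scales_measure T2 k2 ->
  scales_measure (T1 \o T2) (k2 * k1).
Proof.
move=> [m1 s1] [m2 s2]; split; first exact: measurableT_comp.
move=> X mX; rewrite comp_preimage s2 ?s1 ?EFinM ?muleA//.
exact: preimage_measurableT.
Qed.

Lemma scales_measure_ext T1 T2 k : T1 =1 T2 -> scales_measure T1 k -> scales_measure T2 k.
Proof. by move=> /funext ->. Qed.

Lemma scales_measure_translation (a b : R) :
  scales_measure (fun p => (p.1 + a, p.2 + b)) 1.
Proof.
have mT : measurable_fun setT (fun p : mR * mR => ((p.1 + a, p.2 + b) : mR * mR)).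
  apply: measurable_fun_pair; exact: measurable_funD.
split=> // X mX; rewrite mul1e; apply/esym.
apply: (@product_measure_unique _ _ _ _ _ leb leb
   (image_measure leb2 mT)) => //.
move=> A B mA mB; rewrite /= /image_measure.
rewrite (_ : _ @^-1` _ = ((fun y => y + a) @^-1` A) `*` ((fun y => y + b) @^-1` B)) //.
rewrite product_measure1E.
- by congr (_ * _)%E; exact: lebesgue_translation.
- apply: (@preimage_measurableT _ _ mR mR (fun y => y + a)) => //.
  exact: measurable_funD.
- apply: (@preimage_measurableT _ _ mR mR (fun y => y + b)) => //.
  exact: measurable_funD.
Qed.

Lemma scales_measure_swap : scales_measure (fun p => (p.2, p.1)) 1.
Proof.
have mT : measurable_fun setT (fun p : mR * mR => ((p.2, p.1) : mR * mR)).
  exact: measurable_fun_pair.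
split=> // X mX; rewrite mul1e; apply/esym.
apply: (@product_measure_unique _ _ _ _ _ leb leb
   (image_measure leb2 mT)) => //.
move=> A B mA mB; rewrite /= /image_measure.
rewrite (_ : _ @^-1` _ = B `*` A); last by apply/seteqP; split=> -[x y] /= [].
by rewrite product_measure1E// muleC.
Qed.

Lemma scales_measure_dilation (r : R) : 0 < r ->
  scales_measure (fun p => (r * p.1, r * p.2)) (r^-1 ^+ 2).
Proof.
move=> r0.
have mT : measurable_fun setT (fun p : mR * mR => ((r * p.1, r * p.2) : mR * mR)).
  apply: measurable_fun_pair; exact: measurable_funM.
split=> // X mX.
have r0' : 0 <= r ^+ 2 by rewrite sqr_ge0.
pose m' := mscale (NngNum r0')
   (image_measure leb2 mT).
have -> : leb2 X = m' X.
  apply: (@product_measure_unique _ _ _ _ _ leb leb m') => //.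
  move=> A B mA mB; transitivity ((r ^+ 2)%:E *
      leb2 (((fun y : mR => (r * y)%R : mR) @^-1` A) `*` ((fun y : mR => (r * y)%R : mR) @^-1` B)))%E => //.
  rewrite product_measure1E.
  - transitivity ((r ^+ 2)%:E * (((r^-1)%:E * leb A) * ((r^-1)%:E * leb B)))%E.
      by congr (_ * (_ * _))%E; exact: lebesgue_scaling.
    rewrite muleACA -EFinM [LHS]muleA -EFinM.
    have -> : r ^+ 2 * (r^-1 * r^-1) = 1 by field; rewrite gt_eqF.
    by rewrite mul1e.
  - apply: (@preimage_measurableT _ _ mR mR (fun y => r * y)) => //.
    exact: measurable_funM.
  - apply: (@preimage_measurableT _ _ mR mR (fun y => r * y)) => //.
    exact: measurable_funM.
rewrite /m' /mscale /= muleA -EFinM /image_measure.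
by rewrite -exprMn mulVf ?expr1n ?mul1e// gt_eqF.
Qed.

(** Translation invariance on each vertical line. *)
Lemma scales_measure_shear (k : R) : scales_measure (fun p => (p.1, p.2 + k * p.1)) 1.
Proof.
have mT : measurable_fun setT (fun p : mR * mR => ((p.1, p.2 + k * p.1) : mR * mR)).
  apply: measurable_fun_pair => //; apply: measurable_funD => //.
  exact: measurable_funM.
split=> // X mX; rewrite mul1e /product_measure1.
apply: eq_integral => x _ /=.
rewrite -(lebesgue_translation (k * x) (measurable_xsection x mX)).
congr (leb _); apply/seteqP; split=> y; rewrite /xsection /= ?inE /=.
Qed.

(** A rotation with b != 0 is a product of three shears; the remaining ones are
    the identity and the square of a quarter turn. *)
Lemma scales_measure_rotation (a b : R) : a ^+ 2 + b ^+ 2 = 1 ->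
  scales_measure (fun p => (a * p.1 - b * p.2, a * p.2 + b * p.1)) 1.
Proof.
have shx (k : R) : scales_measure (fun p => (p.1 + k * p.2, p.2)) 1.
  have := scales_measure_comp scales_measure_swap
     (scales_measure_comp (scales_measure_shear k) scales_measure_swap).
  by rewrite !mulr1; apply: scales_measure_ext => -[x y].
have rot (a' b' : R) : b' != 0 -> a' ^+ 2 + b' ^+ 2 = 1 ->
    scales_measure (fun p => (a' * p.1 - b' * p.2, a' * p.2 + b' * p.1)) 1.
  move=> b0 ab; have := scales_measure_comp (shx ((a' - 1) / b'))
     (scales_measure_comp (scales_measure_shear b') (shx ((a' - 1) / b'))).
  rewrite !mulr1; apply: scales_measure_ext => -[x y] /=; congr pair.
    have aa : a' ^+ 2 = 1 - b' ^+ 2 by rewrite -ab addrK.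
    rewrite -[RHS](mulfK b0).
    have -> : (a' * x - b' * y) * b' = a' * x * b' - (1 - a' ^+ 2) * y by rewrite aa; ring.
    by field.
  by field.
move=> ab; have [b0|b0] := eqVneq b 0; last exact: rot.
have a2 : a ^+ 2 = 1 by rewrite -ab b0 expr0n addr0.
have id1 : scales_measure id 1 by split=> // X mX; rewrite mul1e.
move/eqP: a2; rewrite sqrf_eq1 => /orP[] /eqP a1.
  by apply: scales_measure_ext id1 => -[x y]; rewrite a1 b0 /=; congr pair; ring.
have i1 : (0 : R) ^+ 2 + 1 ^+ 2 = 1 by rewrite expr0n add0r expr1n.
have := scales_measure_comp (rot 0 1 (oner_neq0 _) i1) (rot 0 1 (oner_neq0 _) i1).
rewrite mulr1; apply: scales_measure_ext => -[x y] /=; rewrite a1 b0; congr pair; ring.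
Qed.

End PlaneTransformations.

HB.instance Definition _ (R : realType) := isPointed.Build (complex R) 0.

Section PlaneMeasurable.
Context {R : realType}.
Local Notation mR := (measurableTypeR R).
Local Notation leb := (@lebesgue_measure R).
Local Notation leb2 := (leb \x leb)%E.

Definition plane_measurable (A : set (complex R)) : Prop :=
  measurable (complex_of_pair @^-1` A : set (mR * mR)).

Lemma plane_measurable0 : plane_measurable set0.
Proof. by rewrite /plane_measurable preimage_set0. Qed.

Lemma plane_measurableC (A : set (complex R)) : plane_measurable A -> plane_measurable (~` A).
Proof. by rewrite /plane_measurable preimage_setC; exact: measurableC. Qed.

Lemma plane_measurable_bigcup (F : (set (complex R))^nat) :
  (forall i, plane_measurable (F i)) -> plane_measurable (\bigcup_i F i).
Proof. by move=> mF; rewrite /plane_measurable preimage_bigcup; apply: bigcup_measurable => k _; exact: mF. Qed.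

HB.instance Definition _ := isMeasurable.Build default_measure_display (complex R)
  plane_measurable0 plane_measurableC plane_measurable_bigcup.

Lemma measurable_complex_of_pair :
  measurable_fun [set: mR * mR] (complex_of_pair : mR * mR -> R[i]).
Proof. by move=> _ A mA; rewrite setTI. Qed.

Definition plane_measure : {measure set R[i] -> \bar R} :=
  image_measure leb2 measurable_complex_of_pair.

Lemma plane_measureE (A : set R[i]) : plane_measure A = leb2 (complex_of_pair @^-1` A).
Proof. by []. Qed.

Definition pair_of_complex (z : R[i]) : R * R := (Re z, Im z).

Lemma complex_of_pairK z : complex_of_pair (pair_of_complex z) = z.
Proof. by case: z. Qed.

Lemma measurable_fun_complex d (T : measurableType d) (D : set T) (f : T -> R[i]) :
  measurable_fun D (fun t => Re (f t)) -> measurable_fun D (fun t => Im (f t)) ->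
  measurable_fun D f.
Proof.
move=> mre mim mD; have m0 := mD; move: mD.
suff : measurable_fun setT (f \_ D) by move=> /(measurable_restrictT f m0).2.
have mre' := (measurable_restrictT _ m0).1 mre.
have mim' := (measurable_restrictT _ m0).1 mim.
move=> _ Y mY; rewrite setTI.
have m2 : measurable_fun setT (fun t => ((Re ((f \_ D) t), Im ((f \_ D) t)) : mR * mR)).
  apply: measurable_fun_pair.
    move: mre'; congr measurable_fun; apply/funext => t.
    by rewrite /patch; case: ifP.
  move: mim'; congr measurable_fun; apply/funext => t.
  by rewrite /patch; case: ifP.
have := preimage_measurableT m2 mY; congr measurable; apply/seteqP.
by split=> t /=; rewrite /complex_of_pair /=; case: ((f \_ D) t).
Qed.

Lemma measurable_Re : measurable_fun [set: R[i]] (fun z => Re z : mR).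
Proof.
move=> _ Y mY; rewrite setTI /measurable /= /plane_measurable.
rewrite (_ : _ @^-1` _ = fst @^-1` Y); last by [].
exact: preimage_measurableT.
Qed.

Lemma measurable_Im : measurable_fun [set: R[i]] (fun z => Im z : mR).
Proof.
move=> _ Y mY; rewrite setTI /measurable /= /plane_measurable.
rewrite (_ : _ @^-1` _ = snd @^-1` Y); last by [].
exact: preimage_measurableT.
Qed.

(** Half-open, so that a square is the disjoint union of its four quarters. *)
Definition square (a : R[i]) (l : R) : set R[i] :=
  [set z | Re a <= Re z < Re a + l /\ Im a <= Im z < Im a + l].

Definition closed_square (a : R[i]) (l : R) : set R[i] :=
  [set z | Re a <= Re z <= Re a + l /\ Im a <= Im z <= Im a + l].

Lemma measurable_square a l : measurable (square a l).
Proof.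
rewrite /measurable /= /plane_measurable.
rewrite (_ : _ @^-1` _ = `[Re a, Re a + l[%classic `*` `[Im a, Im a + l[%classic).
  by apply: measurableX; exact: measurable_itv.
by apply/seteqP; split=> -[x y] /=; rewrite !in_itv.
Qed.

Lemma plane_measure_square a l : 0 <= l -> plane_measure (square a l) = (l ^+ 2)%:E.
Proof.
move=> l0; rewrite plane_measureE.
rewrite (_ : _ @^-1` _ = `[Re a, Re a + l[%classic `*` `[Im a, Im a + l[%classic); last first.
  by apply/seteqP; split=> -[x y] /=; rewrite !in_itv.
have E (x : R) : leb `[x, x + l[%classic = l%:E.
  rewrite lebesgue_measure_itv /= lte_fin ltrDl.
  case: ltgtP l0 => //= [l0 _|<- _//].
  by rewrite -EFinB; congr EFin; ring.
rewrite product_measure1E; [|exact: measurable_itv|exact: measurable_itv].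
rewrite expr2 EFinM; congr (_ * _)%E; exact: E.
Qed.

Definition copen (O : set R[i]) := forall z, O z ->
  exists2 r : R, 0 < r & forall w, normc (w - z) < r -> O w.

Definition shift_corner (a : R[i]) (l x y : R) : R[i] := Complex (Re a + x * l) (Im a + y * l).

Local Notation h := (2^-1 : R).

(** The union of the squares in the first n dyadic subdivisions of square a l
    whose closure lies in O. *)
Fixpoint dyadic_inner (O : set R[i]) (n : nat) (a : R[i]) (l : R) : set R[i] :=
  if pselect (closed_square a l `<=` O) then square a l else
  if n is m.+1 then
    dyadic_inner O m (shift_corner a l 0 0) (h * l) `|`
    dyadic_inner O m (shift_corner a l h 0) (h * l) `|`
    (dyadic_inner O m (shift_corner a l 0 h) (h * l) `|`
    dyadic_inner O m (shift_corner a l h h) (h * l))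
  else set0.

Lemma dyadic_inner_full (O : set R[i]) n a l : closed_square a l `<=` O ->
  dyadic_inner O n a l = square a l.
Proof. by case: n => [|n] H /=; case: pselect. Qed.

Lemma dyadic_inner_rec (O : set R[i]) n a l : ~ (closed_square a l `<=` O) ->
  dyadic_inner O n.+1 a l =
    dyadic_inner O n (shift_corner a l 0 0) (h * l) `|`
    dyadic_inner O n (shift_corner a l h 0) (h * l) `|`
    (dyadic_inner O n (shift_corner a l 0 h) (h * l) `|`
    dyadic_inner O n (shift_corner a l h h) (h * l)).
Proof. by move=> H /=; case: pselect. Qed.

Lemma square_split a l : 0 < l -> square a l =
  square (shift_corner a l 0 0) (h * l) `|` square (shift_corner a l h 0) (h * l) `|`
  (square (shift_corner a l 0 h) (h * l) `|` square (shift_corner a l h h) (h * l)).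
Proof.
move=> l0; apply/seteqP; split=> [z [/andP[x0 x1] /andP[y0 y1]]|z].
  rewrite /square /=.
  have [hx|hx] := ltP (Re z) (Re a + h * l); have [hy|hy] := ltP (Im z) (Im a + h * l).
  - by left; left; split; apply/andP; split; lra.
  - by right; left; split; apply/andP; split; lra.
  - by left; right; split; apply/andP; split; lra.
  - by right; right; split; apply/andP; split; lra.
by rewrite /square /= => -[[|]|[|]] [/andP[x0 x1] /andP[y0 y1]]; split; apply/andP; split; lra.
Qed.

Lemma dyadic_inner_square O n a l : 0 < l -> dyadic_inner O n a l `<=` square a l.
Proof.
elim: n a l => [|n IH] a l l0 /=; case: pselect => //= _ z; rewrite // square_split//.
have hl : 0 < h * l by rewrite mulr_gt0// invr_gt0.
by move=> [[|]|[|]] /IH-/(_ hl); [left; left|left; right|right; left|right; right].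
Qed.

Lemma dyadic_inner_sub O n a l : 0 < l -> dyadic_inner O n a l `<=` O.
Proof.
have sq a' l' : square a' l' `<=` closed_square a' l'.
  by move=> z [/andP[x0 x1] /andP[y0 y1]]; split; apply/andP; split=> //; exact: ltW.
elim: n a l => [|n IH] a l l0 /=; case: pselect => //= H z.
- by move=> zs; apply: H; exact: sq.
- by [].
- by move=> zs; apply: H; exact: sq.
have hl : 0 < h * l by rewrite mulr_gt0// invr_gt0.
by move=> [[|]|[|]] /IH; apply.
Qed.

Lemma measurable_dyadic_inner O n a l : measurable (dyadic_inner O n a l).
Proof.
elim: n a l => [|n IH] a l /=; case: pselect => //= H; try exact: measurable_square.
by apply: measurableU; apply: measurableU.
Qed.

Lemma dyadic_inner_incr O n a l : 0 < l -> dyadic_inner O n a l `<=` dyadic_inner O n.+1 a l.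
Proof.
elim: n a l => [|n IH] a l l0; first by rewrite /=; case: pselect => H z.
have hl : 0 < h * l by rewrite mulr_gt0// invr_gt0.
have [H|H] := pselect (closed_square a l `<=` O).
  by rewrite !dyadic_inner_full.
rewrite (dyadic_inner_rec n H) (dyadic_inner_rec n.+1 H) => z.
by move=> [[|]|[|]] /IH-/(_ hl); [left; left|left; right|right; left|right; right].
Qed.

Lemma dyadic_inner_mono O n m a l : 0 < l -> (n <= m)%N ->
  dyadic_inner O n a l `<=` dyadic_inner O m a l.
Proof.
move=> l0 /subnK <-; elim: (m - n)%N => // k IH.
by rewrite addSn; apply: subset_trans IH _; exact: dyadic_inner_incr.
Qed.

(** A subdivision square containing z whose diameter is small enough lies in a
    disk around z inside O. *)
Lemma dyadic_inner_exhaust (O : set R[i]) a l : 0 < l -> copen O ->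
  O `&` square a l = \bigcup_n dyadic_inner O n a l.
Proof.
move=> l0 oO; apply/seteqP; split=> [z [Oz zs]|z [n _ zn]]; last first.
  by split; [exact: dyadic_inner_sub zn | exact: dyadic_inner_square zn].
have [r r0 hr] := oO z Oz.
suff main n a' l' : 0 < l' -> 2 * l' < r * 2 ^+ n -> square a' l' z ->
    dyadic_inner O n a' l' z.
  have [n hn] : exists n, 2 * l < r * 2 ^+ n.
    exists (Num.bound (2 * l / r)); rewrite [X in _ < X]mulrC -ltr_pdivrMr//.
    apply: (lt_trans (archi_boundP _)); first by rewrite divr_ge0// ?mulr_ge0// ltW.
    by rewrite -natrX ltr_nat ltn_expl.
  by exists n => //; exact: main.
elim: n a' l' => [|n IH] a' l' l'0 ln zs'.
  rewrite dyadic_inner_full// => w [/andP[x0 x1] /andP[y0 y1]].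
  case: zs' => /andP[x2 x3] /andP[y2 y3].
  apply: hr; apply: (le_lt_trans (normc_le_ReIm _)); rewrite ReB ImB.
  rewrite expr0 mulr1 in ln.
  have : `|Re w - Re z| <= l' by rewrite ler_norml; apply/andP; split; lra.
  have : `|Im w - Im z| <= l' by rewrite ler_norml; apply/andP; split; lra.
  by move=> ? ?; lra.
have [H|H] := pselect (closed_square a' l' `<=` O).
  by rewrite dyadic_inner_full.
rewrite dyadic_inner_rec//.
have hl : 0 < h * l' by rewrite mulr_gt0// invr_gt0.
have ln' : 2 * (h * l') < r * 2 ^+ n.
  by move: ln; rewrite exprS mulrCA ltr_pM2l// mulVKf.
move: zs'; rewrite square_split// => -[[|]|[|]] zs'.
- by left; left; exact: IH.
- by left; right; exact: IH.
- by right; left; exact: IH.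
- by right; right; exact: IH.
Qed.

Lemma exhaust_squares : \bigcup_n square (Complex (- n.+1%:R) (- n.+1%:R)) (2 * n.+1%:R) = [set: R[i]].
Proof.
apply/seteqP; split=> // z _.
exists (Num.bound (normc z)) => //=.
have := archi_boundP (normc_ge0 z).
set N := Num.bound _ => hN.
have N1 : normc z < N.+1%:R by rewrite -[in X in _ < X]addn1 natrD; lra.
have := le_lt_trans (Re_le_normc z) N1; have := le_lt_trans (Im_le_normc z) N1.
rewrite !ltr_norml => /andP[? ?] /andP[? ?].
by split=> /=; apply/andP; split; lra.
Qed.

Lemma copen_measurable O : copen O -> measurable O.
Proof.
move=> oO; rewrite -(setIT O) -exhaust_squares setI_bigcupr.
apply: bigcup_measurable => n _.
have l0 : 0 < 2 * n.+1%:R :> R by rewrite mulr_gt0.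
rewrite (dyadic_inner_exhaust _ l0 oO).
by apply: bigcup_measurable => k _; exact: measurable_dyadic_inner.
Qed.

Lemma rccont_measurable (O : set R[i]) (g : R[i] -> R) : copen O ->
  (forall z, O z -> rccont g z) -> measurable_fun O g.
Proof.
move=> oO gc mO; apply: (measurability _ (RGenOInfty.measurableE R)) => //.
move=> /= _ [_ [x ->] <-]; apply: copen_measurable => z [Oz]; rewrite /= in_itv/= andbT => xg.
have [r r0 hr] := oO z Oz.
have [q q0 hq] : exists2 q : R, 0 < q & forall w, normc (w - z) < q -> `|g w - g z| < g z - x.
  by apply: gc => //; rewrite subr_gt0.
exists (Num.min r q) => [|w]; first by rewrite lt_min r0.
rewrite lt_min => /andP[/hr Ow /hq]; rewrite ltr_norml => /andP[? ?].
by split=> //=; rewrite in_itv/= andbT; lra.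
Qed.

Lemma ccont_measurable (O : set R[i]) (f : R[i] -> R[i]) : copen O ->
  (forall z, O z -> ccont f z) -> measurable_fun O f.
Proof.
move=> oO fc; apply: measurable_fun_complex; apply: rccont_measurable => // z /fc h e /h[r r0 k];
  exists r => // w /k; apply: le_lt_trans.
  by rewrite -ReB Re_le_normc.
by rewrite -ImB Im_le_normc.
Qed.

End PlaneMeasurable.

Section PlaneAffine.
Context {R : realType}.
Local Notation leb := (@lebesgue_measure R).
Local Notation leb2 := (leb \x leb)%E.

Lemma measurable_affine (b c : R[i]) : measurable_fun [set: R[i]] (fun w => b + c * w).
Proof.
apply: ccont_measurable; first by move=> z _; exists 1.
by move=> z _; apply: has_cderiv_cont (has_cderiv_affine _ _ _).
Qed.

Lemma scales_measure_affine (b c : R[i]) : c != 0 ->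
  scales_measure (fun p => pair_of_complex (b + c * complex_of_pair p))
    ((normc c)^-1 ^+ 2).
Proof.
move=> c0; have n0 : 0 < normc c by rewrite normc_gt0.
pose u := Re c / normc c; pose v := Im c / normc c.
have uv : u ^+ 2 + v ^+ 2 = 1.
  by rewrite /u /v !expr_div_n -mulrDl -normc_sqr divff// expf_neq0// gt_eqF.
have := scales_measure_comp (scales_measure_translation (Re b) (Im b))
  (scales_measure_comp (scales_measure_dilation n0) (scales_measure_rotation uv)).
rewrite mulr1 mul1r; apply: scales_measure_ext => -[x y] /=.
rewrite /pair_of_complex ReD ImD ReM ImM /=; congr pair.
  rewrite addrC; congr (_ + _); rewrite /u /v mulrBr !mulrA.
  by rewrite !(mulrC (normc c)) !mulfK// gt_eqF.
rewrite addrC; congr (_ + _); rewrite /u /v mulrDr !mulrA.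
by rewrite !(mulrC (normc c)) !mulfK// gt_eqF.
Qed.

Lemma plane_measure_affine (b c : R[i]) (X : set R[i]) : c != 0 -> measurable X ->
  plane_measure ((fun w => b + c * w) @^-1` X) = (((normc c)^-1 ^+ 2)%:E * plane_measure X)%E.
Proof.
move=> c0 mX; rewrite !plane_measureE.
have [_ /(_ _ mX) <-] := scales_measure_affine b c0.
congr (leb2 _); apply/seteqP; split=> p /=;
  by rewrite -/(complex_of_pair _) complex_of_pairK.
Qed.

End PlaneAffine.

(** * Comparison of measures on small squares *)

Section Comparison.
Context {R : realType}.
Local Notation h := (2^-1 : R).

Lemma measure_square_split (mu : {measure set R[i] -> \bar R}) (S1 S2 S3 S4 : set R[i]) (a : R[i]) (l : R) :
  0 < l ->
  measurable S1 -> measurable S2 -> measurable S3 -> measurable S4 ->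
  S1 `<=` square (shift_corner a l 0 0) (h * l) ->
  S2 `<=` square (shift_corner a l h 0) (h * l) ->
  S3 `<=` square (shift_corner a l 0 h) (h * l) ->
  S4 `<=` square (shift_corner a l h h) (h * l) ->
  mu (S1 `|` S2 `|` (S3 `|` S4)) = (mu S1 + mu S2 + (mu S3 + mu S4))%E.
Proof.
move=> l0 m1 m2 m3 m4 s1 s2 s3 s4.
rewrite !measureU//; try exact: measurableU.
- apply/seteqP; split=> // z [/s3 z3 /s4 z4]; move: z3 z4.
  by rewrite /square /= => -[/andP[? ?] _] [/andP[? ?] _]; exfalso; lra.
- apply/seteqP; split=> // z [/s1 z3 /s2 z4]; move: z3 z4.
  by rewrite /square /= => -[/andP[? ?] _] [/andP[? ?] _]; exfalso; lra.
- apply/seteqP; split=> // z [z12 z34].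
  have [z1 z2] : Im z < Im a + h * l /\ Im a + h * l <= Im z; last by lra.
  by split; [case: z12 => [/s1|/s2]|case: z34 => [/s3|/s4]];
    rewrite /square /= => -[_ /andP[? ?]]; lra.
Qed.

(** If mu1 exceeds mu2 by more than e' times the area on a square, it does so on
    one of its four quarters. The squares obtained in this way shrink to a point
    of O, where the local hypothesis forbids such an excess. The corner a' need
    not be p: the bound 4 * l' on its distance is the one that [bisection]
    gives. *)
Lemma comparison_square (mu1 mu2 : {measure set R[i] -> \bar R}) (O : set R[i]) (a : R[i]) (l : R) :
  (forall p, O p -> forall e : R, 0 < e -> exists2 d : R, 0 < d &
     forall a' l', 0 < l' < d -> normc (a' - p) <= 4 * l' ->
       (mu1 (square a' l') <= mu2 (square a' l') + (e * l' ^+ 2)%:E)%E) ->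
  0 < l -> closed_square a l `<=` O -> (mu1 (square a l) <= mu2 (square a l))%E.
Proof.
move=> loc l0 aO; apply/lee_addgt0Pr => e e0; rewrite leNgt; apply/negP => big.
(* the excess per unit of area *)
pose e' := e / l ^+ 2.
have e'0 : 0 < e' by rewrite divr_gt0// exprn_gt0.
pose bad n (t : R[i]) := closed_square t (l / 2 ^+ n) `<=` closed_square a l /\
  (mu2 (square t (l / 2 ^+ n)) + (e' * (l / 2 ^+ n) ^+ 2)%:E < mu1 (square t (l / 2 ^+ n)))%E.
have ln0 n : 0 < l / 2 ^+ n by rewrite divr_gt0// exprn_gt0.
have [||p hp] := @bisection R R[i] id bad l a.
- split; first by rewrite expr0 divr1.
  by rewrite expr0 divr1 /e' divfK// expf_neq0// gt_eqF.
- move=> n t [tsub tbig].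
  have lS : l / 2 ^+ n.+1 = h * (l / 2 ^+ n) by rewrite exprS invfM; ring.
  set m := l / 2 ^+ n in tsub tbig lS *.
  have m0 : 0 < m by exact: ln0.
  have sub x y : (x == 0) || (x == h) -> (y == 0) || (y == h) ->
      closed_square (shift_corner t m x y) (h * m) `<=` closed_square a l.
    move=> xh yh; apply: subset_trans tsub => z [/= /andP[x0 x1] /andP[y0 y1]].
    by move: xh yh => /orP[]/eqP xE /orP[]/eqP yE; rewrite xE yE in x0 x1 y0 y1;
      split; apply/andP; split; lra.
  have near x y : (x == 0) || (x == h) -> (y == 0) || (y == h) ->
      normc (shift_corner t m x y - t) <= m.
    move=> xh yh; apply: (le_trans (normc_le_ReIm _)); rewrite ReB ImB /=.
    have b01 k : (k == 0) || (k == h) -> 0 <= k <= h.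
      by move=> /orP[]/eqP->; apply/andP; split; lra.
    have /andP[x0 x1] := b01 x xh; have /andP[y0 y1] := b01 y yh.
    have -> : Re t + x * m - Re t = x * m by ring.
    have -> : Im t + y * m - Im t = y * m by ring.
    rewrite (ger0_norm (mulr_ge0 x0 (ltW m0))) (ger0_norm (mulr_ge0 y0 (ltW m0))).
    by have := ler_wpM2r (ltW m0) x1; have := ler_wpM2r (ltW m0) y1 => ? ?; lra.
  have quarter x y : (x == 0) || (x == h) -> (y == 0) || (y == h) ->
      (mu2 (square (shift_corner t m x y) (h * m)) + (e' * (h * m) ^+ 2)%:E <
       mu1 (square (shift_corner t m x y) (h * m)))%E ->
      exists2 t', bad n.+1 t' & normc (id t' - id t) <= m.
    move=> xh yh q; exists (shift_corner t m x y); last exact: near.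
    by rewrite /bad lS; split; first exact: sub.
  have b0 : ((0 : R) == 0) || ((0 : R) == h) by rewrite eqxx.
  have bh : (h == 0) || (h == h) by rewrite eqxx orbT.
  have [q1|q1] := ltP (mu2 (square (shift_corner t m 0 0) (h * m)) + (e' * (h * m) ^+ 2)%:E)%E
       (mu1 (square (shift_corner t m 0 0) (h * m))); first exact: quarter q1.
  have [q2|q2] := ltP (mu2 (square (shift_corner t m h 0) (h * m)) + (e' * (h * m) ^+ 2)%:E)%E
       (mu1 (square (shift_corner t m h 0) (h * m))); first exact: quarter q2.
  have [q3|q3] := ltP (mu2 (square (shift_corner t m 0 h) (h * m)) + (e' * (h * m) ^+ 2)%:E)%E
       (mu1 (square (shift_corner t m 0 h) (h * m))); first exact: quarter q3.
  have [q4|q4] := ltP (mu2 (square (shift_corner t m h h) (h * m)) + (e' * (h * m) ^+ 2)%:E)%E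
       (mu1 (square (shift_corner t m h h) (h * m))); first exact: quarter q4.
  exfalso; move: tbig; rewrite ltNge => /negP; apply.
  have := leeD (leeD q1 q2) (leeD q3 q4).
  have sp (mu : {measure set R[i] -> \bar R}) :
     mu (square t m) = (mu (square (shift_corner t m 0 0) (h * m)) +
     mu (square (shift_corner t m h 0) (h * m)) +
     (mu (square (shift_corner t m 0 h) (h * m)) + mu (square (shift_corner t m h h) (h * m))))%E.
    rewrite {1}(square_split t m0) (@measure_square_split mu _ _ _ _ t m)//;
      exact: measurable_square.
  rewrite (addeACA (mu2 (square (shift_corner t m 0 0) _))).
  rewrite (addeACA (mu2 (square (shift_corner t m 0 h) _))).
  rewrite (addeACA (mu2 _ + mu2 _)%E) -!EFinD -!sp.
  by congr (_ <= _ + _%:E)%E; field.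
have Op : O p.
  apply: aO.
  have lo n t : closed_square t (l / 2 ^+ n) `<=` closed_square a l ->
      [/\ Re a <= Re t, Re t <= Re a + l, Im a <= Im t & Im t <= Im a + l].
    move=> /(_ t) []; first by split; apply/andP; split; rewrite ?lerDl// ltW.
    by move=> /andP[? ?] /andP[? ?].
  have key n : exists t : R[i], [/\ Re a <= Re t, Re t <= Re a + l, Im a <= Im t & Im t <= Im a + l] /\
      normc (t - p) <= 4 * l / 2 ^+ n.
    by have [t [ts _] tp] := hp n; exists t; split=> //; exact: lo ts.
  split; apply/andP; split; rewrite -subr_le0; apply: (@le0_eventually _ _ (4 * l)) => n;
    have [t [[? ? ? ?] tp]] := key n;
    have := le_trans (Re_le_normc _) tp; have := le_trans (Im_le_normc _) tp;
    rewrite ReB ImB !ler_norml => /andP[? ?] /andP[? ?]; lra.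
have [d d0 hd] := loc p Op e' e'0.
have [n hn] := exp2_lt_eventually (divr_gt0 d0 l0).
have [t [_ tbig] tp] := hp n.
move: tbig; rewrite ltNge => /negP; apply; apply: hd; last by rewrite mulrA.
by rewrite ln0 /=; move: hn; rewrite ltr_pdivlMr// mulrC.
Qed.

Lemma limit_measure_le (mu1 mu2 : {measure set R[i] -> \bar R}) (F : (set R[i])^nat) :
  (forall n, measurable (F n)) -> (forall n m, (n <= m)%N -> F n `<=` F m) ->
  (forall n, (mu1 (F n) <= mu2 (F n))%E) ->
  (mu1 (\bigcup_n F n) <= mu2 (\bigcup_n F n))%E.
Proof.
move=> mF Fmono le; have mU : measurable (\bigcup_n F n) by exact: bigcup_measurable.
have cv : mu1 (F n) @[n --> \oo] --> mu1 (\bigcup_n F n).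
  by apply: nondecreasing_cvg_mu => // n m nm; apply/subsetPset; exact: Fmono.
apply: cvge_le cv; apply: nearW => n; apply: (le_trans (le n)).
by apply: le_measure; rewrite ?inE//; exact: bigcup_sup.
Qed.

(** An open set is the increasing union of finite unions of disjoint dyadic
    squares. *)
Lemma comparison (mu1 mu2 : {measure set R[i] -> \bar R}) (O : set R[i]) : copen O ->
  (forall p, O p -> forall e : R, 0 < e -> exists2 d : R, 0 < d &
     forall a' l', 0 < l' < d -> normc (a' - p) <= 4 * l' ->
       (mu1 (square a' l') <= mu2 (square a' l') + (e * l' ^+ 2)%:E)%E) ->
  (mu1 O <= mu2 O)%E.
Proof.
move=> oO loc.
have dy n a l : 0 < l -> (mu1 (dyadic_inner O n a l) <= mu2 (dyadic_inner O n a l))%E.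
  elim: n a l => [|n IH] a l l0; have [H|H] := pselect (closed_square a l `<=` O).
  - by rewrite dyadic_inner_full//; exact: comparison_square loc _ _.
  - have -> : dyadic_inner O 0 a l = set0 by rewrite /=; case: pselect.
    by rewrite !measure0.
  - by rewrite dyadic_inner_full//; exact: comparison_square loc _ _.
  have hl : 0 < h * l by rewrite mulr_gt0// invr_gt0.
  rewrite dyadic_inner_rec//.
  by rewrite !(@measure_square_split _ _ _ _ _ a l)//;
    try exact: measurable_dyadic_inner; try exact: dyadic_inner_square;
    rewrite !leeD// IH.
rewrite -(setIT O) -exhaust_squares setI_bigcupr.
have l0 (n : nat) : 0 < 2 * n.+1%:R :> R by rewrite mulr_gt0.
apply: limit_measure_le => [n|n m nm z [Oz [/andP[? ?] /andP[? ?]]]|n].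
- rewrite (dyadic_inner_exhaust _ (l0 n) oO).
  by apply: bigcup_measurable => k _; exact: measurable_dyadic_inner.
- split=> //; have : n.+1%:R <= m.+1%:R :> R by rewrite ler_nat.
  by move=> ?; split=> /=; apply/andP; split; simpl in *; lra.
rewrite (dyadic_inner_exhaust _ (l0 n) oO).
apply: limit_measure_le => [k|k m km|k].
- exact: measurable_dyadic_inner.
- exact: dyadic_inner_mono.
- exact: dy.
Qed.

End Comparison.

(** * Change of variables *)

Section DensityMeasure.
Context {R : realType}.
Variables (f : R[i] -> \bar R).

(** The proofs mf and f0 are arguments so that the measure structure is found
    from the term alone. *)
Definition density_measure (mf : measurable_fun setT f) (f0 : forall z, (0 <= f z)%E)
  (A : set R[i]) : \bar R := (\int[plane_measure]_(z in A) f z)%E.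

Variables (mf : measurable_fun setT f) (f0 : forall z, (0 <= f z)%E).

Let density0 : density_measure mf f0 set0 = 0%E.
Proof. exact: integral_set0. Qed.

Let density_ge0 A : (0 <= density_measure mf f0 A)%E.
Proof. by apply: integral_ge0. Qed.

Let density_sigma_additive : semi_sigma_additive (density_measure mf f0).
Proof.
move=> F mF tF mUF; rewrite /density_measure ge0_integral_bigcup//; last first.
  exact: measurable_funTS.
by apply: is_cvg_ereal_nneg_natsum => n _; exact: integral_ge0.
Qed.

HB.instance Definition _ := isMeasure.Build _ _ _
  (density_measure mf f0) density0 density_ge0 density_sigma_additive.

End DensityMeasure.

Section ChangeOfVariables.
Context {R : realType}.
Local Notation pm := (@plane_measure R).

Lemma integral_restrictE (D E : set R[i]) (f : R[i] -> \bar R) :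
  D `<=` E -> (\int[pm]_(z in D) f z = \int[pm]_(z in D) (f \_ E) z)%E.
Proof.
move=> DE; apply: eq_integral => z /set_mem Dz; rewrite patchE mem_set//; exact: DE.
Qed.

Lemma small_error (U C e : R) : 0 <= U -> 0 <= C -> 0 < e -> exists eta : R,
  [/\ 0 < eta, eta <= 1 & (U + eta) * (C + 4 * eta) ^+ 2 + eta <= U * C ^+ 2 + e].
Proof.
move=> U0 C0 e0.
(* for eta <= 1 the left-hand side is at most U * C ^+ 2 + eta * A *)
pose A := 1 + C ^+ 2 + (U + 1) * (8 * C + 16).
have A0 : 0 < A.
  by rewrite /A -addrA ltr_wpDr// addr_ge0 ?sqr_ge0// mulr_ge0// addr_ge0// mulr_ge0.
pose eta := Num.min 1 (e / A).
have eta0 : 0 < eta by rewrite lt_min ltr01 divr_gt0.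
have eta1 : eta <= 1 by rewrite ge_min lexx.
have etaA : eta * A <= e by rewrite -ler_pdivlMr// ge_min lexx orbT.
exists eta; split=> //; clearbody eta.
have h1 : eta * eta <= eta by rewrite -[leRHS]mulr1 ler_wpM2l// ltW.
have h2 : 0 <= C * eta by rewrite mulr_ge0// ltW.
have h3 : (U + eta) * (8 * C * eta + 16 * (eta * eta)) <= (U + 1) * ((8 * C + 16) * eta).
  apply: ler_pM; rewrite ?addr_ge0 ?mulr_ge0 ?(ltW eta0)//; first by lra.
  by lra.
rewrite /A in etaA; move: etaA h3 => ? ?.
have E : (U + eta) * (C + 4 * eta) ^+ 2 + eta = U * C ^+ 2 + eta * C ^+ 2 +
   (U + eta) * (8 * C * eta + 16 * (eta * eta)) + eta by ring.
rewrite E.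
have E2 : eta * (1 + C ^+ 2 + (U + 1) * (8 * C + 16)) = eta + eta * C ^+ 2 +
   (U + 1) * ((8 * C + 16) * eta) by ring.
by lra.
Qed.

(** On the square, phi is within eta * l of the similarity with factor c. If c is
    not 0, the inverse similarity T moves the image of the square to within
    k = eta * l / normc c of the square itself, hence into one of side l + 4 * k;
    if c is 0, the image lies in a square of side 4 * eta * l. *)
Lemma image_square_area (phi : R[i] -> R[i]) (p a c : R[i]) (l eta : R) :
  0 < l -> 0 < eta ->
  (forall z, square a l z -> normc (phi z - phi p - c * (z - p)) <= eta * l) ->
  exists2 P : set R[i], measurable P /\ (forall z, square a l z -> P (phi z)) &
    (pm P <= ((normc c + 4 * eta) ^+ 2 * l ^+ 2)%:E)%E.
Proof.
move=> l0 eta0 hphi; have [c0|c0] := eqVneq c 0.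
  pose b : R[i] := phi p - Complex (eta * l) (eta * l).
  have el0 : 0 < eta * l by rewrite mulr_gt0.
  exists (square b (4 * eta * l)); first split; first exact: measurable_square.
    move=> z /hphi; rewrite c0 mul0r subr0 => zp.
    have := le_trans (Re_le_normc _) zp; have := le_trans (Im_le_normc _) zp.
    rewrite ReB ImB !ler_norml => /andP[? ?] /andP[? ?].
    by rewrite /square /b /= ReB ImB /=; split; apply/andP; split; lra.
  rewrite plane_measure_square; last by rewrite !mulr_ge0// ltW.
  by rewrite lee_fin c0 normcc0 add0r exprMn.
have n0 : 0 < normc c by rewrite normc_gt0.
pose k := eta * l / normc c.
have k0 : 0 < k by rewrite divr_gt0// mulr_gt0.
pose b : R[i] := a - Complex k k.
pose T w := (p - c^-1 * phi p) + c^-1 * w.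
exists (T @^-1` square b (l + 4 * k)).
  split; first by apply: preimage_measurableT; [exact: measurable_affine|exact: measurable_square].
  move=> z zs; have zp := hphi z zs; rewrite /preimage /=.
  have D : normc (T (phi z) - z) <= k.
    have -> : T (phi z) - z = c^-1 * (phi z - phi p - c * (z - p)) by rewrite /T; field.
    by rewrite normcM normcV /k mulrC ler_pM2r// invr_gt0.
  have := le_trans (Re_le_normc _) D; have := le_trans (Im_le_normc _) D.
  rewrite !ReB !ImB !ler_norml => /andP[? ?] /andP[? ?].
  by case: zs => /andP[? ?] /andP[? ?]; rewrite /square /b /= ReB ImB /=; split; apply/andP; split; lra.
rewrite plane_measure_affine ?invr_eq0//; last exact: measurable_square.
rewrite plane_measure_square; last by clear -l0 k0; lra.
rewrite -EFinM lee_fin normcV invrK -!exprMn le_eqVlt; apply/orP; left; apply/eqP.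
by congr (_ ^+ 2); rewrite /k; field; rewrite gt_eqF.
Qed.

Lemma rccontM (g k : R[i] -> R) z : rccont g z -> rccont k z -> rccont (fun w => g w * k w) z.
Proof.
move=> gc kc e e0.
have G0 : 0 < `|g z| + 1 by rewrite ltr_wpDl.
have K0 : 0 < `|k z| + 1 by rewrite ltr_wpDl.
have e2 : 0 < e / 2 by exact: divr_gt0.
have [r r0 hr] := gc _ (divr_gt0 e2 K0).
have [q q0 hq] := kc _ (divr_gt0 e2 G0).
have [t t0 ht] := kc _ ltr01.
exists (Num.min r (Num.min q t)) => [|w]; first by rewrite !lt_min r0 q0.
rewrite !lt_min => /and3P[/hr wr /hq wq /ht wt].
have kw : `|k w| <= `|k z| + 1.
  by have := ler_normD (k w - k z) (k z); rewrite subrK => ?; lra.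
have -> : g w * k w - g z * k z = (g w - g z) * k w + g z * (k w - k z) by ring.
apply: (le_lt_trans (ler_normD _ _)); rewrite !normrM (splitr e) ltr_leD//.
  apply: (@le_lt_trans _ _ (`|g w - g z| * (`|k z| + 1))); first by rewrite ler_wpM2l.
  by rewrite -ltr_pdivlMr.
apply: (@le_trans _ _ ((`|g z| + 1) * `|k w - k z|)); first by rewrite ler_wpM2r// lerDl.
by rewrite mulrC -ler_pdivlMr// ltW.
Qed.

(** Let mu1 be the measure u dw pulled back to O by phi, and mu2 the measure
    u (phi z) |phi'|^2 dz. On a square of side l near p the second is
    u (phi p) |phi' p|^2 l^2 up to o(l^2), and by [image_square_area] the first
    is at most that, so [comparison] applies. *)
Lemma integral_image_le (O V : set R[i]) (phi psi dphi : R[i] -> R[i]) (u : R[i] -> R) :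
  copen O -> copen V ->
  (forall z, O z -> V (phi z) /\ psi (phi z) = z) ->
  (forall w, V w -> O (psi w) /\ phi (psi w) = w) ->
  (forall z, O z -> has_cderiv phi z (dphi z)) ->
  (forall z, O z -> ccont dphi z) ->
  (forall w, V w -> ccont psi w) ->
  (forall w, V w -> 0 <= u w) -> (forall w, V w -> rccont u w) ->
  (\int[pm]_(w in V) (u w)%:E <= \int[pm]_(z in O) (u (phi z) * normc (dphi z) ^+ 2)%:E)%E.
Proof.
move=> oO oV fO fV dfO dfc psic u0 uc.
have mO := copen_measurable oO; have mV := copen_measurable oV.
pose v z := u (phi z) * normc (dphi z) ^+ 2.
have v0 z : O z -> 0 <= v z by move=> /fO[Vz _]; rewrite mulr_ge0 ?u0 ?sqr_ge0.
have uphi z : O z -> rccont (fun z => u (phi z)) z.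
  move=> Oz e e0; have [Vz _] := fO z Oz; have [r r0 hr] := uc _ Vz e e0.
  have [q q0 hq] := has_cderiv_cont (dfO z Oz) r0.
  by exists q => // w /hq /hr.
have vc z : O z -> rccont v z.
  move=> Oz; apply: rccontM; first exact: uphi.
  by rewrite /= => e; apply: rccontM; apply: ccont_normc; exact: dfc.
have mu' := rccont_measurable oV uc.
have mv := rccont_measurable oO vc.
pose uV := (fun w => (u w)%:E) \_ V.
pose vO := (fun z => (v z)%:E) \_ O.
have muV : measurable_fun setT uV.
  have muE : measurable_fun V (EFin \o u) by exact/measurable_EFinP.
  exact: (measurable_restrictT _ mV).1 muE.
have mvO : measurable_fun setT vO.
  have mvE : measurable_fun O (EFin \o v) by exact/measurable_EFinP.
  exact: (measurable_restrictT _ mO).1 mvE.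
have uV0 w : (0 <= uV w)%E.
  by rewrite /uV patchE; case: ifPn => // /set_mem Vw; rewrite lee_fin u0.
have vO0 z : (0 <= vO z)%E.
  by rewrite /vO patchE; case: ifPn => // /set_mem Oz; rewrite lee_fin v0.
have mpsi : measurable_fun setT (psi \_ V).
  have mp : measurable_fun V psi by exact: ccont_measurable.
  exact: (measurable_restrictT _ mV).1 mp.
pose mu1 : {measure set R[i] -> \bar R} := image_measure (density_measure muV uV0) mpsi.
pose mu2 : {measure set R[i] -> \bar R} := density_measure mvO vO0.
have main : (mu1 O <= mu2 O)%E.
  apply: comparison => // p Op e e0.
  have [Vp psip] := fO p Op.
  set c := dphi p; set U := u (phi p).
  have U0 : 0 <= U by exact: u0.
  have [eta [eta0 eta1 heta]] := small_error U0 (normc_ge0 c) e0.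
  have [r1 r10 h1] := oO p Op.
  have [r2 r20 h2] := dfO p Op (eta / 6) (divr_gt0 eta0 (ltr0Sn _ _)).
  have [r3 r30 h3] := uphi p Op _ eta0.
  have [r4 r40 h4] := vc p Op _ eta0.
  pose r := Num.min (Num.min r1 r2) (Num.min r3 r4).
  have r0 : 0 < r by rewrite !lt_min r10 r20 r30.
  exists (r / 6); first by rewrite divr_gt0.
  move=> a l /andP[l0 lr] ap.
  (* 4 * l from p to the corner and 2 * l inside the square *)
  have near z : square a l z -> normc (z - p) <= 6 * l.
    move=> [/andP[? ?] /andP[? ?]].
    have : normc (z - a) <= 2 * l.
      apply: (le_trans (normc_le_ReIm _)); rewrite ReB ImB !ger0_norm; lra.
    by have := normc_dist a z p => ? ?; lra.
  have near' z : square a l z -> normc (z - p) < r.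
    by move=> /near zp; apply: (le_lt_trans zp); lra.
  have all z : square a l z -> [/\ O z,
      normc (phi z - phi p - c * (z - p)) <= eta * l,
      u (phi z) <= U + eta & v p <= v z + eta].
    move=> zs; have := near' z zs; rewrite !lt_min => /andP[/andP[zr1 zr2] /andP[zr3 zr4]].
    have := h3 z zr3; have := h4 z zr4; rewrite !ltr_norml => /andP[? ?] /andP[? ?].
    split; [exact: h1 | | rewrite /U; lra | lra].
    apply: (le_trans (h2 z zr2)).
    have := ler_wpM2l (divr_ge0 (ltW eta0) (ler0n R 6)) (near z zs).
    by move=> h; apply: (le_trans h); rewrite le_eqVlt; apply/orP; left; apply/eqP; field.
  have [P [mP sP] areaP] := image_square_area l0 eta0 (fun z zs => let: And4 _ h _ _ := all z zs in h).
  have ms := measurable_square a l.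
  have le1 : (mu1 (square a l) <= ((U + eta) * ((normc c + 4 * eta) ^+ 2 * l ^+ 2))%:E)%E.
    pose Q := (psi \_ V) @^-1` square a l.
    have mQ : measurable Q by exact: preimage_measurableT.
    apply: (@le_trans _ _ (\int[pm]_(w in Q) ((U + eta)%:E * (\1_P w)%:E))%E).
      apply: ge0_le_integral => //.
      - exact: measurable_funTS.
      - apply: measurable_funTS; apply: measurable_funeM.
        exact/measurable_EFinP/measurable_indic.
      - move=> w; rewrite /Q /= /uV !patchE; case: ifPn => [/set_mem Vw|_ _]; last first.
          by rewrite mule_ge0 ?lee_fin ?indicE ?ler0n// addr_ge0// ltW.
        have [Ow <-] := fV w Vw; rewrite (fO _ Ow).2 => ws.
        have [_ _ uw _] := all _ ws.
        by rewrite indicE mem_set ?mule1 ?lee_fin//; exact: sP.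
    have mP1 : measurable_fun Q (fun w => (\1_P w : R)%:E).
      apply: measurable_funTS; exact/measurable_EFinP/measurable_indic.
    have P0 w : Q w -> (0 <= (\1_P w : R)%:E)%E by move=> _; rewrite lee_fin indicE ler0n.
    have Ue0 : (0 <= (U + eta)%:E)%E by rewrite lee_fin addr_ge0// ltW.
    rewrite (ge0_integralZl pm mQ mP1 P0 Ue0).
    rewrite integral_indic// EFinM lee_pmul2l//.
    + apply: le_trans areaP; apply: le_measure.
      * by apply/mem_set; exact: measurableI.
      * exact/mem_set.
      * exact: subIsetl.
    + by rewrite lte_fin ltr_wpDl.
  have le2 : ((v p * l ^+ 2)%:E <= mu2 (square a l) + (eta * l ^+ 2)%:E)%E.
    have E k : (\int[pm]_(z in square a l) (cst k%:E z) = (k * l ^+ 2)%:E)%E.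
      by rewrite integral_cst// plane_measure_square ?(ltW l0)// EFinM.
    rewrite -!E -ge0_integralD//; last first.
    - by move=> z _; rewrite lee_fin ltW.
    - exact: measurable_funTS.
    apply: ge0_le_integral => //.
    - by move=> z _; rewrite lee_fin v0.
    - by apply: emeasurable_funD => //; exact: measurable_funTS.
    - move=> z zs; have [Oz _ _ vz] := all z zs.
      by rewrite /cst /vO patchE mem_set// -EFinD lee_fin.
  have l2 : 0 < l ^+ 2 by exact: exprn_gt0.
  apply: (le_trans le1); move: le2.
  case: (mu2 (square a l)) (measure_ge0 mu2 (square a l)) => [m _| |//]; last first.
    by move=> _ _; rewrite addye// leey.
  rewrite -!EFinD !lee_fin => le2.
  have := ler_wpM2r (ltW l2) heta.
  rewrite -[U * normc c ^+ 2]/(v p) => le3; move: le2 le3; lra.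
have -> : (\int[pm]_(z in O) (u (phi z) * normc (dphi z) ^+ 2)%:E = mu2 O)%E.
  exact: integral_restrictE.
apply: (le_trans _ main).
have mQ : measurable ((psi \_ V) @^-1` O) by exact: preimage_measurableT.
have muVQ : measurable_fun ((psi \_ V) @^-1` O) uV by exact: measurable_funTS.
have -> : mu1 O = (\int[pm]_(w in (psi \_ V) @^-1` O) uV w)%E by [].
rewrite (@integral_restrictE V V (fun w => (u w)%:E))//.
apply: (ge0_subset_integral pm mV mQ muVQ (fun w _ => uV0 w)).
by move=> w Vw /=; rewrite patchE mem_set//; exact: (fV w Vw).1.
Qed.

End ChangeOfVariables.

Section Univalent.
Context {R : realType}.
Local Notation pm := (@plane_measure R).
Local Notation D := (unit_disk : set R[i]).
Implicit Types (f phi : R[i] -> R[i]) (u : R[i] -> R).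

Lemma holomorphicP f : holomorphic_on_disk f <-> holo f.
Proof.
split=> [fh z z1|fh z /unit_diskE z1].
  by exists (cderive f z); apply: derivable_cderiv; apply: fh; exact/unit_diskE.
by have [d fd] := fh z z1; exact: has_cderiv_derivable fd.
Qed.

Lemma ccont_comp f g z : ccont f (g z) -> ccont g z -> ccont (fun w => f (g w)) z.
Proof.
move=> fc gc e e0; have [r r0 hr] := fc e e0; have [q q0 hq] := gc r r0.
by exists q => // w /hq /hr.
Qed.

Lemma disk_copen (r : R) : copen [set z : R[i] | normc z < r].
Proof.
move=> z /= zr; exists (r - normc z) => [|w wz]; first by rewrite subr_gt0.
by have := normc_triangle (w - z) z; rewrite subrK /= => ?; lra.
Qed.

Lemma unit_disk_set : D = [set z | normc z < 1].
Proof. by apply/seteqP; split=> z /unit_diskE. Qed.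

Lemma unit_disk_copen : copen D.
Proof. by rewrite unit_disk_set; exact: disk_copen. Qed.

Lemma image_copen phi : holo phi -> set_inj unit_disk phi -> copen (phi @` D).
Proof.
move=> ph pinj _ [z /unit_diskE z1 <-].
have [d d0 hd] := open_mapping ph pinj z1 ltr01.
by exists d => // w /hd[y [_ y1 <-]]; exists y => //; exact/unit_diskE.
Qed.

Lemma integral_image_univalent_le phi u : holo phi -> set_inj unit_disk phi ->
  (forall w, (phi @` D) w -> 0 <= u w) -> (forall w, (phi @` D) w -> rccont u w) ->
  (\int[pm]_(w in phi @` D) (u w)%:E <=
   \int[pm]_(z in D) (u (phi z) * normc (cderive phi z) ^+ 2)%:E)%E.
Proof.
move=> ph pinj u0 uc.
apply: (@integral_image_le _ D (phi @` D) phi (inverse_on phi) (cderive phi) u) => //.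
- exact: unit_disk_copen.
- exact: image_copen.
- move=> z Dz; split; first by exists z.
  by rewrite inverse_onK//; exact/unit_diskE.
- move=> _ [z Dz <-]; rewrite inverse_onK//; exact/unit_diskE.
- by move=> z /unit_diskE z1; exact: holo_cderiv.
- by move=> z /unit_diskE z1; exact: cderive_cont.
- by move=> _ [z /unit_diskE z1 <-]; exact: inverse_on_cont.
Qed.

(** This is [integral_image_le] for the inverse of phi on the open set where phi'
    is not 0; at the zeros of phi' the integrand vanishes. *)
Lemma integral_univalent_le phi u : holo phi -> set_inj unit_disk phi ->
  (forall w, (phi @` D) w -> 0 <= u w) -> (forall w, (phi @` D) w -> rccont u w) ->
  (\int[pm]_(z in D) (u (phi z) * normc (cderive phi z) ^+ 2)%:E <=
   \int[pm]_(w in phi @` D) (u w)%:E)%E.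
Proof.
move=> ph pinj u0 uc.
pose psi := inverse_on phi.
pose O := [set z : R[i] | D z /\ cderive phi z != 0].
pose V := phi @` O.
pose v z := u (phi z) * normc (cderive phi z) ^+ 2.
have psiK z : normc z < 1 -> psi (phi z) = z by exact: inverse_onK.
have oO : copen O.
  move=> z [Dz dz0]; have z1 : normc z < 1 by exact/unit_diskE.
  have [r r0 hr] := unit_disk_copen Dz.
  have n0 : 0 < normc (cderive phi z) by rewrite normc_gt0.
  have [q q0 hq] := cderive_cont ph z1 n0.
  exists (Num.min r q) => [|w]; first by rewrite lt_min r0.
  rewrite lt_min => /andP[wr wq]; split; first exact: hr w wr.
  apply/eqP => w0; have := hq w wq; rewrite w0 sub0r normc_opp.
  by rewrite ltxx.
have psic w : (phi @` D) w -> ccont psi w.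
  by move=> [z /unit_diskE z1 <-]; exact: inverse_on_cont.
have oV : copen V.
  move=> _ [z [Dz dz0] <-].
  have VD : (phi @` D) (phi z) by exists z.
  have [r r0 hr] := image_copen ph pinj VD.
  have [q q0 hq] := oO z (conj Dz dz0).
  have [t t0 ht] := psic _ VD _ q0.
  exists (Num.min r t) => [|w]; first by rewrite lt_min r0.
  rewrite lt_min => /andP[/hr[y Dy <-] /ht].
  rewrite !psiK; [|exact/unit_diskE|exact/unit_diskE].
  by move=> /hq Oy; exists y.
have E1 : (\int[pm]_(z in D) (v z)%:E = \int[pm]_(z in O) (v z)%:E)%E.
  rewrite [LHS]integral_mkcond [RHS]integral_mkcond; congr (integral _ _ _).
  apply/funext => z; rewrite !patchE.
  have [dz0|dz0] := eqVneq (cderive phi z) 0.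
    rewrite (_ : (z \in O) = false); last by apply/negbTE; rewrite notin_setE => -[_]; rewrite dz0 eqxx.
    by case: ifP => // _; rewrite /v dz0 normcc0 expr0n mulr0.
  rewrite (_ : (z \in O) = (z \in D))//.
  by apply/idP/idP => [/set_mem[]|] /mem_set// /set_mem Dz; apply/mem_set; split=> //; exact/set_mem.
rewrite -/(v _) E1.
apply: (@le_trans _ _ (\int[pm]_(w in V) (v (psi w) *
   normc ((cderive phi (psi w))^-1) ^+ 2)%:E)%E).
  have vc z : O z -> rccont v z.
    move=> [Dz _]; have z1 : normc z < 1 by exact/unit_diskE.
    apply: rccontM.
      move=> e e0; have [r r0 hr] := uc (phi z) (ex_intro2 _ _ z Dz erefl) e e0.
      have [q q0 hq] := has_cderiv_cont (holo_cderiv ph z1) r0.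
      by exists q => // w /hq /hr.
    have nc : rccont (fun z => normc (cderive phi z)) z by apply: ccont_normc; exact: cderive_cont.
    by move=> e; exact: rccontM.
  apply: (@integral_image_le _ V O psi phi (fun w => (cderive phi (psi w))^-1) v) => //.
  - move=> _ [z [Dz dz0] <-]; rewrite psiK; [by []|exact/unit_diskE].
  - move=> z Oz; split; first by exists z.
    by rewrite psiK//; exact/unit_diskE/Oz.1.
  - move=> _ [z [/unit_diskE z1 dz0] <-]; rewrite psiK//.
    by apply: inverse_on_deriv => //; exact: holo_cderiv.
  - move=> w [z [Dz dz0] zw]; have z1 : normc z < 1 by exact/unit_diskE.
    have pw : psi w = z by rewrite -zw psiK.
    apply: (@ccont_comp (fun x => x^-1) (fun w => cderive phi (psi w))).
      have := has_cderiv_cont (has_cderiv_invB dz0); rewrite pw.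
      by rewrite (_ : (fun w => _) = (fun x => x^-1))//; apply/funext => x; rewrite subr0.
    apply: ccont_comp; first by rewrite pw; exact: cderive_cont.
    by apply: psic; exists z.
  - by move=> z [/unit_diskE z1 _]; apply: has_cderiv_cont (holo_cderiv ph z1).
  - by move=> z [Dz _]; rewrite mulr_ge0 ?sqr_ge0// u0//; exists z.
have E2 : (\int[pm]_(w in V) (v (psi w) * normc ((cderive phi (psi w))^-1) ^+ 2)%:E
   = \int[pm]_(w in V) (u w)%:E)%E.
  apply: eq_integral => w /set_mem[z [/unit_diskE z1 dz0] <-].
  rewrite psiK// /v normcV -mulrA -exprMn mulfV ?normc_eq0//.
  by rewrite expr1n mulr1.
rewrite E2; have mI := copen_measurable (image_copen ph pinj).
apply: (ge0_subset_integral pm (copen_measurable oV) mI).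
- apply/measurable_EFinP; apply: rccont_measurable => //; exact: image_copen.
- by move=> w Iw; rewrite lee_fin u0.
- by move=> _ [z [Dz _] <-]; exists z.
Qed.

Lemma cderive_sqr_rccont f z : holo f -> normc z < 1 ->
  rccont (fun z => normc (cderive f z) ^+ 2) z.
Proof.
move=> fh z1; have nc : rccont (fun z => normc (cderive f z)) z.
  by apply: ccont_normc; exact: cderive_cont.
by move=> e; exact: rccontM.
Qed.

Lemma measurable_cderive_sqr f (S : set R[i]) : holo f -> S `<=` D -> measurable S ->
  measurable_fun S (fun z => (normc (cderive f z) ^+ 2)%:E).
Proof.
move=> fh SD mS; have mD := copen_measurable unit_disk_copen.
have mf : measurable_fun D (fun z => normc (cderive f z) ^+ 2).
  apply: rccont_measurable; first exact: unit_disk_copen.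
  by move=> z /unit_diskE z1; exact: cderive_sqr_rccont.
have mE : measurable_fun D (EFin \o (fun z => normc (cderive f z) ^+ 2)).
  exact/measurable_EFinP.
exact: measurable_funS mD SD mE.
Qed.

Definition energy (S : set R[i]) f : \bar R :=
  (\int[pm]_(z in S) (normc (cderive f z) ^+ 2)%:E)%E.

Lemma dirichlet_integralE f : holo f ->
  dirichlet_integral f = ((pi^-1)%:E * energy D f)%E.
Proof.
move=> fh; rewrite /dirichlet_integral /energy.
have mD := copen_measurable unit_disk_copen.
have mf := measurable_cderive_sqr fh (@subset_refl _ D) mD.
set H := (fun z : R[i] => (normc (cderive f z) ^+ 2)%:E) in mf *.
have H0 z : (0 <= H z)%E by rewrite lee_fin sqr_ge0.
have mk := @measurable_complex_of_pair R.
have mKD : measurable (complex_of_pair @^-1` D : set (measurableTypeR R * measurableTypeR R)).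
  exact: preimage_measurableT mk mD.
have mHk : measurable_fun (complex_of_pair @^-1` D) (H \o complex_of_pair).
  apply: (measurable_comp mD) => //; first by move=> _ [p Dp <-].
  exact: measurable_funTS.
have -> : (\int[pm]_(z in D) H z = \int[(@lebesgue_measure R \x @lebesgue_measure R)]_(p in
    complex_of_pair @^-1` D) (H \o complex_of_pair) p)%E.
  by apply: (ge0_integral_pushforward mk _ mD mf) => z _; exact: H0.
exact: (ge0_integral_mscale _ mKD _ mHk (fun p _ => H0 _)).
Qed.

End Univalent.

(** * Energy on smaller disks *)

Section RootsOfUnity.
Context {R : realType}.
Local Notation C := R[i].

Lemma prim_root_exists (n : nat) : (0 < n)%N -> exists w : C, n.-primitive_root w.
Proof.
move=> n0; pose p : {poly C} := 'X^n - 1.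
have [r Dp] := closed_field_poly_normal p.
rewrite (monicP (monicXnsubC 1 n0)) scale1r in Dp.
have unity : all n.-unity_root r by apply/allP => z; rewrite -root_prod_XsubC -Dp.
have many : (n < (size r).+1)%N by rewrite -(size_prod_XsubC r id) -Dp size_XnsubC.
have distinct : uniq r.
  by rewrite -separable_prod_XsubC -Dp separable_Xn_sub_1// pnatr_eq0 -lt0n.
by have /hasP[z _ zp] := has_prim_root n0 unity distinct many; exists z.
Qed.

Lemma normc_prim_root n (w : C) : (0 < n)%N -> w ^+ n = 1 -> normc w = 1.
Proof.
move=> n0 wn; apply/eqP; rewrite -(@pexpr_eq1 _ _ n)// ?normc_ge0//.
by rewrite -normcX wn normcc1.
Qed.

Lemma normc_sqrC (z : C) : ((normc z) ^+ 2)%:C = z * conjc z.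
Proof.
rewrite normc_sqr; case: z => a b /=; apply/eqP; rewrite eq_complex /=.
by apply/andP; split; apply/eqP; ring.
Qed.

(** Parseval's identity for the discrete Fourier transform: after expanding the
    squares, the sum over l of the powers of w ^ k / w ^ j vanishes for k != j. *)
Lemma finite_parseval n (w : C) (c : nat -> C) (z : C) : n.-primitive_root w ->
  \sum_(l < n) normc (\sum_(k < n) c k * (w ^+ l * z) ^+ k) ^+ 2 =
  n%:R * \sum_(k < n) normc (c k * z ^+ k) ^+ 2.
Proof.
move=> wp; have n0 := prim_order_gt0 wp.
have wn : w ^+ n = 1 := prim_expr_order wp.
have w1 := normc_prim_root n0 wn.
have wz : w != 0 by rewrite -normc_gt0 w1.
apply: complexI; rewrite rmorphM rmorph_nat !rmorph_sum /=.
have conjw : conjc w = w^-1.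
  apply: (mulfI wz); rewrite -normc_sqrC w1 expr1n divff//.
transitivity (\sum_(l < n) \sum_(k < n) \sum_(j < n)
   (c k * z ^+ k) * conjc (c j * z ^+ j) * (w ^+ k / w ^+ j) ^+ l).
  apply: eq_bigr => l _; rewrite normc_sqrC rmorph_sum big_distrlr /=.
  apply: eq_bigr => k _; apply: eq_bigr => j _.
  rewrite !rmorphM !rmorphXn /= !rmorphM /= !rmorphXn /= conjw !exprMn !exprVn -!exprM.
  rewrite (mulnC l k) (mulnC l j) -!exprVn; ring.
rewrite exchange_big big_distrr /=; apply: eq_bigr => k _.
rewrite exchange_big /= (bigD1 k)//= [X in _ + X]big1 ?addr0.
  rewrite divff ?expf_neq0//.
  under eq_bigr do rewrite expr1n mulr1.
  by rewrite sumr_const card_ord normc_sqrC mulr_natl.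
move=> j jk; rewrite -big_distrr /=.
set x := w ^+ k / w ^+ j.
have x1 : x - 1 != 0.
  rewrite subr_eq0; apply/eqP => xe.
  have : w ^+ k == w ^+ j by rewrite -(divr1_eq xe).
  rewrite (eq_prim_root_expr wp) !modn_small//.
  by move=> /eqP/ord_inj kj; rewrite kj eqxx in jk.
have xn : x ^+ n = 1.
  by rewrite /x expr_div_n -!exprM !(mulnC _ n) !exprM wn !expr1n divr1.
suff -> : \sum_(i < n) x ^+ i = 0 by rewrite mulr0.
by apply: (mulfI x1); rewrite -subrX1 xn subrr mulr0.
Qed.

End RootsOfUnity.

Section Contraction.
Context {R : realType}.
Local Notation pm := (@plane_measure R).
Local Notation D := (unit_disk : set R[i]).
Implicit Types (f : R[i] -> R[i]).

Definition disk (r : R) : set R[i] := [set z | normc z < r].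

Lemma disk_sub (r : R) : r <= 1 -> disk r `<=` D.
Proof. by move=> r1 z zr; apply/unit_diskE; exact: lt_le_trans r1. Qed.

Lemma measurable_disk (r : R) : measurable (disk r).
Proof. by apply: copen_measurable; exact: disk_copen. Qed.

Lemma disk_measure_fin (r : R) : (pm (disk r) < +oo)%E.
Proof.
have [r0|r0] := leP r 0.
  suff -> : disk r = set0 by rewrite measure0.
  by apply/seteqP; split=> // z zr; have := le_lt_trans (normc_ge0 z) zr; rewrite ltNge r0.
apply: (@le_lt_trans _ _ (pm (square (Complex (- r) (- r)) (2 * r)))).
  apply: le_measure.
  - by apply/mem_set; exact: measurable_disk.
  - by apply/mem_set; exact: measurable_square.
  - move=> z zr; have := le_lt_trans (Re_le_normc z) zr; have := le_lt_trans (Im_le_normc z) zr.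
    rewrite !ltr_norml => /andP[? ?] /andP[? ?].
    by split=> /=; apply/andP; split; lra.
by rewrite plane_measure_square ?ltry// mulr_ge0// ltW.
Qed.

Lemma integral_dilation (c : R[i]) (X : set R[i]) (G : R[i] -> \bar R) : c != 0 ->
  measurable X -> measurable_fun X G -> (forall z, (0 <= G z)%E) ->
  (\int[pm]_(z in (fun w => 0 + c * w)%R @^-1` X) G (0 + c * z)%R =
   ((normc c)^-1 ^+ 2)%:E * \int[pm]_(z in X) G z)%E.
Proof.
move=> c0 mX mG G0.
have mT := measurable_affine 0 c.
have k0 : 0 <= (normc c)^-1 ^+ 2 by rewrite sqr_ge0.
transitivity (\int[mscale (NngNum k0) pm]_(z in X) G z)%E; last first.
  by rewrite (ge0_integral_mscale _ mX _ mG).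
transitivity (\int[image_measure pm mT]_(z in X) G z)%E.
  by apply/esym; apply: (ge0_integral_pushforward mT pm mX mG) => z _; exact: G0.
apply: eq_measure_integral => A mA _.
exact: plane_measure_affine.
Qed.

Lemma integral_disk_dilation (c : R[i]) (r : R) (G : R[i] -> \bar R) : c != 0 ->
  measurable_fun (disk (normc c * r)) G -> (forall z, (0 <= G z)%E) ->
  (\int[pm]_(z in disk (normc c * r)) G z =
   ((normc c) ^+ 2)%:E * \int[pm]_(z in disk r) G (c * z)%R)%E.
Proof.
move=> c0 mG G0; have n0 : 0 < normc c by rewrite normc_gt0.
have := integral_dilation c0 (measurable_disk _) mG G0.
have -> : (fun w => 0 + c * w) @^-1` disk (normc c * r) = disk r.
  by apply/seteqP; split=> z; rewrite /disk /= add0r normcM ltr_pM2l.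
have -> : (fun z => G (0 + c * z)%R) = (fun z => G (c * z)%R).
  by apply/funext => z; rewrite add0r.
move=> ->; rewrite muleA -EFinM -exprMn mulfV ?expr1n ?mul1e// gt_eqF//.
Qed.

(** For a polynomial P of degree less than n, [finite_parseval] shows that the
    mean of |P|^2 over the vertices of a regular n-gon increases with the radius.
    On a disk of radius s < 1 the derivative of f is a uniform limit of
    polynomials; the number of vertices depends on the error e. *)
Lemma polygon_mean_le f (r s e : R) : holo f -> 0 < s < 1 -> 0 <= r <= 1 -> 0 < e ->
  exists n (w : R[i]), [/\ (0 < n)%N, normc w = 1 & forall z, normc z < s ->
    \sum_(l < n) normc (cderive f (r%:C * w ^+ l * z)) ^+ 2 <=
    \sum_(l < n) (normc (cderive f (w ^+ l * z)) ^+ 2 + e)].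
Proof.
move=> fh /andP[s0 s1] /andP[r0 r1] e0.
have [M M0 hM] : exists2 M : R, 0 < M & forall z, normc (z - 0) <= s -> normc (cderive f z) <= M.
  apply: closed_disk_bounded; first exact: ltW.
  by move=> z; rewrite subr0 => zs; apply: cderive_cont => //; exact: le_lt_trans zs s1.
pose d := Num.min 1 (e / 2 / (2 * M + 1)).
have K0 : 0 < 2 * M + 1 by rewrite ltr_wpDl// mulr_ge0// ltW.
have d0 : 0 < d by rewrite lt_min ltr01 !divr_gt0.
have d1 : d <= 1 by rewrite ge_min lexx.
have dK : d * (2 * M + 1) <= e / 2 by rewrite -ler_pdivlMr// ge_min lexx orbT.
clearbody d.
have sI : 0 <= s < 1 by rewrite ltW.
have [n [c hc]] := cderive_poly_approx fh sI d0.
have [w wp] := prim_root_exists (R := R) (ltn0Sn n).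
have w1 : normc w = 1 := normc_prim_root (ltn0Sn n) (prim_expr_order wp).
exists n.+1, w; split=> // z zs.
pose c' k := if (k < n)%N then c k else 0.
pose P x := \sum_(k < n.+1) c' k * x ^+ k.
have PE x : P x = \sum_(k < n) c k * x ^+ k.
  rewrite /P big_ord_recr /= /c' ltnn mul0r addr0.
  by apply: eq_bigr => k _; rewrite ltn_ord.
have close x : normc x <= s ->
    normc (cderive f x) ^+ 2 <= normc (P x) ^+ 2 + e / 2 /\
    normc (P x) ^+ 2 <= normc (cderive f x) ^+ 2 + e / 2.
  move=> xs; have := hc x xs; rewrite -PE => h.
  have /andP[a1 a2] : - d <= normc (cderive f x) - normc (P x) <= d.
    by rewrite -ler_norml (le_trans (normc_dist2 _ _)).
  have hx : normc (cderive f x) <= M by apply: hM; rewrite subr0.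
  have p0 := normc_ge0 (P x); have h0 := normc_ge0 (cderive f x).
  set A := normc (cderive f x) in hx h0 a1 a2 *; set B := normc (P x) in p0 a1 a2 *.
  have AB : A + B <= 2 * M + 1 by lra.
  have AB0 : 0 <= A + B by exact: addr_ge0.
  have t1 : (A - B) * (A + B) <= d * (2 * M + 1).
    by apply: (@le_trans _ _ (d * (A + B))); [rewrite ler_wpM2r | rewrite ler_wpM2l// ltW].
  have t2 : (B - A) * (A + B) <= d * (2 * M + 1).
    apply: (@le_trans _ _ (d * (A + B))); last by rewrite ler_wpM2l// ltW.
    by rewrite ler_wpM2r//; lra.
  have e1 : (A - B) * (A + B) = A ^+ 2 - B ^+ 2 by ring.
  have e2 : (B - A) * (A + B) = B ^+ 2 - A ^+ 2 by ring.
  by rewrite e1 in t1; rewrite e2 in t2; split; lra.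
have wl (l : nat) : normc (w ^+ l * z) <= s by rewrite normcM normcX w1 expr1n mul1r ltW.
have rwl (l : nat) : normc (r%:C * w ^+ l * z) <= s.
  rewrite -mulrA normcM normc_real ger0_norm//.
  by apply: (le_trans _ (wl l)); rewrite ler_piMl ?normc_ge0.
apply: (@le_trans _ _ (\sum_(l < n.+1) (normc (P (r%:C * w ^+ l * z)) ^+ 2 + e / 2))).
  by apply: ler_sum => l _; exact: (close _ (rwl l)).1.
apply: (@le_trans _ _ (\sum_(l < n.+1) (normc (P (w ^+ l * z)) ^+ 2 + e / 2))); last first.
  apply: ler_sum => l _; have := (close _ (wl l)).2 => h; lra.
rewrite !big_split /= lerD2r.
have -> : \sum_(l < n.+1) normc (P (r%:C * w ^+ l * z)) ^+ 2 =
    \sum_(l < n.+1) normc (\sum_(k < n.+1) c' k * (w ^+ l * (r%:C * z)) ^+ k) ^+ 2.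
  by apply: eq_bigr => l _; rewrite /P; congr (normc _ ^+ 2); apply: eq_bigr => k _;
    rewrite (mulrC r%:C) -mulrA.
rewrite !(finite_parseval c' _ wp) ler_wpM2l//.
apply: ler_sum => k _; apply: lerXn2r; rewrite ?nnegrE ?normc_ge0//.
rewrite !normcM ler_wpM2l ?normc_ge0// !normcX normcM normc_real ger0_norm//.
apply: lerXn2r; rewrite ?nnegrE ?mulr_ge0 ?normc_ge0//.
by rewrite ler_piMl ?normc_ge0.
Qed.

(** The inequality of [polygon_mean_le] is integrated over z in disk s: by
    rotation invariance every vertex contributes the same integral. The error
    e / (m + 1), where m is the area of the disk, makes the total error at
    most e. *)
Lemma energy_disk_le f (r s : R) : holo f -> 0 < s < 1 -> 0 < r <= 1 ->
  (energy (disk (r * s)) f <= (r ^+ 2)%:E * energy (disk s) f)%E.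
Proof.
move=> fh sI /andP[r0 r1]; have /andP[s0 s1] := sI.
pose H z := (normc (cderive f z) ^+ 2)%:E.
have HE z : H z = (normc (cderive f z) ^+ 2)%:E by [].
have EH (t : R) : energy (disk t) f = (\int[pm]_(z in disk t) H z)%E by [].
have H0 z : (0 <= H z)%E by rewrite lee_fin sqr_ge0.
have mH (t : R) : t <= 1 -> measurable_fun (disk t) H.
  move=> t1; apply: measurable_cderive_sqr => //; first exact: disk_sub.
  exact: measurable_disk.
rewrite !EH; clearbody H.
have mHc (c : R[i]) : normc c <= 1 -> measurable_fun (disk s) (fun z => H (c * z)).
  move=> c1; apply: (measurable_comp (measurable_disk s) (g := fun z => c * z)).
  - move=> _ [z zs <-]; rewrite /disk /= normcM.
    by apply: le_lt_trans zs; rewrite ler_piMl ?normc_ge0.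
  - by apply: mH; exact: ltW.
  - apply: measurable_funTS; have := measurable_affine 0 c.
    by congr measurable_fun; apply/funext => z; rewrite add0r.
have rc0 : r%:C != 0 by rewrite -normc_gt0 normc_real normr_gt0 gt_eqF.
have rn : normc r%:C = r by rewrite normc_real ger0_norm// ltW.
have rs1 : r * s <= 1.
  by apply: (@le_trans _ _ (1 * s)); [rewrite ler_wpM2r// ltW | rewrite mul1r ltW].
have E1 : (\int[pm]_(z in disk (r * s)) H z)%E =
    ((r ^+ 2)%:E * \int[pm]_(z in disk s) H (r%:C * z)%R)%E.
  have := @integral_disk_dilation r%:C s H rc0; rewrite rn => h.
  exact: (h (mH _ rs1) H0).
rewrite E1; apply: lee_wpmul2l; first by rewrite lee_fin sqr_ge0.
have rot (w : R[i]) l (c : R[i]) : normc w = 1 -> normc c <= 1 ->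
    (\int[pm]_(z in disk s) H (c * w ^+ l * z)%R = \int[pm]_(z in disk s) H (c * z)%R)%E.
  move=> w1 c1; have wl1 : normc (w ^+ l) = 1 by rewrite normcX w1 expr1n.
  have wl0 : w ^+ l != 0 by rewrite -normc_gt0 wl1.
  have := @integral_disk_dilation (w ^+ l) s (fun z => H (c * z)) wl0.
  rewrite wl1 (mul1r s) expr1n mul1e => h.
  have {}h := h (mHc c c1) (fun z => H0 _).
  transitivity (\int[pm]_(z in disk s) H (c * (w ^+ l * z))%R)%E; last exact: esym h.
  by apply: eq_integral => z _; rewrite (mulrA c).
apply/lee_addgt0Pr => e e0.
have [m mE] : exists m : R, pm (disk s) = m%:E.
  exists (fine (pm (disk s))); rewrite fineK// ge0_fin_numE ?measure_ge0//.
  exact: disk_measure_fin.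
have m0 : 0 <= m by rewrite -lee_fin -mE measure_ge0.
have m1 : 0 < m + 1 by rewrite ltr_wpDl.
have rI : 0 <= r <= 1 by rewrite ltW.
have [n [w [n0 w1 hw]]] := polygon_mean_le fh sI rI (divr_gt0 e0 m1).
have sumH (c : R[i]) : normc c <= 1 ->
   (\int[pm]_(z in disk s) \sum_(l < n) H (c * w ^+ l * z)%R =
    n%:R%:E * \int[pm]_(z in disk s) H (c * z)%R)%E.
  move=> c1; rewrite ge0_integral_sum//; first last.
  - by move=> l; apply: mHc; rewrite normcM normcX w1 expr1n mulr1.
  - exact: measurable_disk.
  under eq_bigr do rewrite rot//.
  by rewrite sumr_const card_ord; apply/esym; exact: mule_natl.
have nE0 : (0 < n%:R%:E :> \bar R)%E by rewrite lte_fin ltr0n.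
rewrite -(lee_pmul2l _ nE0)//.
rewrite -sumH; last by rewrite rn.
have E2 : (n%:R%:E * (\int[pm]_(z in disk s) H z + e%:E) =
   n%:R%:E * \int[pm]_(z in disk s) H (1 * z)%R + n%:R%:E * e%:E)%E.
  rewrite ge0_muleDr ?lee_fin ?(ltW e0)//; last by apply: integral_ge0 => z _; exact: H0.
  by congr (_ * _ + _)%E; apply: eq_integral => z _; rewrite mul1r.
rewrite E2 -sumH ?normcc1//.
apply: (@le_trans _ _ (\int[pm]_(z in disk s)
    (\sum_(l < n) H (1 * w ^+ l * z)%R + (n%:R * (e / (m + 1)))%:E))%E).
  apply: ge0_le_integral => //.
  - exact: measurable_disk.
  - by move=> z _; apply: sume_ge0 => l _; exact: H0.
  - apply: emeasurable_sum => l; apply: mHc.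
    by rewrite normcM normcX w1 expr1n mulr1 rn.
  - apply: emeasurable_funD => //; apply: emeasurable_sum => l; apply: mHc.
    by rewrite mul1r normcX w1 expr1n.
  - move=> z zs.
    have sE (c : R[i]) : (\sum_(l < n) H (c * w ^+ l * z)%R =
        (\sum_(l < n) normc (cderive f (c * w ^+ l * z)) ^+ 2)%R%:E)%E.
      by rewrite -sumEFin; apply: eq_bigr => l _; exact: HE.
    rewrite !sE -EFinD lee_fin; apply: (le_trans (hw z zs)).
    have -> : n%:R * (e / (m + 1)) = \sum_(l < n) (e / (m + 1)).
      by rewrite sumr_const card_ord mulr_natl.
    by rewrite -big_split; apply: ler_sum => l _; rewrite mul1r.
rewrite ge0_integralD//; last first.
- by move=> z _; rewrite lee_fin mulr_ge0// divr_ge0 ?(ltW e0) ?(ltW m1).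
- apply: emeasurable_sum => l; apply: mHc.
  by rewrite mul1r normcX w1 expr1n.
- by move=> z _; apply: sume_ge0 => l _; exact: H0.
- exact: measurable_disk.
apply: leeD => //.
rewrite integral_cst ?mE -?EFinM ?lee_fin; last exact: measurable_disk.
rewrite -mulrA ler_wpM2l// mulrAC ler_pdivrMr// ler_wpM2l ?(ltW e0)//.
by rewrite lerDl.
Qed.

(** The radius sqrt r is interposed because [energy_disk_le] compares disks of
    radius less than 1; this costs a square root in the ratio, the bound
    r ^+ 2 being the sharp one. *)
Lemma energy_small_disk_le f (r : R) : holo f -> 0 < r < 1 ->
  (energy (disk r) f <= r%:E * energy D f)%E.
Proof.
move=> fh /andP[r0 r1]; pose s := Num.sqrt r.
have s0 : 0 < s by rewrite sqrtr_gt0.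
have ss : s ^+ 2 = r by rewrite sqr_sqrtr// ltW.
have s1 : s < 1 by rewrite -(@ltr_pXn2r _ 2)// ?nnegrE ?(ltW s0)// ss expr1n.
have -> : disk r = disk (s * s) by rewrite -expr2 ss.
have sI : 0 < s < 1 by rewrite s0.
have sI' : 0 < s <= 1 by rewrite s0 ltW.
apply: (le_trans (energy_disk_le fh sI sI')); rewrite ss lee_pmul2l ?lte_fin//.
have mD := copen_measurable (@unit_disk_copen R).
apply: (ge0_subset_integral pm (measurable_disk s) mD).
- exact: measurable_cderive_sqr.
- by move=> z _; rewrite lee_fin sqr_ge0.
- by apply: disk_sub; exact: ltW.
Qed.

End Contraction.

(** * Sets that are null on almost every circle *)

Section Radial.
Context {R : realType}.
Local Notation mR := (measurableTypeR R).
Local Notation leb := (@lebesgue_measure R).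
Local Notation leb2 := (leb \x leb)%E.
Local Notation pm := (@plane_measure R).
Local Notation D := (unit_disk : set R[i]).

Lemma negligible_translation (c : R) (N : set mR) : leb.-negligible N ->
  leb.-negligible ((fun y => y + c) @^-1` N).
Proof.
move=> [B [mB B0 NB]]; exists ((fun y : mR => (y + c : mR)) @^-1` B); split.
- by apply: preimage_measurableT mB; exact: measurable_funD.
- by rewrite -B0; exact: lebesgue_translation.
- by move=> x /NB.
Qed.

Lemma negligible_scaling (r : R) (N : set mR) : 0 < r -> leb.-negligible N ->
  leb.-negligible ((fun y => r * y) @^-1` N).
Proof.
move=> r0 [B [mB B0 NB]]; exists ((fun y : mR => (r * y : mR)) @^-1` B); split.
- by apply: preimage_measurableT mB; exact: measurable_funM.
- by apply: etrans (lebesgue_scaling r0 mB) _; rewrite B0 mule0.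
- by move=> x /NB.
Qed.

Lemma measurable_circ : measurable_fun [set: mR * mR] (fun p => circ p.1 p.2 : R[i]).
Proof.
have mcos : measurable_fun [set: mR * mR] (fun p => cos p.2 : mR).
  have mcos : measurable_fun [set: mR] (cos : mR -> mR).
    by apply: continuous_measurable_fun; exact: continuous_cos.
  exact: (measurableT_comp mcos measurable_snd).
have msin : measurable_fun [set: mR * mR] (fun p => sin p.2 : mR).
  have msin : measurable_fun [set: mR] (sin : mR -> mR).
    by apply: continuous_measurable_fun; exact: continuous_sin.
  exact: (measurableT_comp msin measurable_snd).
apply: measurable_fun_complex.
- rewrite (_ : (fun _ => _) = (fun p : mR * mR => p.1 * cos p.2)); first exact: measurable_funM.
  by apply/funext => p; rewrite /circ ReM /= mul0r subr0.
- rewrite (_ : (fun _ => _) = (fun p : mR * mR => p.1 * sin p.2)); first exact: measurable_funM.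
  by apply/funext => p; rewrite /circ ImM /= mul0r addr0.
Qed.

Lemma measurable_funM_complex d (T : measurableType d) (f g : T -> R[i]) :
  measurable_fun setT f -> measurable_fun setT g -> measurable_fun setT (fun t => f t * g t).
Proof.
move=> mf mg.
have mRe (h : T -> R[i]) : measurable_fun setT h -> measurable_fun setT (fun t => Re (h t) : mR).
  by move=> mh; exact: measurableT_comp (@measurable_Re R) mh.
have mIm (h : T -> R[i]) : measurable_fun setT h -> measurable_fun setT (fun t => Im (h t) : mR).
  by move=> mh; exact: measurableT_comp (@measurable_Im R) mh.
apply: measurable_fun_complex.
- rewrite (_ : (fun _ => _) = (fun t => Re (f t) * Re (g t) - Im (f t) * Im (g t))).
    by apply: measurable_funB; apply: measurable_funM; [exact: mRe|exact: mRe|exact: mIm|exact: mIm].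
  by apply/funext => t; rewrite ReM.
- rewrite (_ : (fun _ => _) = (fun t => Re (f t) * Im (g t) + Im (f t) * Re (g t))).
    by apply: measurable_funD; apply: measurable_funM; [exact: mRe|exact: mIm|exact: mIm|exact: mRe].
  by apply/funext => t; rewrite ImM.
Qed.

Lemma circM (r s t u : R) : circ r t * circ s u = circ (r * s) (t + u) :> R[i].
Proof.
rewrite /circ /cis cosD sinD; apply/eqP; rewrite eq_complex /=.
by apply/andP; split; apply/eqP; ring.
Qed.

Lemma circ_turn (r t : R) : circ r (t + 2 * pi) = circ r t :> R[i].
Proof. by rewrite /circ /cis mulr_natl cosD2pi sinD2pi. Qed.

Lemma null_sections (A : set (mR * mR)) : measurable A ->
  leb.-negligible [set x | leb (xsection A x) != 0%E] -> leb2 A = 0%E.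
Proof.
move=> mA [N [mN N0 hN]]; rewrite /product_measure1.
transitivity (\int[leb]_(x in [set: mR]) (cst 0%E x : \bar R))%E; last exact: integral0.
apply: ge0_ae_eq_integral => //.
- exact: measurable_fun_xsection.
- exists N; split=> // x /= /not_implyP[_ xn]; apply: hN => /=.
  exact/eqP.
Qed.

(** For 0 <= t <= 2 * pi the angle t + b is, modulo one turn, again in that
    interval, so the set is covered by two translates of a null set. *)
Lemma circle_turn_null (S : set R[i]) (r b : R) : measurable S -> 0 <= b <= 2 * pi ->
  leb.-negligible [set t | 0 <= t <= 2 * pi /\ S (circ r t)] ->
  leb.-negligible [set t | 0 <= t <= 2 * pi /\ S (circ r (t + b))].
Proof.
move=> mS /andP[b0 b1] N0.
apply: negligibleS (negligibleU (negligible_translation b N0)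
   (negligible_translation (b - 2 * pi) N0)).
move=> t [/andP[t0 t1] St] /=.
have [tb|tb] := leP (t + b) (2 * pi); [left|right]; split=> //.
- by rewrite addr_ge0.
- by apply/andP; split; lra.
- by rewrite -circ_turn addrA subrK.
Qed.

Definition annular_sector : set (mR * mR) := [set p | 1 <= p.1 <= 2 /\ 0 <= p.2 <= 2 * pi].

Lemma annular_sectorE : annular_sector = `[1, 2]%classic `*` `[0, 2 * pi]%classic.
Proof. by apply/seteqP; split=> p; rewrite /annular_sector /= !in_itv. Qed.

Lemma measurable_annular_sector : measurable annular_sector.
Proof. by rewrite annular_sectorE; exact: measurableX. Qed.

(** In polar coordinates z = circ (normc z) b, multiplication by circ t u scales
    the radius by t and shifts the angle by u: the exceptional radii are
    scaled, and for the other radii the angular section is null. *)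
Lemma null_multiples (S : set R[i]) (z : R[i]) : measurable S -> S `<=` D -> z != 0 ->
  {ae leb, forall r, 0 <= r < 1 ->
    {ae leb, forall t, 0 <= t <= 2 * pi -> ~ S (circ r t)}} ->
  leb2 [set p | annular_sector p /\ S (circ p.1 p.2 * z)] = 0%E.
Proof.
move=> mS SD z0 aeS.
have mA : measurable [set p | annular_sector p /\ S (circ p.1 p.2 * z)].
  apply: measurableI; first exact: measurable_annular_sector.
  apply: (@preimage_measurableT _ _ _ _ (fun p : mR * mR => circ p.1 p.2 * z)) => //.
  by apply: measurable_funM_complex => //; exact: measurable_circ.
have n0 : 0 < normc z by rewrite normc_gt0.
have [b b0 zb] := circP z.
apply: null_sections => //.
apply: negligibleS (negligible_scaling n0 aeS) => t /= /eqP tn.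
rewrite /setC /= => tS; apply: tn.
apply: measure_negligible; first exact: measurable_xsection.
have [t1|t1] := boolP (1 <= t); last first.
  apply: negligibleS (@negligible_set0 _ _ _ leb) => u; rewrite /xsection /= inE => -[[/andP[]]].
  by rewrite (negbTE t1).
have nz : 0 <= normc z * t by rewrite mulr_ge0 ?normc_ge0// (le_trans ler01).
have E1 u : circ t u * z = circ (normc z * t) (u + b).
  by rewrite [in LHS]zb circM (mulrC t).
have [nt|nt] := leP 1 (normc z * t).
  apply: negligibleS (@negligible_set0 _ _ _ leb) => u; rewrite /xsection /= inE /= E1 => -[_ /SD].
  by move/unit_diskE; rewrite normc_circ// ltNge nt.
have rI : 0 <= normc z * t < 1 by rewrite nz.
have {}tS := tS rI.
have tN : leb.-negligible [set u | 0 <= u <= 2 * pi /\ S (circ (normc z * t) u)].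
  by apply: negligibleS tS => u [u0 Su] /= h; exact: h u0 Su.
apply: negligibleS (circle_turn_null mS b0 tN).
by move=> u; rewrite /xsection /= inE /= E1 => -[[_ u0] Su].
Qed.

Lemma plane_measure_set0 : pm [set 0] = 0%E.
Proof.
rewrite plane_measureE (_ : _ @^-1` _ = [set 0] `*` [set 0]).
  rewrite product_measure1E//; try exact: measurable_set1.
  by rewrite [X in (X * _)%E]lebesgue_measure_set1 mul0e.
apply/seteqP; split=> -[x y] /=.
  by move=> [-> ->].
by move=> [-> ->].
Qed.

Lemma lebesgue_plane_sigma_finite : sigma_finite [set: mR * mR] leb2.
Proof.
pose F n : set R[i] := square (Complex (- n.+1%:R) (- n.+1%:R)) (2 * n.+1%:R).
exists (fun n => complex_of_pair @^-1` F n).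
  by rewrite -preimage_bigcup exhaust_squares preimage_setT.
move=> n; split; first exact: preimage_measurableT (@measurable_complex_of_pair R) (measurable_square _ _).
by rewrite -plane_measureE plane_measure_square ?ltry// mulr_ge0.
Qed.

(** A name for the product measure that carries sigma-finiteness as an
    instance. *)
Definition lebesgue_plane : set (mR * mR) -> \bar R := leb2.

HB.instance Definition _ := Measure.on lebesgue_plane.

HB.instance Definition _ := Measure_isSigmaFinite.Build _ _ _ lebesgue_plane
  lebesgue_plane_sigma_finite.

(** Integrate the indicator of circ t u * z in S over (t, u) in the sector
    1 <= t <= 2, 0 <= u <= 2 pi, and over z in the plane. For fixed z != 0 the
    integral over (t, u) is 0 by [null_multiples]. For fixed (t, u) the integral
    over z is the measure of S divided by t ^ 2, hence at least a quarter of it.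
    By Tonelli's theorem S is null. This replaces the change of variables to
    polar coordinates. *)
Lemma radial_null (S : set R[i]) : measurable S -> S `<=` D ->
  {ae leb, forall r, 0 <= r < 1 ->
    {ae leb, forall t, 0 <= t <= 2 * pi -> ~ S (polar r t)}} -> pm S = 0%E.
Proof.
move=> mS SD aeS.
have m0 : measurable [set (0 : R[i])].
  rewrite (_ : [set 0] = [set z : R[i] | Re z = 0] `&` [set z : R[i] | Im z = 0]); last first.
    apply/seteqP; split=> z /=; first by move=> ->.
    by move=> [x y]; apply/eqP; rewrite eq_complex x y /= !eqxx.
  apply: measurableI.
    exact: (preimage_measurableT (@measurable_Re R) (measurable_set1 0)).
  exact: (preimage_measurableT (@measurable_Im R) (measurable_set1 0)).
pose S' := S `\ 0.
have mS' : measurable S' by exact: measurableD.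
suff S'0 : pm S' = 0%E.
  apply/eqP; rewrite -measure_le0 -[leRHS]adde0 -[X in (X + _)%E]S'0 -plane_measure_set0.
  rewrite -measureU//; last first.
    by apply/seteqP; split=> // z [[_ zn] z0].
  apply: le_measure; first by apply/mem_set.
  - by apply/mem_set; exact: measurableU.
  - by move=> z Sz; have [->|z0] := eqVneq z 0; [right | left; split=> //; exact/eqP].
pose E := [set p : (mR * mR) * (mR * mR) | annular_sector p.1 /\
   S' (circ p.1.1 p.1.2 * complex_of_pair p.2)].
have mE : measurable E.
  apply: measurableI.
    apply: (@preimage_measurableT _ _ ((mR * mR) * (mR * mR))%type (mR * mR)%type fst).
      exact: measurable_fst.
    exact: measurable_annular_sector.
  apply: (@preimage_measurableT _ _ ((mR * mR) * (mR * mR))%type _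
    (fun p => circ p.1.1 p.1.2 * complex_of_pair p.2)) => //.
  apply: measurable_funM_complex.
    exact: (measurableT_comp measurable_circ measurable_fst).
  exact: (measurableT_comp (@measurable_complex_of_pair R) measurable_snd).
pose mu2 : {sigma_finite_measure set (mR * mR)%type -> \bar R} := lebesgue_plane.
have mu2E A : mu2 A = leb2 A by [].
clearbody mu2.
have tonelli := indic_fubini_tonelli mu2 mu2 mE.
rewrite (indic_fubini_tonelli_FE mu2 mE) (indic_fubini_tonelli_GE mu2 mE) in tonelli.
have aeS' : {ae leb, forall r, 0 <= r < 1 ->
    {ae leb, forall t, 0 <= t <= 2 * pi -> ~ S' (circ r t)}}.
  apply: negligibleS aeS => r; apply: contra_not => h r01.
  apply: negligibleS (h r01) => t; apply: contra_not => {}h t01.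
  by rewrite -polar_circ => -[/(h t01)].
have G0 : (\int[mu2]_q (mu2 \o ysection E) q = 0)%E.
  apply: integral0_eq => q _; rewrite [LHS]mu2E.
  have [q0|q0] := eqVneq (complex_of_pair q) 0.
    suff -> : ysection E q = set0 by rewrite measure0.
    apply/seteqP; split=> // p.
    move=> /set_mem[_]; rewrite -/((p, q).2).
    have -> : complex_of_pair (p, q).2 = 0 by [].
    by rewrite mulr0 => -[_]; apply.
  rewrite -(null_multiples mS' _ q0 aeS'); last by move=> z [/SD].
  by congr (leb2 _); apply/seteqP; split=> p; rewrite /ysection /= inE.
have F0 p : annular_sector p -> (4^-1%:E * pm S' <= mu2 (xsection E p))%E.
  move=> Wp; have /andP[p1 p2] := Wp.1.
  have pp : 0 < p.1 by exact: lt_le_trans p1.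
  have nc : normc (circ p.1 p.2) = p.1 by rewrite normc_circ// ltW.
  have c0 : circ p.1 p.2 != 0 by rewrite -normc_gt0 nc.
  have -> : mu2 (xsection E p) = pm ((fun w => 0 + circ p.1 p.2 * w) @^-1` S').
    rewrite mu2E plane_measureE; congr (leb2 _); apply/seteqP; split=> q.
      by rewrite /xsection /= inE /= add0r => -[].
    by rewrite /xsection /= inE /= add0r.
  rewrite plane_measure_affine// nc; apply: lee_wpmul2r => //.
  rewrite lee_fin exprVn lef_pV2 ?posrE ?exprn_gt0//.
  by rewrite (_ : 4 = 2 ^+ 2); [rewrite lerXn2r ?nnegrE// ltW | rewrite -natrX].
have W0 : mu2 annular_sector = (2 * pi)%:E.
  rewrite mu2E annular_sectorE product_measure1E// -[RHS]mul1e; congr (_ * _)%E.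
    rewrite [LHS](_ : _ = leb `[1, 2]%classic)// lebesgue_measure_itv/= lte_fin ltr1n -EFinB.
    by congr EFin; lra.
  rewrite [LHS](_ : _ = leb `[0, 2 * pi]%classic)// lebesgue_measure_itv/= lte_fin twopi_gt0.
  by rewrite -EFinB subr0.
have : ((4^-1%:E * pm S') * mu2 annular_sector <= 0)%E.
  rewrite -G0 -tonelli -integral_cst//; last exact: measurable_annular_sector.
  apply: (@le_trans _ _ (\int[mu2]_(p in annular_sector) (mu2 \o xsection E) p)%E).
    apply: ge0_le_integral => //.
    - exact: measurable_annular_sector.
    - by move=> p _; rewrite mule_ge0.
    - by apply: measurable_funTS; exact: measurable_fun_xsection.
  apply: ge0_subset_integral => //; first exact: measurable_annular_sector.
  exact: measurable_fun_xsection.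
rewrite W0; apply: contraPP => /eqP pS; apply/negP; rewrite -ltNge.
by rewrite !mule_gt0 ?lte_fin ?invr_gt0 ?twopi_gt0// lt0e pS measure_ge0.
Qed.

End Radial.

(** * Composition operators *)

Section Composition.
Context {R : realType}.
Local Notation mR := (measurableTypeR R).
Local Notation leb := (@lebesgue_measure R).
Local Notation leb2 := (leb \x leb)%E.
Local Notation pm := (@plane_measure R).
Local Notation D := (unit_disk : set R[i]).
Implicit Types (f phi : R[i] -> R[i]) (S : set R[i]).

Lemma energy_ge0 S f : (0 <= energy S f)%E.
Proof. by apply: integral_ge0 => z _; rewrite lee_fin sqr_ge0. Qed.

Lemma energy_le S1 S2 f : holo f -> measurable S1 -> measurable S2 ->
  S1 `<=` S2 -> S2 `<=` D -> (energy S1 f <= energy S2 f)%E.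
Proof.
move=> fh m1 m2 S12 S2D; apply: (ge0_subset_integral pm m1 m2) => //.
- exact: measurable_cderive_sqr.
- by move=> z _; rewrite lee_fin sqr_ge0.
Qed.

Lemma energy_full S f : holo f -> measurable S -> S `<=` D -> pm (D `\` S) = 0%E ->
  energy S f = energy D f.
Proof.
move=> fh mS SD DS; have mD := copen_measurable (@unit_disk_copen R).
rewrite /energy [RHS](ge0_negligible_integral (measurableD mD mS)) //.
- by congr (integral _ _ _); rewrite setDD setIidr.
- exact: measurable_cderive_sqr.
- by move=> z _; rewrite lee_fin sqr_ge0.
Qed.

Lemma area_plane_measure S : area S = ((pi^-1)%:E * pm S)%E.
Proof. by []. Qed.

Section SelfMap.
Variable phi : R[i] -> R[i].
Hypotheses (ph : holo phi) (phiD : set_fun unit_disk unit_disk phi).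

Lemma normc_self_map z : normc z < 1 -> normc (phi z) < 1.
Proof. by move=> /unit_diskE /phiD /unit_diskE. Qed.

Lemma has_cderiv_composition f z : holo f -> normc z < 1 ->
  has_cderiv (f \o phi) z (cderive f (phi z) * cderive phi z).
Proof.
move=> fh z1; apply: has_cderiv_comp; last exact: holo_cderiv.
by apply: holo_cderiv => //; exact: normc_self_map.
Qed.

Lemma holo_composition f : holo f -> holo (f \o phi).
Proof. by move=> fh z z1; eexists; exact: has_cderiv_composition. Qed.

Lemma energy_composition f : set_inj unit_disk phi -> holo f ->
  energy D (f \o phi) = energy (phi @` D) f.
Proof.
move=> pinj fh; pose u w := normc (cderive f w) ^+ 2.
have -> : energy D (f \o phi) =
    (\int[pm]_(z in D) (u (phi z) * normc (cderive phi z) ^+ 2)%:E)%E.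
  apply: eq_integral => z /set_mem /unit_diskE z1.
  by rewrite (has_cderiv_cderive (has_cderiv_composition fh z1)) normcM exprMn.
have u0 w : (phi @` D) w -> 0 <= u w by move=> _; exact: sqr_ge0.
have uc w : (phi @` D) w -> rccont u w.
  move=> [z /unit_diskE z1 <-]; apply: cderive_sqr_rccont => //.
  exact: normc_self_map.
by apply/eqP; rewrite eq_le integral_univalent_le// integral_image_univalent_le.
Qed.

(** Otherwise |phi|, which is 0 at 0, takes the value r on a segment from 0. *)
Lemma image_inside (r : R) : phi 0 = 0 -> 0 < r ->
  (forall z, D z -> normc (phi z) != r) -> phi @` D `<=` disk r.
Proof.
move=> phi0 r0 hr _ [z /unit_diskE z1 <-]; rewrite /disk /= ltNge; apply/negP => rz.
have tz t : 0 <= t <= 1 -> normc (0 + t%:C * z) < 1.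
  move=> /andP[t0 t1]; rewrite add0r normcM normc_real ger0_norm//.
  by apply: le_lt_trans z1; rewrite ler_piMl ?normc_ge0.
have ct : pconts 0 1 (fun t => (normc (phi (0 + t%:C * z)))%:C).
  move=> t tI; apply: (@pcont_comp _ (fun w => (normc (phi w))%:C)).
    have pc : ccont phi (0 + t%:C * z) by apply: holo_cont => //; exact: tz.
    move=> e /pc[d d0 h]; exists d => // w /h; apply: le_lt_trans.
    rewrite (_ : _ - _ = (normc (phi w) - normc (phi (0 + t%:C * z)))%:C).
      by rewrite normc_real normc_dist2.
    by rewrite rmorphB.
  exact: has_rderiv_pcont (has_rderiv_line _ _ _).
have [c1 _] := pconts_within ct.
have [|t tI /= ht] := IVT (v := r) ler01 c1.
  rewrite /= mul0r addr0 phi0 normcc0 mul1r add0r.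
  by rewrite ge_min le_max rz (ltW r0) orbT.
move: tI; rewrite in_itv /= => tI.
by have /unit_diskE/hr := tz _ tI; rewrite ht eqxx.
Qed.

End SelfMap.

Lemma dirichlet0P f : dirichlet0 f <-> [/\ holo f, (dirichlet_integral f < +oo)%E & f 0 = 0].
Proof. by split=> [[[/holomorphicP]]|[/holomorphicP]]. Qed.

Lemma dirichlet_integral_ge0 f : holo f -> (0 <= dirichlet_integral f)%E.
Proof.
move=> fh; rewrite dirichlet_integralE// mule_ge0 ?energy_ge0// lee_fin.
by rewrite invr_ge0 pi_ge0.
Qed.

Lemma dirichlet_norm0 f : f 0 = 0 -> dirichlet_norm f = Num.sqrt (fine (dirichlet_integral f)).
Proof. by move=> f0; rewrite /dirichlet_norm f0 normcc0 expr0n add0r. Qed.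

Lemma dirichlet_integral_le f g (k : R) : holo f -> holo g ->
  (energy D g <= k%:E * energy D f)%E ->
  (dirichlet_integral g <= k%:E * dirichlet_integral f)%E.
Proof.
move=> fh gh fg; rewrite !dirichlet_integralE// muleCA.
by apply: lee_wpmul2l => //; rewrite lee_fin invr_ge0 pi_ge0.
Qed.

Lemma dirichlet_norm_le f g (k : R) : 0 <= k -> dirichlet0 f -> holo g -> g 0 = 0 ->
  (energy D g <= k%:E * energy D f)%E ->
  dirichlet0 g /\ dirichlet_norm g <= Num.sqrt k * dirichlet_norm f.
Proof.
move=> k0 /dirichlet0P[fh ffin f0] gh g0 /(dirichlet_integral_le fh gh) fg.
have f_ge0 := dirichlet_integral_ge0 fh; have g_ge0 := dirichlet_integral_ge0 gh.
rewrite (dirichlet_norm0 f0) (dirichlet_norm0 g0).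
suff [gfin le] : (dirichlet_integral g < +oo)%E /\
    fine (dirichlet_integral g) <= k * fine (dirichlet_integral f).
  by split; [apply/dirichlet0P | rewrite -sqrtrM// ler_wsqrtr].
move: (dirichlet_integral f) (dirichlet_integral g) ffin fg f_ge0 g_ge0 => a b.
move=> aoo ba a0 b0; have af : a \is a fin_num by rewrite ge0_fin_numE.
have boo : (b < +oo)%E.
  by apply: (le_lt_trans ba); rewrite -(fineK af) -EFinM ltry.
have bf : b \is a fin_num by rewrite ge0_fin_numE.
by split=> //; rewrite -lee_fin EFinM !fineK.
Qed.

End Composition.

Section Main.
Context {R : realType}.
Local Notation mR := (measurableTypeR R).
Local Notation leb := (@lebesgue_measure R).
Local Notation pm := (@plane_measure R).
Local Notation D := (unit_disk : set R[i]).
Implicit Types (f phi : R[i] -> R[i]) (S : set R[i]).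

Lemma unit_disk_measure : exists2 m : R, 0 < m & pm D = m%:E.
Proof.
have Doo : (pm D < +oo)%E by rewrite unit_disk_set; exact: disk_measure_fin.
have mD := copen_measurable (@unit_disk_copen R).
have Dpos : (0 < pm D)%E.
  apply: (@lt_le_trans _ _ (pm (square 0 (1 / 2)))).
    by rewrite plane_measure_square ?lte_fin// exprn_gt0.
  apply: le_measure; [|exact/mem_set|].
    by apply/mem_set; exact: measurable_square.
  move=> z [] /=; rewrite add0r => /andP[x0 x1] /andP[y0 y1]; apply/unit_diskE.
  apply: (le_lt_trans (normc_le_ReIm z)).
  rewrite !ger0_norm//; lra.
exists (fine (pm D)); last by rewrite fineK// ge0_fin_numE// ltW.
by apply: fine_gt0; rewrite Dpos.
Qed.

(** A multiple of the identity function. *)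
Lemma unit_dirichlet_norm_exists : exists2 f : R[i] -> R[i], dirichlet0 f & dirichlet_norm f = 1.
Proof.
have [m m0 mE] := unit_disk_measure.
have p0 : 0 < pi :> R := pi_gt0 R.
pose c := Num.sqrt (pi / m); pose f w : R[i] := 0 + c%:C * w.
have fd z : has_cderiv f z c%:C := has_cderiv_affine _ _ _.
have fh : holo f by move=> z _; exists c%:C.
have f0 : f 0 = 0 by rewrite /f mulr0 addr0.
have E : dirichlet_integral f = 1%E.
  rewrite dirichlet_integralE//.
  have -> : energy D f = ((pi / m)%:E * pm D)%E.
    rewrite -integral_cst; last exact: copen_measurable (@unit_disk_copen R).
    apply: eq_integral => z _; rewrite (has_cderiv_cderive (fd z)) normc_real.
    by rewrite real_normK ?num_real // sqr_sqrtr ?divr_ge0 ?ltW.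
  by rewrite mE -!EFinM mulfVK ?mulVf ?gt_eqF.
exists f; first by apply/dirichlet0P; split=> //; rewrite E ltry.
by rewrite dirichlet_norm0// E /= sqrtr1.
Qed.

Lemma counting_function1 phi z : set_inj unit_disk phi -> D z ->
  counting_function phi (phi z) = 1%E.
Proof.
move=> pinj Dz; rewrite /counting_function.
have -> : [set y | D y /\ phi y = phi z] = [set z].
  apply/seteqP; split=> [y [Dy /pinj yz]|y ->]; last by [].
  by apply: yz; exact/mem_set.
by rewrite /counting asboolT; [rewrite fset_set1 finmap.cardfs1 | exact: finite_set1].
Qed.

Lemma counting_function0 phi w : ~ (phi @` D) w -> counting_function phi w = 0%E.
Proof.
move=> nw; rewrite /counting_function.
have -> : [set y | D y /\ phi y = w] = set0.
  by apply/seteqP; split=> // y [Dy yw]; apply: nw; exists y.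
by rewrite /counting asboolT; [rewrite fset_set0 finmap.cardfs0 | exact: finite_set0].
Qed.

Lemma interval_not_negligible (N : set mR) (a b : R) : a < b -> leb.-negligible N ->
  exists2 t, a <= t <= b & ~ N t.
Proof.
move=> ab N0; apply: contrapT => h.
suff : leb.-negligible `[a, b]%classic.
  move=> ab0; have : leb `[a, b]%classic = 0%E by apply: measure_negligible ab0.
  rewrite lebesgue_measure_itv /= lte_fin ab -EFinB => -[] /eqP.
  by rewrite subr_eq0 gt_eqF.
apply: negligibleS N0 => t; rewrite /= in_itv /= => tab.
by apply: contrapT => nt; apply: h; exists t.
Qed.

(** The open image of phi contains an arc of each circle. The arc has positive
    length, so it contains an angle outside the exceptional null set, and there
    the counting function is both 1 and g r. Hence g r = 1, and almost every
    point of the circle has a preimage. *)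
Lemma full_of_radial phi : holo phi -> set_fun unit_disk unit_disk phi ->
  set_inj unit_disk phi -> essentially_radial (counting_function phi) -> phi 0 = 0 ->
  (forall r, 0 < r < 1 -> exists2 z, D z & normc (phi z) = r) ->
  pm (D `\` phi @` D) = 0%E.
Proof.
move=> ph phiD pinj [g _ rad] phi0 meet.
have mD := copen_measurable (@unit_disk_copen R).
have oI := image_copen ph pinj.
apply: radial_null.
- by apply: measurableD => //; exact: copen_measurable.
- by move=> z [].
apply: negligibleS rad => r; apply: contra_not => rad r01.
have [r0|r0] := eqVneq r 0.
  apply: negligibleS (@negligible_set0 _ _ _ leb) => t /= /not_implyP[_ /contrapT].
  rewrite polar_circ /circ r0 mul0r => -[_]; apply.
  by exists 0 => //; apply/unit_diskE; rewrite normcc0.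
have rI : 0 < r < 1 by rewrite lt_neqAle eq_sym r0 r01.
have [z Dz zr] := meet r rI.
have [t0 /andP[t00 t01]] := circP (phi z); rewrite zr => zt.
have Iz : (phi @` D) (circ r t0) by rewrite -zt; exists z.
have [d d0 hd] := oI _ Iz.
have [q q0 hq] := (pcontP _ _).1 (has_rderiv_pcont (has_rderiv_circ r t0)) d d0.
have tp := @twopi_gt0 R.
have ab : Num.max 0 (t0 - q / 2) < Num.min (2 * pi) (t0 + q / 2).
  by rewrite gt_max !lt_min tp /=; apply/and3P; split; lra.
pose N := ~` [set t | 0 <= t <= 2 * pi -> counting_function phi (polar r t) = (g r)%:E].
have N0 : leb.-negligible N := rad r01.
have [t] := interval_not_negligible ab N0.
rewrite ge_max le_min => /andP[/andP[t1 t2] /andP[t3 t4]] /contrapT Nt.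
have tg : counting_function phi (polar r t) = (g r)%:E by apply: Nt; rewrite t1.
have It : (phi @` D) (circ r t).
  apply: hd; apply: hq; rewrite ltr_norml; apply/andP; split; lra.
have g1 : (g r)%:E = 1%E :> \bar R.
  by rewrite -tg polar_circ; move: It => [y Dy <-]; exact: counting_function1.
apply: negligibleS N0 => s; apply: contra_not => sg sI [_ nI].
have := sg sI; rewrite counting_function0// g1 => -[] /eqP.
by rewrite eq_sym oner_eq0.
Qed.

Lemma composition_contracts phi (k : R) : holo phi -> set_fun unit_disk unit_disk phi ->
  set_inj unit_disk phi -> phi 0 = 0 -> 0 <= k ->
  (forall f, holo f -> (energy (phi @` D) f <= k%:E * energy D f)%E) ->
  forall f, dirichlet0 f -> dirichlet0 (f \o phi) /\
    dirichlet_norm (f \o phi) <= Num.sqrt k * dirichlet_norm f.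
Proof.
move=> ph phiD pinj phi0 k0 hk f Hf; have [fh _ f0] := (dirichlet0P f).1 Hf.
apply: dirichlet_norm_le => //.
- exact: holo_composition.
- by rewrite /= phi0.
- by rewrite energy_composition//; exact: hk.
Qed.

Lemma operator_norm_le H (T : (R[i] -> R[i]) -> R[i] -> R[i]) (k : R) : 0 <= k ->
  (forall f, H f -> dirichlet_norm (T f) <= k * dirichlet_norm f) ->
  (operator_norm H T <= k%:E)%E.
Proof.
move=> k0 hk; apply: ge_ereal_sup => _ [f [Hf f1] <-]; rewrite lee_fin.
by apply: (le_trans (hk f Hf)); rewrite ler_piMr.
Qed.

End Main.

Theorem theorem2p1 (R : realType) (phi : R[i] -> R[i])
  (phi_holo : holomorphic_on_disk phi)
  (phi_disk : set_fun unit_disk unit_disk phi)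
  (phi_inj : set_inj unit_disk phi)
  (phi_radial : essentially_radial (counting_function phi))
  (phi0 : phi 0 = 0) :
  full_map phi <->
  (set_fun dirichlet0 dirichlet0 (composition_operator phi) /\
   operator_norm dirichlet0 (composition_operator phi) = 1%E).
Proof.
have ph := (holomorphicP phi).1 phi_holo.
have mD := copen_measurable (@unit_disk_copen R).
have mI := copen_measurable (image_copen ph phi_inj).
have ID : phi @` unit_disk `<=` unit_disk by move=> _ [z Dz <-]; exact: phi_disk.
have fullE : full_map phi <-> plane_measure (unit_disk `\` phi @` unit_disk) = 0%E.
  rewrite /full_map area_plane_measure; split=> [|->]; last by rewrite mule0.
  move=> /eqP; rewrite mule_eq0 eqe invr_eq0 gt_eqF ?pi_gt0//=.
  by move=> /eqP.
have contr := composition_contracts ph phi_disk phi_inj phi0.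
split=> [/fullE full|[_ norm1]].
- have hk f : holo f -> (energy (phi @` unit_disk) f <= 1%:E * energy unit_disk f)%E.
    by move=> fh; rewrite mul1e; exact: energy_le.
  have {}contr := contr 1 ler01 hk.
  split; first by move=> f Hf; exact: (contr f Hf).1.
  apply/eqP; rewrite eq_le; apply/andP; split.
    apply: operator_norm_le => // f Hf; rewrite -[X in X * _]sqrtr1.
    exact: (contr f Hf).2.
  have [f Hf f1] := @unit_dirichlet_norm_exists R.
  have [fh _ f0] := (dirichlet0P f).1 Hf.
  have g0 : (f \o phi) 0 = 0 by rewrite /= phi0.
  have fphi : dirichlet_integral (f \o phi) = dirichlet_integral f.
    rewrite (dirichlet_integralE (holo_composition ph phi_disk fh)) (dirichlet_integralE fh).
    by rewrite (energy_composition ph phi_disk phi_inj fh) (energy_full fh mI ID full).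
  apply: ereal_sup_ubound; exists f; first by split; rewrite ?f1.
  by congr EFin; rewrite /composition_operator (dirichlet_norm0 g0) fphi -(dirichlet_norm0 f0).
- apply/fullE/full_of_radial => // r /andP[r0 r1]; apply: contrapT => nr.
  have inside : phi @` unit_disk `<=` disk r.
    apply: image_inside => // z Dz; apply/eqP => zr; apply: nr; by exists z.
  have hk f : holo f -> (energy (phi @` unit_disk) f <= r%:E * energy unit_disk f)%E.
    move=> fh; apply: le_trans (energy_small_disk_le fh _); last by rewrite r0.
    apply: energy_le => //; first exact: measurable_disk.
    by apply: disk_sub; exact: ltW.
  have {}contr := contr r (ltW r0) hk.
  have : (1%E <= (Num.sqrt r)%:E)%E.
    rewrite -norm1; apply: operator_norm_le => [|f Hf]; first exact: sqrtr_ge0.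
    exact: (contr f Hf).2.
  rewrite lee_fin; apply/negP; rewrite -ltNge.
  by rewrite -[ltRHS]sqrtr1 ltr_sqrt.
Qed.
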